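(* Let $\mathcal{A}$ be a central hyperplane arrangement defined over a number field $K$. For any tuple of nonnegative integers $\boldsymbol{\mu}=(\mu_x)_{x\in\mathcal{L}(\mathcal{A})}$, the abscissa of convergence $\alpha(\mathcal{A},\boldsymbol{\mu})$ of the Dirichlet series $\zeta^{\mathrm{ask}}_{\boldsymbol{\mu}_{\mathcal{A}}/\mathcal{O}_K}(s)$ is a positive integer. It satisfies $$\alpha(\mathcal{A},\boldsymbol{\mu})=\max_{x\in\mathcal{L}(\mathcal{A})}\Big\{\dim(\mathcal{A})+1-\mathrm{rk}(x)-\sum_{y\not\le x}\mu_y\Big\}\in[\dim(\mathcal{A})-\mathrm{rk}(\mathcal{A})+1,\ \dim(\mathcal{A})+1],$$ and is independent of $K$.
   Context: Arrangements. A hyperplane arrangement $\mathcal{A}$ over a field $K$ is a finite set of affine hyperplanes in $K^{d}$, $d=\dim(\mathcal{A})$. Its intersection poset $\mathcal{L}(\mathcal{A})$ consists of all non-empty intersections of hyperplanes of $\mathcal{A}$ together with $\hat 0=K^d$, ordered by reverse inclusion and ranked by codimension, $\mathrm{rk}$; $\mathcal{A}$ is central if $\bigcap_{H\in\mathcal{A}}H\neq\varnothing$, and then $\mathrm{rk}(\mathcal{A})$ is the rank of this intersection (the top element). For $x\in\mathcal{L}(\mathcal{A})$ let $\mathcal{A}_x=\{H\in\mathcal{A}: H\supseteq x\}$. For a number field $K$ with ring of integers $\mathcal{O}_K$, each $H\in\mathcal{A}$ is given as the zero locus of a fixed polynomial $L_H\in\mathcal{O}_K[X_1,\dots,X_d]$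 of degree one; for central $\mathcal{A}$ the $L_H$ are taken to be homogeneous linear forms. Matrix of linear forms. Let $E=\{(x,i): x\in\mathcal{L}(\mathcal{A}),\ 1\le i\le\mu_x\}$ and let $Z_{(H,e)}$, for $e=(x,i)\in E$ and $H\in\mathcal{A}_x$, be algebraically independent variables. The matrix $A^{\boldsymbol{\mu}}_{\mathcal{A}}(\boldsymbol{Z})$ over $\mathcal{O}_K[\boldsymbol{Z}]$ is the $d\times|E|$ matrix of linear forms whose entry at $(j,e)$, with $1\le j\le d$ and $e=(x,i)$, is $\sum_{H\in\mathcal{A}_x}L_H(e_j)Z_{(H,e)}$, where $e_1,\dots,e_d$ is the standard basis. Global ask zeta function. For a $d\times e$ matrix $A$ of linear forms in $n$ variables over a ring $R$ and a finite $R$-algebra $S$, $\mathrm{ask}_S(A)=|S|^{-n}\sum_{z\in S^n}|\ker A(z)|$, where $A(z)$ acts on rows: $\ker A(z)=\{v\in S^d: v^{\top}A(z)=0\}$. Then $\zeta^{\mathrm{ask}}_{\boldsymbol{\mu}_{\mathcal{A}}/\mathcal{O}_K}(s)=\sum_{I}\mathrm{ask}_{\mathcal{O}_K/I}(A^{\boldsymbol{\mu}}_{\mathcal{A}}(\boldsymbol{Z}))\,|\mathcal{O}_K/I|^{-s}$, where $I$ ranges over the non-zero ideals of $\mathcal{O}_K$. *)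

(* Defs.v *)
From HB Require Import structures.
From mathcomp Require Import all_boot all_order all_algebra all_field.
From mathcomp Require Import generic_quotient ring_quotient.
From mathcomp Require Import finmap all_classical all_reals all_analysis.
From mathcomp Require Import complex.
(* Only the canonical structures and coercions of mpoly are imported: its notations clash with
   those of mathcomp-analysis.  Thus mpoly.mpoly n R is {mpoly R[n]}. *)
From mathcomp Require mpoly.
Import (canonicals, coercions) mpoly.

Set Implicit Arguments.
Unset Strict Implicit.
Unset Printing Implicit Defensive.

Import Order.TTheory GRing.Theory Num.Theory numFieldNormedType.Exports.

Local Open Scope ring_scope.
Local Open Scope quotient_scope.

(* Number fields are the finite-dimensional field extensions of rat. *)

Section RingOfIntegers.
Variable K : fieldExtType rat.

Definition algint : {pred K} :=
  fun x : K => `[< integralOver (intr : int -> K) x >].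

Lemma algint_subring : subring_closed algint.
Proof.
split=> [|x y /asboolP xint /asboolP yint|x y /asboolP xint /asboolP yint];
  apply/asboolP.
- exact: integral1.
- exact: integral_sub.
- exact: integral_mul.
Qed.

HB.instance Definition _ := GRing.isSubringClosed.Build K algint algint_subring.

Record ring_of_integers :=
  RingOfIntegers { ring_of_integers_val :> K; _ : ring_of_integers_val \in algint }.

HB.instance Definition _ := [isSub for ring_of_integers_val].
HB.instance Definition _ := [Choice of ring_of_integers by <:].
HB.instance Definition _ :=
  [SubChoice_isSubComNzRing of ring_of_integers by <:].

End RingOfIntegers.

(* The structure idealr of ring_quotient requires ideals to be proper, but the
   unit ideal contributes the constant term of the ask zeta function. *)

Record ideal (R : comNzRingType) := Ideal {
  ideal_pred :> R -> bool;
  ideal_zmod_closed : zmod_closed ideal_pred;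
  ideal_mul_closed : forall a : R, {in ideal_pred, forall x, a * x \in ideal_pred}
}.

HB.instance Definition _ (R : comNzRingType) := gen_eqMixin (ideal R).
HB.instance Definition _ (R : comNzRingType) := gen_choiceMixin (ideal R).

Definition nonzero_ideal (R : comNzRingType) (I : ideal R) :=
  exists2 x : R, x \in ideal_pred I & x != 0.

Section QuotientRing.
Variables (R : comNzRingType) (I : ideal R).

HB.instance Definition _ :=
  GRing.isZmodClosed.Build R (ideal_pred I) (ideal_zmod_closed I).

Definition quotient_ring := {ideal_quot (ideal_pred I : {pred R})}.

HB.instance Definition _ := GRing.Zmodule.on quotient_ring.

Definition quotient_map (x : R) : quotient_ring :=
  \pi_{ideal_quot (ideal_pred I : {pred R})} x.
Definition quotient_repr (x : quotient_ring) : R :=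
  @repr _ {ideal_quot (ideal_pred I : {pred R})} x.
Definition quotient_one := quotient_map 1.
Definition quotient_mul (x y : quotient_ring) :=
  quotient_map (quotient_repr x * quotient_repr y).

Lemma quotient_mapP (x y : R) :
  reflect (quotient_map x = quotient_map y) (x - y \in ideal_pred I).
Proof. by rewrite Quotient.idealrBE; apply: eqP. Qed.

Lemma quotient_reprK : cancel quotient_repr quotient_map.
Proof. exact: reprK. Qed.

Lemma quotient_map_is_zmod_morphism : zmod_morphism quotient_map.
Proof. exact: pi_is_zmod_morphism. Qed.

HB.instance Definition _ :=
  GRing.isZmodMorphism.Build R quotient_ring quotient_map
    quotient_map_is_zmod_morphism.

Lemma quotient_mapM (x y : R) :
  quotient_map (x * y) = quotient_mul (quotient_map x) (quotient_map y).
Proof.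
have repr_map z : z - quotient_repr (quotient_map z) \in ideal_pred I.
  by apply/quotient_mapP; rewrite quotient_reprK.
apply/quotient_mapP; set x' := quotient_repr _; set y' := quotient_repr _.
have -> : x * y - x' * y' = y * (x - x') + x' * (y - y').
  by rewrite !mulrBr addrA (mulrC y x) (mulrC y x') subrK.
by apply: rpredD; apply: ideal_mul_closed; apply: repr_map.
Qed.

Lemma quotient_mulA : associative quotient_mul.
Proof.
move=> x y z; rewrite -[x]quotient_reprK -[y]quotient_reprK -[z]quotient_reprK.
by rewrite -!quotient_mapM mulrA.
Qed.

Lemma quotient_mulC : commutative quotient_mul.
Proof. by move=> x y; rewrite /quotient_mul mulrC. Qed.

Lemma quotient_mul1 : left_id quotient_one quotient_mul.
Proof. by move=> x; rewrite -[x]quotient_reprK -quotient_mapM mul1r. Qed.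

Lemma quotient_mulDl : left_distributive quotient_mul +%R.
Proof.
move=> x y z; rewrite -[x]quotient_reprK -[y]quotient_reprK -[z]quotient_reprK.
by rewrite -raddfD -!quotient_mapM mulrDl raddfD.
Qed.

HB.instance Definition _ := GRing.Zmodule_isComPzRing.Build quotient_ring
  quotient_mulA quotient_mulC quotient_mul1 quotient_mulDl.

Lemma quotient_map_is_monoid_morphism : monoid_morphism quotient_map.
Proof. by split; last exact: quotient_mapM. Qed.

HB.instance Definition _ :=
  GRing.isMonoidMorphism.Build R quotient_ring quotient_map
    quotient_map_is_monoid_morphism.

End QuotientRing.

(* Number of elements of a finite set; 0 for infinite sets. *)
Definition ncard (T : choiceType) (B : set T) : nat := #|` fset_set B|.

Definition ideal_norm (R : comNzRingType) (I : ideal R) : nat :=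
  ncard [set: quotient_ring I].

(* A matrix of linear forms in n variables has entries in {mpoly R[n]} that are
   homogeneous of degree one.  Its specialisation at z in S^n is computed from
   the coefficients mcoeff U_(k): mpoly's own evaluation mmap is not available
   over the zero ring, which occurs as the quotient by the unit ideal. *)
Definition specialise (R : comNzRingType) (S : comPzRingType)
    (phi : {rmorphism R -> S}) (n d e : nat) (A : 'M[mpoly.mpoly n R]_(d, e))
    (z : 'rV[S]_n) : 'M[S]_(d, e) :=
  \matrix_(i, j) \sum_(k < n) phi (mpoly.mcoeff (mpoly.mnm1 k) (A i j)) * z 0 k.

(* ask_S(A), the R-algebra S being given by its structure morphism phi. *)
Definition ask (RR : realType) (R : comNzRingType) (S : comPzRingType)
    (phi : {rmorphism R -> S}) (n d e : nat) (A : 'M[mpoly.mpoly n R]_(d, e))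
    : RR :=
  ((ncard [set: S])%:R ^+ n)^-1 *
  \sum_(z \in [set: 'rV[S]_n])
     ((ncard [set v : 'rV[S]_d | v *m specialise phi A z = 0])%:R : RR).

Section Dirichlet.
Variable RR : realType.

(* n ^ (- s) for n > 0. *)
Definition dirichlet_pow (n : nat) (s : RR[i]) : RR[i] :=
  let t := ln (n%:R : RR) in
  (expR (- (complex.Re s * t)))%:C%C *
  (cos (complex.Im s * t) +i* - sin (complex.Im s * t))%C.

(* Convergence of the sum of a n * n ^ (- s) over n >= 1. *)
Definition dirichlet_converges (a : nat -> RR) (s : RR[i]) : Prop :=
  cvgn (series (fun m => (a m.+1)%:C%C * dirichlet_pow m.+1 s : RR[i]^o)).

Definition abscissa_of_convergence (a : nat -> RR) : \bar RR :=
  ereal_inf [set c%:E | c in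
    [set c : RR | forall s : RR[i], c < complex.Re s -> dirichlet_converges a s]].

(* The coefficient of m ^ (- s) in the sum of ask_{R/I}(A) |R/I| ^ (- s) over
   the nonzero ideals I of R.  When R is the ring of integers of a number field,
   finitely many ideals have a given norm m > 0, so the sum is a finite one. *)
Definition ask_zeta_coef (R : comNzRingType) (n d e : nat)
    (A : 'M[mpoly.mpoly n R]_(d, e)) (m : nat) : RR :=
  \sum_(I \in [set I : ideal R | nonzero_ideal I /\ ideal_norm I = m])
     ask RR (quotient_map I) A.

End Dirichlet.

(* A central arrangement is taken to be linear: the forms L_H are homogeneous, so
   that hyperplanes and their intersections are subspaces of 'rV[K]_d, and all
   intersections are non-empty. *)
Record central_arrangement (K : fieldExtType rat) (d : nat) :=
  CentralArrangement {
    hyps : {fset {vspace 'rV[K]_d}};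
    form : hyps -> mpoly.mpoly d (ring_of_integers K);
    form_neq0 : forall H, form H != 0;
    form_homog : forall H, form H \is mpoly.ishomog1 1 mpoly.mdeg;
    formP : forall (H : hyps) (v : 'rV[K]_d),
      (v \in val H) =
      (mpoly.meval (v 0) (mpoly.map_mpoly (@ring_of_integers_val K) (form H)) == 0)
  }.

Section Arrangement.
Variables (K : fieldExtType rat) (d : nat) (A : central_arrangement K d).

Definition intersection (J : {set hyps A}) : {vspace 'rV[K]_d} :=
  (\bigcap_(H in J) val H)%VS.

(* The intersection poset; J = set0 gives the whole space. *)
Definition flats : {fset {vspace 'rV[K]_d}} :=
  [fset intersection J | J in {: {set hyps A}}]%fset.

Definition flat_le (x y : flats) : bool := (val y <= val x)%VS.

Definition codim (U : {vspace 'rV[K]_d}) : nat := (d - \dim U)%N.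

Definition flat_rk (x : flats) : nat := codim (val x).

Definition arr_rk : nat := codim (intersection finset.setT).

Lemma ambient_subproof : fullv \in flats.
Proof. by apply/imfsetP; exists finset.set0; rewrite // /intersection big_set0. Qed.

Definition ambient : flats := [` ambient_subproof]%fset.

Variable mu : flats -> nat.

(* The column indices (x, i), and the variables Z_(H,(x,i)) with x contained
   in H. *)
Definition column : finType := {x : flats & 'I_(mu x)}.
Definition variable : finType :=
  {p : hyps A * column | (val (tag p.2) <= val p.1)%VS}.

Definition form_at_basis (H : hyps A) (j : 'I_d) : ring_of_integers K :=
  mpoly.meval (fun k => (k == j)%:R) (form H).

Definition arr_matrix :
    'M[mpoly.mpoly #|variable| (ring_of_integers K)]_(d, #|column|) :=
  \matrix_(j, c) \sum_(p : variable | (val p).2 == enum_val c)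
    form_at_basis (val p).1 j *: mpoly.mpolyX _ (mpoly.mnm1 (enum_rank p)).

Definition arr_abscissa (RR : realType) : \bar RR :=
  abscissa_of_convergence (ask_zeta_coef RR arr_matrix).

Definition flat_value (x : flats) : int :=
  d%:Z + 1 - (flat_rk x)%:Z - (\sum_(y : flats | ~~ flat_le y x) mu y)%N%:Z.

Definition max_flat_value : int :=
  \big[Order.max/flat_value ambient]_(x : flats) flat_value x.

End Arrangement.

Section BaseChange.
Variables (K K' : fieldExtType rat) (iota : {rmorphism K -> K'}) (d : nat).

Definition extend_scalars (U : {vspace 'rV[K]_d}) : {vspace 'rV[K']_d} :=
  <<[seq map_mx iota v | v <- vbasis U]>>%VS.

Definition is_base_change (A : central_arrangement K d)
    (A' : central_arrangement K' d) : Prop :=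
  hyps A' = [fset extend_scalars H | H in hyps A]%fset.

(* mu' corresponds to mu under the identification of the intersection posets of
   A and of its base change A'. *)
Definition same_multiplicities (A : central_arrangement K d)
    (A' : central_arrangement K' d) (mu : flats A -> nat)
    (mu' : flats A' -> nat) : Prop :=
  forall (x : flats A) (x' : flats A'),
    val x' = extend_scalars (val x) -> mu' x' = mu x.

End BaseChange.

(* Main.v *)
(* Write N for the norm of I and beta + 1 for the claimed abscissa.  The point is that
   c N^beta <= ask_{O/I} <= C_eps N^(beta + eps) for every nonzero ideal I.  As there are O(X)
   ideals of norm at most X, and at least X / polylog(X) for suitable arbitrarily large X
   (principal ideals, counted through heights of their generators), the Dirichlet series with
   nonnegative coefficients then converges to the right of beta + 1 and not to the left of it.

   The lower bound comes from one flat U: a vector v in the reduction of U annihilates all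
   columns whose hyperplanes contain U, and the other columns impose at most one condition
   on z each.

   For the upper bound, suppose first that the principal ideals of S = O/I form a chain.
   Classify v by the sizes of the ideals generated by the values L_H(v); there are at most
   polylogarithmically many classes.  Given v, the image of z -> v A(z) has at least
   prod_c max_{H in col c} |L_H(v) S| elements, and the v in a class are counted by choosing
   greedily a basis among the forms L_H, sorted by size.  Comparing both counts gives the
   exponent beta.  If the ideals do not form a chain, S splits as a product, and the number of
   solutions is multiplicative.  Passing to p-th powers, the polylogarithmic loss in a factor is
   bounded by its norm unless some proper ideal containing the factor's ideal has norm at most
   Q = Q(p), and there are finitely many such ideals: so only boundedly many factors
   contribute a constant. *)

(* Prime factorisation of ideals, the class number formula and the unit theorem are all bypassed.
   What is mainly used of [O] is, on the one hand, boxes of about T^m elements of height T, and on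
   the other hand that any a, b admit e with a dividing e * b and b dividing (1 - e) * a; hence the
   dichotomy between chains and splittings of a finite quotient.

   The shaping obstacle is uniformity in I. Linear algebra over K survives in O/I only up to a fixed
   nonzero [del]; its annihilator in O/I is bounded by the norm of [del], whatever I is. Such a
   constant is harmless once, but not once per factor of a splitting, whence the separate treatment
   of factors that lie below ideals of small norm. The p-th powers turn N^eps into N^(1/p) and keep
   the estimates among natural numbers.

   The two bounds meet because the claimed maximum is that of dim x + 1 minus the number of columns
   that x does not annihilate: the upper bound uses the inequality for every set of hyperplanes, the
   lower bound uses one maximiser. *)
Require Import Defs.
From HB Require Import structures.
From mathcomp Require Import all_boot all_order all_algebra all_field.
From mathcomp Require Import finmap all_classical all_reals all_analysis.
From mathcomp Require Import complex zify ring lra.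
From mathcomp Require mpoly.
Import (canonicals, coercions) mpoly.

Set Implicit Arguments.
Unset Strict Implicit.
Unset Printing Implicit Defensive.

Import Order.TTheory GRing.Theory Num.Theory numFieldNormedType.Exports.

Local Open Scope ring_scope.

(** * Integral elements and embeddings of a number field *)

Section Integrality.
Variable K : fieldType.

Local Notation ZK := (intr : int -> K).
Local Notation integralZ := (integralOver (intr : int -> K)).
Local Notation pZK := (map_poly ZK).

(** The determinant trick: the nonzero row v is an eigenvector of an integer matrix with eigenvalue
    y, so y is a root of its monic characteristic polynomial. *)
Lemma integral_stable_span (n : nat) (v : 'I_n -> K) (y : K) (i0 : 'I_n) :
  v i0 != 0 ->
  (forall j, exists c : 'I_n -> int, y * v j = \sum_i (c i)%:~R * v i) ->
  integralZ y.
Proof.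
move=> v0 /choice[c yv]; pose M : 'M[int]_n := \matrix_(i, j) c j i.
pose w : 'rV[K]_n := \row_j v j.
have wM : w *m map_mx ZK M = y *: w.
  by apply/rowP=> j; rewrite !mxE yv; apply: eq_bigr => i _; rewrite !mxE mulrC.
have w0 : w != 0 by apply: contraNneq v0 => /rowP/(_ i0); rewrite !mxE => ->.
exists (char_poly M); first exact: char_poly_monic.
rewrite map_char_poly -eigenvalue_root_char.
by apply/eigenvalueP; exists w.
Qed.

(** Multiplication by this value y preserves the Z-span of 1, rho, ..., rho^(m-1), where m is the
    degree of q. For j < n the product y * rho^j has small enough degree; for j >= n the relation
    q(rho) = 0 trades the upper part of q for minus the lower one. *)
Lemma integral_drop_poly (q : {poly int}) (rho : K) (n : nat) :
  root (pZK q) rho -> integralZ (pZK (drop_poly n q)).[rho].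
Proof.
move=> qrho.
have [sn | ns] := leqP (size q) n.
  rewrite drop_poly_eq0 // map_poly0 horner0; exact: mxpoly.integral0.
set y := _.[_].
have [m sq] : exists m, size q = m.+1 by exists (size q).-1; lia.
rewrite sq in ns.
have [m0|m_gt0] := posnP m.
  have n0 : n = 0 by move: ns; rewrite m0; case: (n).
  rewrite /y n0 drop_poly0l (rootP qrho); exact: mxpoly.integral0.
have span (s : {poly int}) : (size s <= m)%N ->
    exists c : 'I_m -> int, (pZK s).[rho] = \sum_i (c i)%:~R * rho ^+ i.
  move=> ss; exists (fun i => s`_i); rewrite (horner_coef_wide rho (n := m)).
    by apply: eq_bigr => i _; rewrite coef_map.
  by rewrite (leq_trans (size_poly _ _)).
apply: (@integral_stable_span m (fun i => rho ^+ i) y (Ordinal m_gt0)).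
  by rewrite expr0 oner_eq0.
move=> j /=; have [jn|nj] := ltnP j n.
  have -> : y * rho ^+ j = (pZK (drop_poly n q * 'X^j)).[rho].
    by rewrite rmorphM /= map_polyXn hornerM hornerXn.
  apply: span; rewrite (leq_trans (size_polyMleq _ _)) // size_polyXn.
  rewrite size_drop_poly sq; lia.
have -> : y * rho ^+ j = (pZK (- take_poly n q * 'X^(j - n))).[rho].
  rewrite rmorphM rmorphN /= map_polyXn hornerM hornerN hornerXn.
  have : (pZK (take_poly n q + drop_poly n q * 'X^n)).[rho] = 0.
    by rewrite poly_take_drop (rootP qrho).
  rewrite rmorphD rmorphM /= map_polyXn hornerD hornerM hornerXn.
  rewrite -/y => /eqP; rewrite addr_eq0 => /eqP ->.
  by rewrite opprK -mulrA -exprD subnKC.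
apply: span; rewrite (leq_trans (size_polyMleq _ _)) // size_polyXn size_polyN.
set sz := size _; have : (sz <= n)%N by exact: size_take_poly.
have := ltn_ord j; move: (nat_of_ord j) nj => k nj; lia.
Qed.

(** Dropping all but the two leading coefficients of q leaves this product plus an integer. *)
Lemma integral_lead_coef_mul (q : {poly int}) (rho : K) :
  root (pZK q) rho -> integralZ ((lead_coef q)%:~R * rho).
Proof.
move=> qrho; have [sq | sq] := leqP (size q) 1.
  have /size1_polyC Dq := sq; move: qrho; rewrite Dq map_polyC /= rootC lead_coefC.
  by move=> /eqP ->; rewrite mul0r; exact: mxpoly.integral0.
have := integral_drop_poly (size q).-2 qrho.
have -> : drop_poly (size q).-2 q = (lead_coef q) *: 'X + (q`_(size q).-2)%:P.
  apply/polyP=> i; rewrite coef_drop_poly coefD coefZ coefX coefC lead_coefE.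
  case: i => [|[|i]] /=; rewrite ?mulr0 ?mulr1 ?add0r ?addr0 //.
    by move: sq; case: (size q) => [|[|s]].
  by rewrite nth_default //; case: (size q) => [|[|s]] //=; rewrite !addSn ltnS ltnS leq_addl.
rewrite rmorphD /= map_polyZ /= map_polyX map_polyC /= !hornerE.
move=> h; rewrite -[X in integralZ X](addrK (q`_(size q).-2)%:~R).
by apply: integral_sub => //; exact: integral_id.
Qed.

End Integrality.

Lemma zcontents_bezout (p : {poly int}) :
  exists t : 'I_(size p) -> int, zcontents p = \sum_i t i * p`_i.
Proof.
suff [t ht] : exists t : 'I_(size p) -> int,
   (\big[gcdn/0%N]_(i < size p) `|(p`_i)%R|)%N%:Z = \sum_i t i * p`_i.
  exists (fun i => sgz (lead_coef p) * t i); rewrite /zcontents ht mulr_sumr.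
  by apply: eq_bigr => i _; rewrite mulrA.
elim: (size p) => [|n [t ht]].
  by exists (fun=> 0); rewrite !big_ord0.
rewrite big_ord_recr /=.
have [u [v uv]] := Bezoutz (\big[gcdn/0%N]_(i < n) `|(p`_i)%R|)%N%:Z p`_n.
exists (fun i => if unlift ord_max i is Some j then u * t j else v).
rewrite big_ord_recr /= unlift_none.
transitivity (gcdz (\big[gcdn/0%N]_(i < n) `|(p`_i)%R|)%N%:Z p`_n); first by [].
rewrite -uv ht mulr_sumr; congr (_ + _); apply: eq_bigr => i _.
have -> : widen_ord (leqnSn n) i = lift ord_max i.
  by apply: val_inj; rewrite /= /bump leqNgt ltn_ord.
by rewrite liftK mulrA.
Qed.

Section NumberFieldIntegers.
Variable K : fieldExtType rat.

Local Notation ZK := (intr : int -> K).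
Local Notation integralZ := (integralOver (intr : int -> K)).
Local Notation pZK := (map_poly ZK).

Lemma intr_number_field_inj : injective ZK.
Proof.
move=> a b; rewrite -!(rmorph_int (in_alg K)) => /fmorph_inj; exact: intr_inj.
Qed.

Lemma intr_number_field_eq0 (a : int) : (a%:~R == 0 :> K) = (a == 0).
Proof. by rewrite -[0](mulr0z 1) (inj_eq intr_number_field_inj). Qed.

Lemma number_field_int_root (rho : K) :
  exists2 q : {poly int}, q != 0 & root (pZK q) rho.
Proof.
have /polyOver1P[p Dp] := minPolyOver 1 rho.
have [q [a a0 Dq]] := rat_poly_scale p.
have p0 : p != 0.
  rewrite -(map_poly_eq0 (in_alg K)) -Dp monic_neq0 ?monic_minPoly //.
exists q.
  by apply: contraNneq p0; rewrite Dq => ->; rewrite rmorph0 scaler0.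
have: root (map_poly (in_alg K) (map_poly intr q)) rho.
  have := root_minPoly 1 rho; rewrite Dp Dq map_polyZ /= rootZ //.
  by rewrite scaler_eq0 invr_eq0 intr_eq0 (negPf a0) oner_eq0.
rewrite -map_poly_comp; congr (root _ _); apply: eq_map_poly => b /=.
by rewrite alg_num_field ratr_int.
Qed.

Lemma integral_multiple (x : K) : exists2 n : int, n != 0 & integralZ (n%:~R * x).
Proof.
have [q q0 qx] := number_field_int_root x.
by exists (lead_coef q); [rewrite lead_coef_eq0 | exact: integral_lead_coef_mul].
Qed.

(* With h = \sum_n h_n X^n primitive and h(rho) = 0, the Horner sums
   Y_n = \sum_(i >= n) h_i rho^(i - n) are integral and h_n = Y_n - rho * Y_(n+1);
   a Bezout relation between the h_n does the rest. *)
Lemma integral_fraction_split (rho : K) : exists u w : K,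
  [/\ u - rho * w = 1, integralZ u, integralZ (rho * u), integralZ w &
      integralZ (rho * w)].
Proof.
have [q q0 qrho] := number_field_int_root rho.
pose h := zprimitive q.
have hrho : root (pZK h) rho.
  move: qrho; rewrite [q]zpolyEprim map_polyZ /= rootZ //.
  by rewrite intr_number_field_eq0 zcontents_eq0.
have [t ht] := zcontents_bezout h.
have {}ht : \sum_i t i * h`_i = 1 by rewrite -ht zcontents_primitive q0.
pose Y n := (pZK (drop_poly n h)).[rho].
have intY n : integralZ (Y n) by exact: integral_drop_poly.
have YE n : rho * Y n.+1 = Y n - (h`_n)%:~R.
  have -> : Y n = (pZK ((h`_n)%:P + drop_poly n.+1 h * 'X)).[rho].
    congr (pZK _).[_]; apply/polyP=> i; rewrite coefD coefC coefMX !coef_drop_poly.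
    by case: i => [|i] /=; rewrite ?addr0 ?add0r // addSnnS.
  rewrite rmorphD rmorphM /= map_polyC map_polyX /= hornerD hornerC hornerM hornerX.
  by rewrite -/(Y n.+1) addrAC subrr add0r mulrC.
have intrY n : integralZ (rho * Y n).
  case: n => [|n].
    rewrite /Y drop_poly0l (rootP hrho) mulr0; exact: mxpoly.integral0.
  by rewrite YE; apply: integral_sub => //; exact: integral_id.
have intsum (F : nat -> K) : (forall n, integralZ (F n)) ->
    integralZ (\sum_(i < size h) (t i)%:~R * F i).
  move=> intF; apply: (big_ind integralZ); first exact: mxpoly.integral0.
    by move=> x y; apply: integral_add.
  move=> i _; apply: integral_mul => //; exact: integral_id.
exists (\sum_(i < size h) (t i)%:~R * Y i), (\sum_(i < size h) (t i)%:~R * Y i.+1).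
have comm (F : nat -> K) : rho * (\sum_(i < size h) (t i)%:~R * F i)
   = \sum_(i < size h) (t i)%:~R * (rho * F i).
  by rewrite mulr_sumr; apply: eq_bigr => i _; rewrite mulrCA.
split; rewrite ?(comm Y) ?(comm (fun n => Y n.+1)); try exact: intsum.
- rewrite -sumrB -[RHS](_ : ZK 1 = _) // -ht rmorph_sum /=.
  by apply: eq_bigr => i _; rewrite YE rmorphM /= -mulrBr opprB addrC subrK.
- by apply: (intsum (fun n => rho * Y n)).
- by apply: (intsum (fun n => Y n.+1)).
- by apply: (intsum (fun n => rho * Y n.+1)).
Qed.

End NumberFieldIntegers.

Section Embeddings.
Variable K : fieldExtType rat.

Local Notation integralZ := (integralOver (intr : int -> K)).
Local Notation pQtoK := (map_poly (in_alg K)).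
Local Notation pQtoC := (map_poly (ratr : rat -> algC)).

Lemma number_field_separable (U : {subfield K}) (x : K) : separable_element U x.
Proof.
apply: pcharf0_separable => p; rewrite inE; apply/negP => /andP[p_pr].
rewrite -[_%:R]/(p%:Z%:~R) intr_number_field_eq0.
by case: p p_pr.
Qed.

(** The elements of a basis are adjoined one by one, with a primitive element at each stage; a
    nonzero integer multiple of the last one is integral and generates the same field. *)
Lemma number_field_primitive : exists2 z : K, integralZ z & (<<1; z>> = fullv)%VS.
Proof.
have adj (s : seq K) : exists z : K, (<<1 & s>> = <<1; z>>)%VS.
  elim/last_ind: s => [|s x [z Dz]].
    by exists 0; rewrite Fadjoin_nil Fadjoin0.
  rewrite adjoin_rcons Dz.
  have [z' ->] := Primitive_Element_Theorem x (number_field_separable 1%AS z).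
  by exists z'.
have [z0 Dz0] := adj (vbasis (fullv : {vspace K})).
have full0 : (<<1; z0>> = fullv :> {vspace K})%VS.
  apply/eqP; rewrite eqEsubv subvf /= -Dz0 -[X in (X <= _)%VS](span_basis (vbasisP _)).
  by apply/span_subvP => x xb; apply: seqv_sub_adjoin.
have [n n0 nz] := integral_multiple z0.
exists (n%:~R * z0) => //; apply/eqP; rewrite eqEsubv subvf -full0 /=.
rewrite sub_adjoin1v.
have Dz : z0 = (n%:Q)^-1 *: (n%:~R * z0).
  rewrite -mulr_algl -/(in_alg K _) fmorphV /= alg_num_field ratr_int.
  by rewrite mulKf ?intr_number_field_eq0.
by rewrite [X in X \in _]Dz memvZ ?memv_adjoin.
Qed.

(** Each root r_i of the minimal polynomial p of z gives the embedding q(z) |-> q(r_i), well defined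
    because p divides the difference of two representatives. Separability makes the roots distinct,
    and remainders modulo p give the coordinates. *)
Lemma number_field_embeddings :
  exists (m : nat) (sig : 'I_m -> {rmorphism K -> algC}) (z : K),
  [/\ (0 < m)%N, integralZ z, injective (fun i => sig i z) &
      forall x, exists c : 'I_m -> rat, x = \sum_j ratr (c j) * z ^+ j].
Proof.
have [z intz fullz] := number_field_primitive.
have /polyOver1P[p Dp] := minPolyOver 1 z.
have sepp : separable_poly p.
  rewrite -(separable_map (in_alg K)) -Dp; exact: (number_field_separable 1%AS z).
have [r Dr] := closed_field_poly_normal (pQtoC p).
have mon_p : p \is monic by rewrite -(map_monic (in_alg K)) -Dp monic_minPoly.
have lc1 : lead_coef (pQtoC p) = 1 by apply/eqP; rewrite -[_ == _]/(_ \is monic) map_monic.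
rewrite {}lc1 scale1r in Dr.
have Ur : uniq r by rewrite -separable_prod_XsubC -Dr separable_map.
have sz : (size p).-1 = size r.
  by rewrite -(size_map_poly (ratr : {rmorphism rat -> algC})) Dr size_prod_XsubC.
have zP (x : K) : exists q, x = (pQtoK q).[z].
  by apply/Fadjoin1_polyP; rewrite fullz memvf.
have [cq cqE] := choice zP.
have wd (q1 q2 : {poly rat}) (i : 'I_(size r)) : (pQtoK q1).[z] = (pQtoK q2).[z] ->
    (pQtoC q1).[r`_i] = (pQtoC q2).[r`_i].
  move=> q12; apply/eqP; rewrite -subr_eq0 -hornerN -hornerD -rmorphB /=.
  have : p %| q1 - q2.
    rewrite -(dvdp_map (in_alg K)) -Dp; apply: minPoly_dvdp; first exact: alg_polyOver.
    by apply/rootP; rewrite rmorphB hornerD hornerN q12 subrr.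
  rewrite -(dvdp_map (ratr : {rmorphism rat -> algC})) Dr => /dvdpP[g ->].
  by rewrite -/(root _ _) rootM root_prod_XsubC mem_nth ?orbT.
pose f (i : 'I_(size r)) x := (pQtoC (cq x)).[r`_i].
have fE i q : f i (pQtoK q).[z] = (pQtoC q).[r`_i] by apply: wd; rewrite -cqE.
have fa i : zmod_morphism (f i).
  move=> x y; rewrite (cqE x) (cqE y) -hornerN -hornerD -rmorphB !fE.
  by rewrite rmorphB hornerD hornerN.
have fm i : monoid_morphism (f i).
  split=> [|x y]; last by rewrite (cqE x) (cqE y) -hornerM -rmorphM !fE rmorphM hornerM.
  have -> : (1 : K) = (pQtoK 1).[z] by rewrite rmorph1 hornerC.
  by rewrite fE rmorph1 hornerC.
pose fRM i : {rmorphism K -> algC} :=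
  HB.pack (f i) (GRing.isZmodMorphism.Build _ _ (f i) (fa i))
    (GRing.isMonoidMorphism.Build _ _ (f i) (fm i)).
have fz i : f i z = r`_i.
  by rewrite -{1}[z]hornerX -(map_polyX (in_alg K)) fE map_polyX hornerX.
exists (size r), fRM, z; split => //.
- rewrite -sz -ltnS prednK; last by rewrite size_poly_gt0 monic_neq0.
  by rewrite -(size_map_poly (in_alg K)) -Dp size_minPoly /adjoin_degree; case: (\dim_1%AS _)%VS.
- move=> i j /=; rewrite !fz => /eqP; rewrite nth_uniq // => /eqP; exact: val_inj.
- move=> x; rewrite (cqE x); set q := cq x.
  have szm : (size (q %% p)%R <= size r)%N.
    by rewrite -sz -ltnS prednK ?size_poly_gt0 ?ltn_modp monic_neq0.
  exists (fun j => (q %% p)%R`_j).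
  have -> : (pQtoK q).[z] = (pQtoK (q %% p)).[z].
    rewrite {1}(divp_eq q p) rmorphD rmorphM /= hornerD hornerM -Dp.
    by rewrite minPolyxx mulr0 add0r.
  rewrite (horner_coef_wide z (n := size r)) ?size_map_poly //.
  by apply: eq_bigr => j _; rewrite coef_map /= alg_num_field.
Qed.

End Embeddings.

Section IntegersSplit.
Variable K : fieldExtType rat.
Local Notation O := (ring_of_integers K).

Fact ring_of_integers_val_is_zmod_morphism : zmod_morphism (@ring_of_integers_val K).
Proof. by []. Qed.
Fact ring_of_integers_val_is_monoid_morphism : monoid_morphism (@ring_of_integers_val K).
Proof. by []. Qed.
HB.instance Definition _ := GRing.isZmodMorphism.Build O K (@ring_of_integers_val K)
  ring_of_integers_val_is_zmod_morphism.
HB.instance Definition _ := GRing.isMonoidMorphism.Build O K (@ring_of_integers_val K)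
  ring_of_integers_val_is_monoid_morphism.

Lemma algint_val (x : O) : integralOver (intr : int -> K) (\val x).
Proof. by case: x => x /= /asboolP. Qed.

Lemma mem_algint (x : K) : integralOver (intr : int -> K) x -> x \in @algint K.
Proof. by move=> h; apply/asboolP. Qed.

Definition mk_algint (x : K) (h : integralOver (intr : int -> K) x) : O :=
  RingOfIntegers (mem_algint h).

Lemma ring_of_integers_mulf_eq0 (x y : O) : x * y = 0 -> x = 0 \/ y = 0.
Proof.
move=> /(congr1 val)/eqP; rewrite rmorphM rmorph0 mulf_eq0 => /orP[] /eqP xy.
  by left; apply: val_inj.
by right; apply: val_inj.
Qed.

(** For a != 0 this is [integral_fraction_split] at rho = - b / a, with e its u: then e * b / a is
    integral and 1 - e = w * b / a. Locally, one of a and b divides the other: a divides b where e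
    is invertible, b divides a where 1 - e is. *)
Lemma ring_of_integers_split (a b : O) : exists e u w : O,
  e * b = u * a /\ (1 - e) * a = w * b.
Proof.
have [->|a0] := eqVneq a 0.
  by exists 0, 0, 0; rewrite !mul0r mulr0.
have a0' : \val a != 0 by apply: contraNneq a0 => a0; apply/eqP/val_inj.
have [u [w [uw intu intru intw intrw]]] := integral_fraction_split (- (\val b / \val a)).
have intru' : integralOver (intr : int -> K) (- (- (\val b / \val a) * u)).
  exact: integral_opp.
exists (mk_algint intu), (mk_algint intru'), (mk_algint intw).
split; apply: val_inj.
  by change (u * \val b = - (- (\val b / \val a) * u) * \val a); field.
by change ((1 - u) * \val a = w * \val b); rewrite -uw; field.
Qed.

End IntegersSplit.

(** * Heights *)

Section Heights.
Variables (K : fieldExtType rat) (m : nat) (sig : 'I_m -> {rmorphism K -> algC}) (z : K).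
Hypotheses (m_gt0 : (0 < m)%N) (intz : integralOver (intr : int -> K) z)
  (sigz_inj : injective (fun i => sig i z))
  (z_span : forall x, exists c : 'I_m -> rat, x = \sum_j ratr (c j) * z ^+ j).
Local Notation O := (ring_of_integers K).

(** A bound on the house of x, the largest absolute value of its conjugates. *)
Definition hle (x : O) (T : nat) : Prop := forall i, `|sig i (\val x)| <= T%:R.

Lemma hleM x y T U : hle x T -> hle y U -> hle (x * y) (T * U)%N.
Proof.
move=> hx hy i; rewrite natrM /= rmorphM normrM.
by apply: ler_pM.
Qed.

Lemma hleB x y T U : hle x T -> hle y U -> hle (x - y) (T + U)%N.
Proof.
move=> hx hy i; rewrite natrD /= rmorphB.
by apply: le_trans (ler_normB _ _) _; apply: lerD; [exact: hx | exact: hy].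
Qed.

Lemma hleD x y T U : hle x T -> hle y U -> hle (x + y) (T + U)%N.
Proof.
move=> hx hy i; rewrite natrD /= rmorphD.
by apply: le_trans (ler_normD _ _) _; apply: lerD; [exact: hx | exact: hy].
Qed.

Lemma hle_leq x T U : (T <= U)%N -> hle x T -> hle x U.
Proof. by move=> TU hx i; apply: le_trans (hx i) _; rewrite ler_nat. Qed.

Lemma algC_bound (I : finType) (F : I -> algC) : exists B : nat, forall i, `|F i| <= B%:R.
Proof.
have [B hB] : exists B : I -> nat, forall i, `|F i| <= (B i)%:R.
  have /choice[B hB] : forall i, exists b : nat, `|F i| <= b%:R.
    by move=> i; exists (Num.bound `|F i|); apply/ltW/archi_boundP/normr_ge0.
  by exists B.
exists (\sum_i B i)%N => i; apply: le_trans (hB i) _.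
by rewrite ler_nat (bigD1 i) //= leq_addr.
Qed.

Lemma hle_exists (x : O) : exists T, hle x T.
Proof. exact: (algC_bound (fun i => sig i (\val x))). Qed.

Lemma hle_seq_exists (s : seq O) : exists T, forall x, x \in s -> hle x T.
Proof.
elim: s => [|x s [T hT]]; first by exists 0%N.
have [U hU] := hle_exists x; exists (T + U)%N => y; rewrite inE => /predU1P[->|/hT hy].
  by apply: hle_leq hU; rewrite leq_addl.
by apply: hle_leq hy; rewrite leq_addr.
Qed.

(** The polynomial with coefficients [sig i (c j)], which do not depend on i, has degree less than m
    and vanishes at the m distinct numbers [sig i z]. *)
Lemma coords_eq0 (c : 'I_m -> K) :
  (forall i j, sig i (c j) = sig (Ordinal m_gt0) (c j)) ->
  \sum_j c j * z ^+ j = 0 -> forall j, c j = 0.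
Proof.
move=> csig sum0.
pose i0 := Ordinal m_gt0.
pose P : {poly algC} := \poly_(j < m) (if insub j is Some j' then sig i0 (c j') else 0).
have Pr i : root P (sig i z).
  apply/rootP; rewrite horner_poly.
  transitivity (sig i (\sum_j c j * z ^+ j)); last by rewrite sum0 rmorph0.
  rewrite rmorph_sum /=.
  by apply: eq_bigr => j _; rewrite valK rmorphM rmorphXn /= (csig i).
have P0 : P = 0.
  apply/eqP; apply: contraTT isT => P0.
  have := max_poly_roots P0 (rs := [seq sig i z | i <- enum 'I_m]).
  rewrite map_inj_uniq ?enum_uniq; last exact: sigz_inj.
  rewrite size_map size_enum_ord ltnNge size_poly /=; apply => //.
  by apply/allP => _ /mapP[i _ ->].
move=> j; apply: (fmorph_inj (sig i0)); rewrite rmorph0.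
have := congr1 (fun p : {poly algC} => p`_j) P0.
by rewrite coef_poly coef0 ltn_ord valK.
Qed.

(** The box consists of the combinations of 1, z, ..., z^(m-1) with coefficients in 0..T. B bounds
    the conjugates of these powers, and its successor keeps c1 positive. *)
Lemma hle_lower_box : exists c1 : nat, (0 < c1)%N /\ forall T : nat,
  exists2 f : {ffun 'I_m -> 'I_T.+1} -> O, injective f & forall a, hle (f a) (c1 * T)%N.
Proof.
have [B hB] := algC_bound (fun p : 'I_m * 'I_m => sig p.1 (z ^+ p.2)).
pose zO : O := mk_algint intz.
exists (m * B.+1)%N; split; first by rewrite muln_gt0 m_gt0.
move=> T; exists (fun a : {ffun 'I_m -> 'I_T.+1} => \sum_j (a j : nat)%:R * zO ^+ j).
  move=> a b /(congr1 val); rewrite !rmorph_sum /= => /eqP.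
  rewrite -subr_eq0 -sumrB => /eqP ab.
  have := @coords_eq0 (fun j => (a j : nat)%:R - (b j : nat)%:R).
  have csig i j : sig i ((a j : nat)%:R - (b j : nat)%:R) =
      sig (Ordinal m_gt0) ((a j : nat)%:R - (b j : nat)%:R).
    by rewrite !rmorphB !rmorph_nat.
  move=> /(_ csig) h; apply/ffunP=> j; apply: val_inj => /=.
  have {}h : \sum_j ((a j : nat)%:R - (b j : nat)%:R) * z ^+ j = 0 ->
      forall j, (a j : nat)%:R - (b j : nat)%:R = 0 :> K := h.
  have /eqP : (a j : nat)%:R - (b j : nat)%:R = 0 :> K.
    apply: h; rewrite -[RHS]ab; apply: eq_bigr => i _.
    by rewrite !rmorph_nat rmorphXn /= mulrBl.
  rewrite subr_eq0 -(rmorph_nat (in_alg K)) -[X in _ == X](rmorph_nat (in_alg K)).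
  by rewrite (inj_eq (fmorph_inj _)) eqr_nat => /eqP.
move=> a i; rewrite !rmorph_sum /=; apply: le_trans (ler_norm_sum _ _ _) _.
rewrite mulnAC -mulnA natrM mulr_natl -[X in _ *+ X]card_ord -sumr_const.
apply: ler_sum => j _; rewrite natrM rmorphM !rmorph_nat !rmorphXn /= normrM normr_nat.
apply: ler_pM => //; first by rewrite ler_nat -ltnS.
by have := hB (i, j); rewrite /= rmorphXn /= => h; apply: le_trans h _; rewrite ler_nat.
Qed.

End Heights.

Section HeightCounting.
Variables (K : fieldExtType rat) (m : nat) (sig : 'I_m -> {rmorphism K -> algC}) (z : K).
Hypotheses (m_gt0 : (0 < m)%N) (intz : integralOver (intr : int -> K) z)
  (sigz_inj : injective (fun i => sig i z))
  (z_span : forall x, exists c : 'I_m -> rat, x = \sum_j ratr (c j) * z ^+ j).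
Local Notation O := (ring_of_integers K).
Local Notation hle := (hle sig).

Lemma Aint_integralOver (x : algC) : integralOver (intr : int -> algC) x -> x \in Aint.
Proof.
case=> p mon_p px; apply: (root_monic_Aint px); first exact: monic_map.
by apply/polyOverP => i; rewrite coef_map /= rpred_int.
Qed.

Lemma Aint_embedding (i : 'I_m) (x : K) :
  integralOver (intr : int -> K) x -> sig i x \in Aint.
Proof.
move=> /(integral_rmorph (sig i)) [p mon_p px]; apply: Aint_integralOver.
exists p => //; congr (is_true (root _ _)): px.
by apply: eq_map_poly => a /=; rewrite rmorph_int.
Qed.

Lemma Aint_denominator (x : algC) : exists2 n : int, n != 0 & n%:~R * x \in Aint.
Proof.
have [p [_ mon_p] dv_p] := minCpolyP x.
have [q [a a0 Dq]] := rat_poly_scale p.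
have q0 : q != 0.
  apply: contraTneq mon_p => q0; rewrite Dq q0 rmorph0 scaler0.
  by rewrite monicE lead_coef0 eq_sym oner_eq0.
exists (lead_coef q); first by rewrite lead_coef_eq0.
apply/Aint_integralOver/integral_lead_coef_mul.
have : root (map_poly ratr p) x by rewrite dv_p.
rewrite Dq map_polyZ /= rootZ; last by rewrite fmorph_eq0 invr_eq0 intr_eq0.
rewrite -map_poly_comp; congr (is_true (root _ _)).
by apply: eq_map_poly => b /=; rewrite ratr_int.
Qed.

Definition power_embed_mx : 'M[algC]_m := \matrix_(j, i) sig i (z ^+ j).
Local Notation W := power_embed_mx.

Lemma power_embed_mx_unit : W \in unitmx.
Proof.
rewrite unitmxE unitfE.
have -> : W = Vandermonde m (\row_i sig i z).
  by apply/matrixP => j i; rewrite !mxE rmorphXn.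
rewrite det_Vandermonde; apply/prodf_neq0 => i _; apply/prodf_neq0 => j ij.
by rewrite !mxE subr_eq0; apply: contraTneq ij => /sigz_inj ->; rewrite ltnn.
Qed.

Lemma embed_coords (x : K) (c : 'I_m -> rat) : x = \sum_j ratr (c j) * z ^+ j ->
  (\row_j ratr (c j)) *m W = \row_i sig i x.
Proof.
move=> ->; apply/rowP=> i; rewrite !mxE rmorph_sum /=.
by apply: eq_bigr => j _; rewrite !mxE rmorphM fmorph_rat.
Qed.

(** The product of the conjugates is the determinant of multiplication by x in the basis of powers
    of z. It is thus rational, integral and nonzero. *)
Lemma norm_embed_ge1 (x : O) : x != 0 -> 1 <= \prod_i `|sig i (\val x)|.
Proof.
move=> x0; rewrite -normr_prod.
have [c cE] : exists c : 'I_m -> 'I_m -> rat,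
    forall j : 'I_m, \val x * z ^+ j = \sum_k ratr (c j k) * z ^+ k.
  by have /choice[c cE] := fun j : 'I_m => z_span (\val x * z ^+ j); exists c.
pose M : 'M[rat]_m := \matrix_(j, k) c j k.
have MW : map_mx ratr M *m W = W *m diag_mx (\row_i sig i (\val x)).
  apply/row_matrixP => j; rewrite row_mul.
  have -> : row j (map_mx ratr M) = \row_k ratr (c j k) :> 'rV[algC]_m
    by apply/rowP=> k; rewrite !mxE.
  rewrite (embed_coords (cE j)); apply/rowP => i; rewrite mul_mx_diag !mxE.
  by rewrite rmorphM mulrC.
have detE : \prod_i sig i (\val x) = ratr (\det M).
  have := congr1 determinant MW; rewrite !det_mulmx det_diag mulrC.
  move=> /(mulfI _) h; rewrite -det_map_mx h.
    by apply: eq_bigr => i _; rewrite !mxE.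
  by have := power_embed_mx_unit; rewrite unitmxE unitfE.
apply: norm_intr_ge1.
  apply: Cint_rat_Aint; first by rewrite detE; apply/CratP; exists (\det M).
  by apply: rpred_prod => i _; apply: Aint_embedding; exact: algint_val.
apply/prodf_neq0 => i _; rewrite fmorph_eq0.
by apply: contraNneq x0 => x0; apply/eqP/val_inj.
Qed.

(** The coordinates of x in the powers of z come from its conjugates through the inverse Vandermonde
    matrix. With n clearing the denominator of the inverse determinant, n times a coordinate is an
    integer of size at most m * B * T; the code shifts it by m * B * T to make it natural, whence c2
    = 2 * (m * B). *)
Lemma hle_upper_box : exists c2 : nat, forall T : nat,
  exists g : O -> {ffun 'I_m -> 'I_(c2 * T).+1},
    forall x y, hle x T -> hle y T -> g x = g y -> x = y.
Proof.
have [n n0 nD] := Aint_denominator (\det W)^-1.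
have /choice[c cE] := z_span.
pose k (x : O) j : rat := n%:~R * c (\val x) j.
have cV (x : O) : \row_j ratr (c (\val x) j) = (\row_i sig i (\val x)) *m invmx W.
  by rewrite -(embed_coords (cE _)) mulmxK // power_embed_mx_unit.
have kint x j : k x j \is a Num.int.
  have /rowP/(_ j) := cV x; rewrite !mxE => cj.
  rewrite -(Cint_rat (k x j)); apply: Cint_rat_Aint; first by apply/CratP; exists (k x j).
  rewrite rmorphM /= ratr_int cj mulr_sumr; apply: rpred_sum => i _.
  rewrite /invmx power_embed_mx_unit !mxE mulrCA; apply: rpredM.
    by apply: Aint_embedding; exact: algint_val.
  rewrite mulrA; apply: rpredM => //; rewrite /cofactor; apply: rpredM.
    by rewrite rpredX // rpredN rpred1.
  rewrite /determinant; apply: rpred_sum => s _; apply: rpredM.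
    by rewrite rpredX // rpredN rpred1.
  apply: rpred_prod => l _; rewrite !mxE rmorphXn; apply: rpredX.
  exact: Aint_embedding.
have [B hB] := algC_bound (fun p : 'I_m * 'I_m => n%:~R * invmx W p.1 p.2).
have kbound x j T : hle x T -> `|k x j| <= (m * B * T)%:R.
  move=> hx; rewrite -(ler_rat algC) ratr_norm ratr_nat.
  have /rowP/(_ j) := cV x; rewrite !mxE => cj.
  rewrite rmorphM /= ratr_int cj mulr_sumr; apply: le_trans (ler_norm_sum _ _ _) _.
  rewrite -mulnA natrM mulr_natl -[X in _ *+ X]card_ord -sumr_const.
  apply: ler_sum => i _; rewrite mulrCA normrM mulnC natrM !mxE.
  by apply: ler_pM => //; exact: (hB (i, j)).
exists (2 * (m * B))%N => T.
exists (fun x => [ffun j => inord `|numq (k x j + (m * B * T)%:R)|%N]).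
move=> x y hx hy /ffunP xy; apply: val_inj; rewrite /= (cE (\val x)) (cE (\val y)).
apply: eq_bigr => j _; congr (ratr _ * _).
suff : k x j = k y j by apply: mulfI; rewrite intr_eq0.
have shift w : hle w T -> exists2 a : nat, (a < (2 * (m * B) * T).+1)%N &
    k w j + (m * B * T)%:R = a%:R.
  move=> hw; have := kbound w j T hw; rewrite ler_norml => /andP[lo hi].
  have /natrP[a Da] : k w j + (m * B * T)%:R \is a Num.nat.
    rewrite natrEint rpredD ?kint ?rpred_nat //= -lerBlDr sub0r //.
  exists a => //; rewrite ltnS -(ler_nat rat) -Da.
  have -> : (2 * (m * B) * T = m * B * T + m * B * T)%N by rewrite addnn -mul2n !mulnA.
  by rewrite natrD lerD2r.
have [a a_lt Da] := shift x hx; have [b b_lt Db] := shift y hy.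
have := xy j; rewrite !ffunE Da Db !pmulrn !numq_int => /(congr1 val) /=.
rewrite !inordK // => ab; apply: (addIr (m * B * T)%:R); rewrite Da Db.
by move: ab => /= ->.
Qed.

End HeightCounting.

Section HeightCells.
Variables (K : fieldExtType rat) (m : nat) (sig : 'I_m -> {rmorphism K -> algC}) (z : K).
Hypotheses (m_gt0 : (0 < m)%N) (intz : integralOver (intr : int -> K) z)
  (sigz_inj : injective (fun i => sig i z))
  (z_span : forall x, exists c : 'I_m -> rat, x = \sum_j ratr (c j) * z ^+ j).
Local Notation O := (ring_of_integers K).
Local Notation hle := (hle sig).

(* Since the norm of x is at least 1, each |sig i x| lies between T^(1 - m) and T;
   x and y are in the same cell if all their absolute values are dyadically close. *)
Lemma hle_cells (T : nat) : exists cell : O -> {ffun 'I_m -> 'I_(m * (trunc_log 2 T).+1).+1},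
  forall x y u, x != 0 -> y != 0 -> hle x T -> hle y T -> cell x = cell y ->
    y = u * x -> hle u 2.
Proof.
pose a (x : O) i : algC := (T ^ m.-1)%:R * `|sig i (\val x)|.
exists (fun x => [ffun i => inord (trunc_log 2 (Num.truncn (a x i)))]).
have bnd (x : O) i : x != 0 -> hle x T -> exists l : nat,
    [/\ l = trunc_log 2 (Num.truncn (a x i)), (2 ^ l)%:R <= a x i, a x i < (2 ^ l.+1)%:R
      & (l < (m * (trunc_log 2 T).+1).+1)%N].
  move=> x0 hx; have T_gt0 : (0 < T)%N.
    rewrite lt0n; apply/eqP => T0; have := norm_embed_ge1 sigz_inj z_span x0.
    rewrite (bigD1 i) //=; have := hx i; rewrite T0 normr_le0 => /eqP ->.
    by rewrite normr0 mul0r ler10.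
  have a1 : 1 <= a x i.
    apply: le_trans (norm_embed_ge1 sigz_inj z_span x0) _.
    rewrite (bigD1 i) //= mulrC; apply: ler_wpM2r => //.
    rewrite natrX; apply: le_trans (_ : \prod_(k < m | k != i) (T%:R : algC) <= _).
      by apply: ler_prod => k _; rewrite normr_ge0 hx.
    by rewrite prodr_const cardC1 card_ord.
  have aT : a x i <= (T ^ m)%:R.
    rewrite -[X in (T ^ X)%N](prednK m_gt0) expnSr natrM /a; apply: ler_wpM2l => //.
  have /truncn_itv/andP[ta at1] : 0 <= a x i by apply: le_trans a1.
  have t0 : (0 < Num.truncn (a x i))%N by rewrite truncn_gt0.
  have /andP[lo hi] := trunc_log_bounds (isT : (1 < 2)%N) t0.
  exists (trunc_log 2 (Num.truncn (a x i))); split => //.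
  - by apply: le_trans ta; rewrite ler_nat.
  - by apply: lt_le_trans at1 _; rewrite ler_nat.
  - rewrite ltnS ltnW // -(ltn_exp2l _ _ (isT : (1 < 2)%N)); apply: leq_ltn_trans lo _.
    apply: (@leq_ltn_trans (T ^ m)); first by rewrite -(ler_nat algC) (le_trans ta).
    by rewrite mulnC expnM ltn_exp2r // trunc_log_ltn.
move=> x y u x0 y0 hx hy /ffunP xy Dy i.
have [l [Dl lo hi lb]] := bnd x i x0 hx; have [l' [Dl' lo' hi' lb']] := bnd y i y0 hy.
have ll : l = l'.
  by have := xy i; rewrite !ffunE -Dl -Dl' => /(congr1 val); rewrite /= !inordK.
have ax : 0 < a x i by apply: lt_le_trans lo; rewrite ltr0n expn_gt0.
rewrite -(ler_pM2r ax); apply: (@le_trans _ _ (a y i)).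
  by rewrite /a Dy mulrCA rmorphM normrM.
apply: (ltW (lt_le_trans hi' _)); rewrite -ll expnS natrM; exact: ler_wpM2l.
Qed.

End HeightCells.

(* h x T reads "x has height at most T". *)
Record height_structure (R : comNzRingType) (m : nat) (h : R -> nat -> Prop) : Prop :=
  HeightStructure {
    height_dim_gt0 : (0 < m)%N;
    heightM : forall x y T U, h x T -> h y U -> h (x * y) (T * U)%N;
    heightB : forall x y T U, h x T -> h y U -> h (x - y) (T + U)%N;
    heightD : forall x y T U, h x T -> h y U -> h (x + y) (T + U)%N;
    height_leq : forall x T U, (T <= U)%N -> h x T -> h x U;
    height_seq : forall s : seq R, exists T, forall x, x \in s -> h x T;
    height_lower_box : exists c1 : nat, (0 < c1)%N /\ forall T : nat,
      exists2 f : {ffun 'I_m -> 'I_T.+1} -> R, injective f & forall a, h (f a) (c1 * T)%N;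
    height_upper_box : exists c2 : nat, forall T : nat,
      exists g : R -> {ffun 'I_m -> 'I_(c2 * T).+1},
        forall x y, h x T -> h y T -> g x = g y -> x = y;
    height_cells : forall T : nat,
      exists cell : R -> {ffun 'I_m -> 'I_(m * (trunc_log 2 T).+1).+1},
        forall x y u, x != 0 -> y != 0 -> h x T -> h y T -> cell x = cell y ->
          y = u * x -> h u 2
  }.

Lemma ring_of_integers_heights (K : fieldExtType rat) :
  exists m h, @height_structure (ring_of_integers K) m h.
Proof.
have [m [sig [z [m0 intz inj span]]]] := number_field_embeddings K.
exists m, (hle sig); split => //.
- exact: hleM.
- exact: hleB.
- exact: hleD.
- exact: hle_leq.
- exact: hle_seq_exists.
- exact: hle_lower_box inj.
- exact: hle_upper_box span.
- exact: hle_cells span.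
Qed.

(** * Counting ideals *)

(* fin_ring finS is S, given the finType structure that comes from the proof finS that S is
   finite. *)
Section FiniteRing.
Variables (S : comPzRingType) (finS : finite_set [set: S]).

Definition fin_ring of finite_set [set: S] : Type := S.

HB.instance Definition _ := GRing.ComPzRing.copy (fin_ring finS) S.

Let fin_enum : seq (fin_ring finS) := fset_set [set: S].

Let mem_fin_enum (x : fin_ring finS) : x \in fin_enum.
Proof. by rewrite /fin_enum (@in_fset_set _ _ finS) in_setT. Qed.

Fact fin_ring_pickleK :
  pcancel (index^~ fin_enum) (fun n => nth None (map Some fin_enum) n).
Proof.
by move=> x; rewrite (nth_map x) ?index_mem ?mem_fin_enum // nth_index ?mem_fin_enum.
Qed.

HB.instance Definition _ : isCountable (fin_ring finS) := PCanIsCountable fin_ring_pickleK.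

Fact fin_ring_enumP : Finite.axiom fin_enum.
Proof. by move=> x; rewrite count_uniq_mem ?fset_uniq ?mem_fin_enum. Qed.

HB.instance Definition _ := fintype.isFinite.Build (fin_ring finS) fin_ring_enumP.

End FiniteRing.

Lemma ncard_finType (T : finType) (A : set T) : ncard A = #|[pred x | x \in A]|.
Proof.
rewrite /ncard cardE; apply/perm_size/uniq_perm; rewrite ?fset_uniq ?enum_uniq //.
by move=> x; rewrite in_fset_set; [exact: esym (mem_enum _ _) | exact: finite_finset].
Qed.

Lemma bounded_uniq_finite (T : choiceType) (A : set T) (B : nat) :
  (forall s : seq T, uniq s -> (forall x, x \in s -> A x) -> (size s <= B)%N) -> finite_set A.
Proof.
move=> sB; apply: contrapT => /(infinite_set_fset B.+1) [F FA BF].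
by have := sB F (fset_uniq F) (fun x xF => FA x xF); rewrite leqNgt BF.
Qed.

Lemma ncard_leq (T : choiceType) (B : nat) :
  (forall s : seq T, uniq s -> (size s <= B)%N) ->
  finite_set [set: T] /\ (ncard [set: T] <= B)%N.
Proof.
move=> sB; split; last exact/sB/fset_uniq.
by apply: bounded_uniq_finite => s us _; exact: sB.
Qed.

Section IdealNorm.
Variables (R : comNzRingType).
Implicit Types (I J : ideal R).

Definition fin_quot I := finite_set [set: quotient_ring I].

Lemma ideal_zero I : 0 \in ideal_pred I.
Proof. by case: (ideal_zmod_closed I). Qed.

Lemma idealB I x y : x \in ideal_pred I -> y \in ideal_pred I -> x - y \in ideal_pred I.
Proof. by case: (ideal_zmod_closed I) => _; apply. Qed.

Lemma idealN I x : x \in ideal_pred I -> - x \in ideal_pred I.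
Proof. by move=> xI; rewrite -sub0r idealB ?ideal_zero. Qed.

Lemma idealD I x y : x \in ideal_pred I -> y \in ideal_pred I -> x + y \in ideal_pred I.
Proof. by move=> xI yI; rewrite -[y]opprK idealB ?idealN. Qed.

Lemma idealM I a x : x \in ideal_pred I -> a * x \in ideal_pred I.
Proof. exact: ideal_mul_closed. Qed.

Lemma eq_ideal I J : ideal_pred I =i ideal_pred J -> I = J.
Proof.
case: I J => [I Iz Im] [J Jz Jm] /= IJ.
have {}IJ : I = J by apply/funext => x; exact: IJ.
subst J; congr Ideal; exact: Prop_irrelevance.
Qed.

Lemma fin_quot_ncard I (f : fin_quot I) : ideal_norm I = #|{: fin_ring f}|.
Proof.
rewrite /ideal_norm (@ncard_finType (fin_ring f)); apply: eq_card => x.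
by rewrite !inE in_setT.
Qed.

(** Finiteness is concluded together with the bound because [ncard] gives an infinite quotient the
    norm 0. *)
Lemma ideal_norm_leq I (B : nat) :
  (forall n (r : 'I_n -> R), (forall i j, r i - r j \in ideal_pred I -> i = j) -> (n <= B)%N) ->
  fin_quot I /\ (ideal_norm I <= B)%N.
Proof.
move=> rB; apply: ncard_leq => s us.
apply: (rB _ (fun i => quotient_repr (nth 0 s i))) => i j /quotient_mapP.
rewrite !quotient_reprK => /eqP; rewrite nth_uniq // => /eqP; exact: val_inj.
Qed.

Lemma leq_ideal_norm I (T : finType) (r : T -> R) : fin_quot I ->
  (forall i j, r i - r j \in ideal_pred I -> i = j) -> (#|T| <= ideal_norm I)%N.
Proof.
move=> f rI; rewrite (fin_quot_ncard f).
apply: (leq_card (fun i => quotient_map I (r i) : fin_ring f)) => i j.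
by move/quotient_mapP/rI.
Qed.

Lemma ideal_pigeonhole I (T : finType) (r : T -> R) : fin_quot I ->
  (ideal_norm I < #|T|)%N -> exists i j, i <> j /\ r i - r j \in ideal_pred I.
Proof.
move=> f IT; apply: contrapT => nex; move: IT; rewrite ltnNge.
rewrite (leq_ideal_norm f (r := r)) // => i j rij; apply: contrapT => ij.
by apply: nex; exists i, j.
Qed.

Lemma ideal_norm_reps I : fin_quot I -> exists r : 'I_(ideal_norm I) -> R,
  (forall i j, r i - r j \in ideal_pred I -> i = j) /\
  forall x, exists i, x - r i \in ideal_pred I.
Proof.
move=> f; rewrite (fin_quot_ncard f).
exists (fun i => quotient_repr (enum_val i : fin_ring f)); split.
  move=> i j /quotient_mapP; rewrite !quotient_reprK => h.
  exact: (@enum_val_inj (fin_ring f) _ _ _ h).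
move=> x; exists (enum_rank (quotient_map I x : fin_ring f)).
by apply/quotient_mapP; rewrite enum_rankK quotient_reprK.
Qed.

Lemma ideal_norm_gt0 I : fin_quot I -> (0 < ideal_norm I)%N.
Proof.
move=> f; rewrite (fin_quot_ncard f); apply/card_gt0P.
by exists (0 : fin_ring f).
Qed.

Lemma fin_quotS I J : {subset ideal_pred I <= ideal_pred J} -> fin_quot I ->
  fin_quot J /\ (ideal_norm J <= ideal_norm I)%N.
Proof.
move=> IJ f; apply: ideal_norm_leq => n r rJ; rewrite -[X in (X <= _)%N]card_ord.
by apply: (leq_ideal_norm f (r := r)) => i j /IJ/rJ.
Qed.

Section MakeIdeal.
Variable P : R -> Prop.
Hypotheses (P0 : P 0) (PB : forall x y, P x -> P y -> P (x - y))
  (PM : forall a x, P x -> P (a * x)).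

Let pP : R -> bool := fun x => `[<P x>].

Fact mk_ideal_zmod : zmod_closed pP.
Proof.
by split; [apply/asboolP | move=> x y /asboolP Px /asboolP Py; apply/asboolP/PB].
Qed.

Fact mk_ideal_mul (a : R) : {in pP, forall x, a * x \in pP}.
Proof. by move=> x /asboolP Px; apply/asboolP/PM. Qed.

Definition mk_ideal : ideal R := Ideal mk_ideal_zmod mk_ideal_mul.

Lemma mem_mk_ideal x : (x \in ideal_pred mk_ideal) <-> P x.
Proof. by split=> [/asboolP|Px] //; apply/asboolP. Qed.

End MakeIdeal.

End IdealNorm.

Lemma nat_root (m Y : nat) : (0 < m)%N -> exists t, (t ^ m <= Y < t.+1 ^ m)%N.
Proof.
move=> m_gt0; have ex : exists t, (Y < t.+1 ^ m)%N.
  by exists Y; case: m m_gt0 => // m _; rewrite expnS leq_pmulr // expn_gt0.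
exists (ex_minn ex); case: ex_minnP => -[|t] tY min.
  by rewrite exp0n // tY.
by rewrite tY andbT leqNgt; apply/negP => /min; rewrite ltnn.
Qed.

Lemma leq_card_inj_in (T1 T2 : finType) (A : {set T1}) (f : T1 -> T2) :
  {in A &, injective f} -> (#|A| <= #|T2|)%N.
Proof. by move=> inj; rewrite -(card_in_imset inj) max_card. Qed.

Section IdealCounting.
Variables (R : comNzRingType) (m : nat) (h : R -> nat -> Prop).
Hypotheses (H : height_structure m h)
  (Rdomain : forall x y : R, x * y = 0 -> x = 0 \/ y = 0)
  (Rchar0 : forall n : nat, n.+1%:R != 0 :> R).

Let m_gt0 := height_dim_gt0 H.

Lemma domain_mulI (a x y : R) : a != 0 -> a * x = a * y -> x = y.
Proof.
move=> a0 /eqP; rewrite -subr_eq0 -mulrBr => /eqP/Rdomain[|/eqP].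
  by move=> a00; rewrite a00 eqxx in a0.
by rewrite subr_eq0 => /eqP.
Qed.

Definition principal (a : R) : ideal R.
Proof.
apply: (@mk_ideal R (fun x => exists y, x = y * a)).
- by exists 0; rewrite mul0r.
- by move=> _ _ [x ->] [y ->]; exists (x - y); rewrite mulrBl.
- by move=> b _ [x ->]; exists (b * x); rewrite mulrA.
Defined.

Lemma principalP a x : (x \in ideal_pred (principal a)) <-> exists y, x = y * a.
Proof. exact: mem_mk_ideal. Qed.

Lemma mem_principal a : a \in ideal_pred (principal a).
Proof. by apply/principalP; exists 1; rewrite mul1r. Qed.

Lemma principal_sub a (I : ideal R) :
  a \in ideal_pred I -> {subset ideal_pred (principal a) <= ideal_pred I}.
Proof. by move=> aI x /principalP[y ->]; apply: idealM. Qed.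

(** A packing argument: if the r_i are incongruent modulo a, their translates by a times a large box
    are disjoint, and all of them lie in a box that is only O(T) times wider. *)
Lemma principal_norm_bound : exists C : nat, forall (a : R) (T : nat),
  a != 0 -> (0 < T)%N -> h a T ->
  fin_quot (principal a) /\ (ideal_norm (principal a) <= C * T ^ m)%N.
Proof.
have [c1 [c1_gt0 lower]] := height_lower_box H.
have [c2 upper] := height_upper_box H.
exists ((1 + c1 * c2) ^ m)%N => a T a0 T_gt0 ha; apply: ideal_norm_leq => n r r_inj.
have [U hU] := height_seq H [seq r i | i <- enum 'I_n].
have {}hU i : h (r i) U by apply: hU; apply/mapP; exists i; rewrite ?mem_enum.
(* With this T' the heights of the r_i contribute exactly T' to the side of the outer box, so U
   disappears from the bound after division by [T'.+1 ^ m]. *)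
pose T' := (c2 * U)%N; have [f f_inj hf] := lower T'.
pose X := (U + T * (c1 * T'))%N; have [g g_inj] := upper X.
pose F (p : 'I_n * {ffun 'I_m -> 'I_T'.+1}) := r p.1 + a * f p.2.
have hF p : h (F p) X by apply: (heightD H) => //; apply: (heightM H).
have F_inj : injective (g \o F).
  move=> [i b] [j c] /= /(g_inj _ _ (hF _) (hF _)); rewrite /F /= => ibjc.
  have ij : i = j.
    apply: r_inj; apply/principalP; exists (f c - f b).
    have -> : r i = r j + a * f c - a * f b by rewrite -ibjc addrK.
    by ring.
  subst j; congr (_, _); apply: f_inj; apply: (domain_mulI a0).
  exact: addrI ibjc.
have := leq_card _ F_inj; rewrite card_prod !card_ffun !card_ord => nX.
have {}nX : (n * T'.+1 ^ m <= ((1 + c1 * c2 * T) * T'.+1) ^ m)%N.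
  apply: leq_trans nX _; rewrite leq_exp2r //; rewrite /X /T'.
  have -> : (c2 * (U + T * (c1 * (c2 * U))) = c2 * U + c1 * c2 * T * (c2 * U))%N by ring.
  by rewrite mulnDl mul1n -addSn leq_add2l leq_mul2l leqnSn orbT.
rewrite expnMn leq_pmul2r ?expn_gt0 // in nX.
rewrite -expnMn; apply: leq_trans nX _; rewrite leq_exp2r //.
by rewrite mulnDl mul1n leq_add2r.
Qed.

(** Minkowski's bound by pigeonhole: if t^m <= N(I) < (t + 1)^m, the box of side t has two elements
    congruent modulo I, and their difference is small. *)
Lemma ideal_small_element : exists C : nat, forall I : ideal R, fin_quot I ->
  exists a T, [/\ a != 0, a \in ideal_pred I, (0 < T)%N, h a T & (T ^ m <= C * ideal_norm I)%N].
Proof.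
have [c1 [c1_gt0 lower]] := height_lower_box H.
exists ((2 * c1) ^ m)%N => I fI.
have [t /andP[tN Nt]] := nat_root (ideal_norm I) m_gt0.
have t_gt0 : (0 < t)%N.
  by case: t {tN} Nt => //; rewrite exp1n ltnNge ideal_norm_gt0.
have [f f_inj hf] := lower t.
have [|b [c [bc fbc]]] := @ideal_pigeonhole _ _ _ f fI.
  by rewrite card_ffun !card_ord.
exists (f b - f c), (2 * c1 * t)%N; split => //.
- by rewrite subr_eq0; apply/eqP => /f_inj.
- by rewrite !muln_gt0 c1_gt0.
- by rewrite -mulnA mul2n -addnn; apply: (heightB H).
- by rewrite expnMn leq_mul2l tN orbT.
Qed.

Lemma fin_quot_nonzero (I : ideal R) : nonzero_ideal I -> fin_quot I.
Proof.
have [C prB] := principal_norm_bound.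
case=> a aI a0; have [T hT] := height_seq H [:: a].
have ha : h a T.+1 by apply: (height_leq H (leqnSn T)); apply: hT; rewrite inE.
have [fa _] := prB a T.+1 a0 isT ha.
exact: (fin_quotS (principal_sub aI) fa).1.
Qed.

Lemma nonzero_principal a : a != 0 -> nonzero_ideal (principal a).
Proof. by exists a => //; apply: mem_principal. Qed.

Lemma natr_neq0 (n : nat) : (0 < n)%N -> n%:R != 0 :> R.
Proof. by case: n. Qed.

(** An ideal containing k is the preimage of its image in the finite ring R/(k), so there are only
    finitely many such ideals. *)
Lemma ideal_trace_code (k : R) (fk : fin_quot (principal k)) :
  exists code : ideal R -> {set fin_ring fk}, forall I J : ideal R,
    k \in ideal_pred I -> k \in ideal_pred J -> code I = code J -> I = J.
Proof.
exists (fun I : ideal R =>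
  [set q : fin_ring fk | @quotient_repr _ (principal k) q \in ideal_pred I]) => I J kI kJ IJ.
have memE (L : ideal R) x : k \in ideal_pred L -> (x \in ideal_pred L) =
    (quotient_repr (quotient_map (principal k) x) \in ideal_pred L).
  move=> kL; set y := quotient_repr _.
  have xy : x - y \in ideal_pred L.
    by apply: (principal_sub kL); apply/quotient_mapP; rewrite quotient_reprK.
  apply/idP/idP => [xL|yL]; last by rewrite -(subrK y x) idealD.
  by rewrite -[y](subKr x) idealB.
apply: eq_ideal => x; rewrite (memE I) // (memE J) //.
have /setP/(_ (quotient_map (principal k) x : fin_ring fk)) := IJ.
by rewrite !inE.
Qed.

(** The argument behind the finiteness of the class number: a small element a of I has bounded index
    in I, so a fixed k maps I into (a), and k * I = a * J for an ideal J containing k. There are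
    O(X) choices of a and boundedly many of J. *)
Lemma ideal_count_upper : exists C : nat, forall (X : nat) (s : seq (ideal R)),
  uniq s -> (forall I, I \in s -> nonzero_ideal I /\ (ideal_norm I <= X)%N) ->
  (size s <= C * X)%N.
Proof.
have [C3 prB] := principal_norm_bound.
have [C5 smallB] := ideal_small_element.
have [c2 upper] := height_upper_box H.
(* N(a) <= C3 * T^m <= C * N(I) for the small element a of I, so multiplication by C! kills
   I/(a). *)
pose C := (C3 * C5)%N; pose k : R := (C`!)%:R.
have k0 : k != 0 by apply: natr_neq0; rewrite fact_gt0.
have fk : fin_quot (principal k) by apply/fin_quot_nonzero/nonzero_principal.
have [code codeP] := ideal_trace_code fk.
(* Pigeonhole for the residues r_i + u * x modulo a, with u <= C: since a and x lie in I, a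
   collision forces equal r_i and leaves (u - v) * x in (a), where u - v divides C!. *)
have mulk (I : ideal R) a T x : fin_quot I -> a != 0 -> a \in ideal_pred I -> (0 < T)%N ->
    h a T -> (T ^ m <= C5 * ideal_norm I)%N -> x \in ideal_pred I -> exists y, k * x = a * y.
  move=> fI a0 aI T0 ha Tm xI; have [fa na] := prB a T a0 T0 ha.
  have [r [r_inj _]] := ideal_norm_reps fI.
  pose F (p : 'I_(ideal_norm I) * 'I_C.+1) := r p.1 + (p.2 : nat)%:R * x.
  have [|[i u] [[j v] [ijuv]]] := @ideal_pigeonhole _ _ _ F fa.
    rewrite card_prod !card_ord; apply: leq_ltn_trans na _.
    apply: (@leq_ltn_trans (C * ideal_norm I)%N); first by rewrite -mulnA leq_mul2l Tm orbT.
    by rewrite mulnC ltn_pmul2l // ideal_norm_gt0.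
  rewrite /F /= => Fij.
  have DF : r i + (u : nat)%:R * x - (r j + (v : nat)%:R * x)
     = (r i - r j) + ((u : nat)%:R - (v : nat)%:R) * x by ring.
  have ij : i = j.
    apply: r_inj; rewrite -[X in X \in _](addrK (((u : nat)%:R - (v : nat)%:R) * x)) -DF.
    by apply: idealB; [exact: (principal_sub aI) | exact: idealM].
  subst j; move: Fij; rewrite DF subrr add0r => /principalP[y Dy].
  have uv : (u : nat) <> v by move=> uv; apply: ijuv; congr (_, _); apply: val_inj.
  wlog ltuv : u v y Dy uv {ijuv DF} / (v < u)%N.
    move=> WL; have [vu|vu] := ltnP v u; first exact: (WL u v y).
    apply: (WL v u (- y)); last by rewrite ltn_neqAle vu andbT; apply/eqP.
      by rewrite -opprB mulNr Dy mulNr.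
    exact/nesym.
  have /dvdnP[q Dq] : (u - v %| C`!)%N.
    by rewrite dvdn_fact // subn_gt0 ltuv (leq_trans (leq_subr _ _)) // -ltnS.
  exists (q%:R * y); rewrite /k Dq natrM natrB ?(ltnW ltuv) //.
  by rewrite -mulrA Dy; ring.
exists (C5.+1 * c2.+1 ^ m * 2 ^ #|{: fin_ring fk}|)%N => X s us sX.
have [|X0] := posnP X.
  move=> X0; case: s us sX => // I s _ /(_ I); rewrite inE eqxx => /(_ isT)[nI].
  by rewrite X0 leqn0 => /eqP n0; have := ideal_norm_gt0 (fin_quot_nonzero nI); rewrite n0.
(* The successor makes t positive even if C5 = 0. *)
have [t /andP[tX Xt]] := nat_root (C5.+1 * X) m_gt0.
have t_gt0 : (0 < t)%N.
  case: t {tX} Xt => //; rewrite exp1n ltnS leqn0 muln_eq0 /= => /eqP X00.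
  by rewrite X00 in X0.
have [g g_inj] := upper t.
(* I is recovered from the pair (a, J) as the set of x with k * x in a * J. *)
pose Q (I : ideal R) (p : R * ideal R) :=
  [/\ h p.1 t, p.1 != 0, k \in ideal_pred p.2 &
      forall x, x \in ideal_pred I <-> exists2 y, y \in ideal_pred p.2 & k * x = p.1 * y].
have exQ I : I \in s -> exists p, Q I p.
  move=> /sX[nI NX]; have fI := fin_quot_nonzero nI.
  have [a [T [a0 aI T0 ha Tm]]] := smallB I fI.
  have kx := mulk I a T _ fI a0 aI T0 ha Tm.
  pose P y := exists2 x, x \in ideal_pred I & k * x = a * y.
  have P0 : P 0 by exists 0; rewrite ?ideal_zero // !mulr0.
  have PB y1 y2 : P y1 -> P y2 -> P (y1 - y2).
    move=> [x1 x1I Dx1] [x2 x2I Dx2]; exists (x1 - x2); first exact: idealB.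
    by rewrite !mulrBr Dx1 Dx2.
  have PM b y : P y -> P (b * y).
    by move=> [x xI Dx]; exists (b * x); [exact: idealM | rewrite mulrCA Dx mulrCA].
  have JP y : y \in ideal_pred (mk_ideal P0 PB PM) <-> P y by exact: mem_mk_ideal.
  exists (a, mk_ideal P0 PB PM); split => /=.
  - apply: (height_leq H _ ha); rewrite -ltnS -(ltn_exp2r _ _ m_gt0).
    by apply: leq_ltn_trans Xt; apply: leq_trans Tm _; rewrite leq_mul ?leqnSn.
  - by [].
  - apply/JP; exists a; [exact: aI | exact: mulrC].
  - move=> x; split=> [xI|[y /JP[x' x'I Dx'] Dx]].
      have [y Dy] := kx x xI; exists y => //; apply/JP; by exists x.
    by rewrite (domain_mulI k0 (etrans Dx (esym Dx'))).
have [c cP] : exists c, forall I, I \in s -> Q I (c I).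
  have /choice[c cP] : forall I, exists p, I \in s -> Q I p.
    move=> I; case: (boolP (I \in s)) => [/exQ[p Qp]|_]; first by exists p.
    by exists (0, I).
  by exists c.
pose code' (i : 'I_(size s)) := let I := nth (principal 0) s i in (g (c I).1, code (c I).2).
have code'_inj : injective code'.
  move=> i j []; set I := nth _ s i; set J := nth _ s j => gij cij.
  have [hI aI0 kI memI] := cP I (mem_nth _ (ltn_ord i)).
  have [hJ aJ0 kJ memJ] := cP J (mem_nth _ (ltn_ord j)).
  have DI := g_inj _ _ hI hJ gij; have DJ := codeP _ _ kI kJ cij.
  have IJ : I = J.
    apply: eq_ideal => x; apply/idP/idP.
      by move/memI => [y yI Dx]; apply/memJ; exists y; rewrite -?DI -?DJ.
    by move/memJ => [y yI Dx]; apply/memI; exists y; rewrite ?DI ?DJ.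
  by apply: val_inj; apply/eqP; move/eqP: IJ; rewrite nth_uniq.
have := leq_card _ code'_inj; rewrite card_prod card_ffun !card_ord => sz.
apply: leq_trans sz _; rewrite -cardsT -powersetT card_powerset cardsT.
rewrite [X in (_ <= X)%N]mulnAC leq_mul2r; apply/orP; right.
rewrite mulnAC; apply: (@leq_trans (t ^ m * c2.+1 ^ m)%N); last by rewrite leq_mul2r tX orbT.
rewrite -expnMn leq_exp2r // mulnS mulnC -add1n leq_add2r //.
Qed.

End IdealCounting.

(** * Many principal ideals of bounded norm *)

Section IdealLowerCount.
Variables (R : comNzRingType) (m : nat) (h : R -> nat -> Prop).
Hypotheses (H : height_structure m h)
  (Rdomain : forall x y : R, x * y = 0 -> x = 0 \/ y = 0).

Let m_gt0 := height_dim_gt0 H.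

(** Generators of one ideal differ by units, whose number is not controlled directly. Within one
    cell, however, the unit has height at most 2, so an ideal has only O(log^m T) generators in the
    box. *)
Lemma ideal_count_lower : exists C : nat, (0 < C)%N /\ forall T : nat, (0 < T)%N ->
  exists s : seq (ideal R), [/\ uniq s,
    forall I, I \in s -> nonzero_ideal I /\ (ideal_norm I <= C * T ^ m)%N &
    (T ^ m <= size s * (C * (trunc_log 2 T).+1 ^ m))%N].
Proof.
have [C3 prB] := principal_norm_bound H Rdomain.
have [c1 [c1_gt0 lower]] := height_lower_box H.
have [c2 upper] := height_upper_box H.
have [g g_inj] := upper 2%N.
(* The factors bound the number of cells up to a power of log T, the number of elements of height 2,
   and the passage from [(size s).+1] to [size s]. *)
pose C7 := ((m * (trunc_log 2 c1 + 2)).+1 ^ m * (c2 * 2).+1 ^ m * 2)%N.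
exists (C3 * c1 ^ m + C7)%N; split.
  by rewrite addn_gt0 orbC /C7 !muln_gt0 !expn_gt0.
move=> T T_gt0; have [f f_inj hf] := lower T.
have cT_gt0 : (0 < c1 * T)%N by rewrite muln_gt0 c1_gt0.
have [cell cellP] := height_cells H (c1 * T)%N.
pose B := [set b | f b != 0]; pose s := undup [seq principal (f b) | b in B].
have sP b : f b != 0 -> principal (f b) \in s.
  by move=> fb; rewrite mem_undup; apply/mapP; exists b; rewrite ?mem_enum ?inE.
exists s; split; first exact: undup_uniq.
  move=> I; rewrite mem_undup => /mapP[b]; rewrite mem_enum inE => fb ->.
  split; first exact: nonzero_principal.
  have [_ nb] := prB _ _ fb cT_gt0 (hf b); apply: leq_trans nb _.
  by rewrite expnMn mulnA leq_mul2r leq_addr orbT.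
(* The box has [T.+1 ^ m] elements, of which at most one is 0. *)
have TB : (T ^ m <= #|B|)%N.
  have : (#|~: B| <= 1)%N.
    apply/card_le1_eqP => b c; rewrite !inE !negbK => /eqP fb /eqP fc.
    by apply: f_inj; rewrite fb fc.
  move=> BC; have : (T ^ m < T.+1 ^ m)%N by rewrite ltn_exp2r.
  have := cardsC B; rewrite card_ffun !card_ord => <- h1.
  by rewrite -ltnS; apply: leq_trans h1 _; rewrite -[X in (_ <= X)%N]addn1 leq_add2l.
pose key b := (principal (f b), cell (f b)).
have [rep repP] : exists rep : {ffun 'I_m -> 'I_T.+1} -> {ffun 'I_m -> 'I_T.+1},
    (forall b, b \in B -> rep b \in B /\ key (rep b) = key b) /\
    (forall b c, b \in B -> c \in B -> key b = key c -> rep b = rep c).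
  exists (fun b => odflt b [pick c | (c \in B) && (key c == key b)]); split.
    move=> b bB; case: pickP => [c /andP[cB /eqP kc] //|] nob.
    by have := nob b; rewrite /= bB eqxx.
  move=> b c bB cB bc; rewrite bc; case: pickP => // noc.
  by have := noc c; rewrite /= cB eqxx.
have {}[repB rep_eq] := repP.
have exu b : exists u, b \in B -> f b = u * f (rep b).
  case: (boolP (b \in B)) => [bB|_]; last by exists 0.
  have [rB kk] := repB b bB; have kb : principal _ = principal _ := congr1 fst kk.
  have : f b \in ideal_pred (principal (f (rep b))) by rewrite kb mem_principal.
  by move=> /principalP[u Du]; exists u.
have [u uP] := choice exu.
have hu b : b \in B -> h (u b) 2.
  move=> bB; have [rB kk] := repB b bB; have cb : cell _ = cell _ := congr1 snd kk.
  move: (rB) (bB); rewrite !inE => fr fb.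
  by apply: (cellP (f (rep b)) (f b)) => //; exact: uP.
(* The ideal and the cell of [f b] determine the representative; multiplying it by [u b] gives [f b]
   back. *)
pose code' b : 'I_(size s).+1 * _ * _ := ((inord (index (principal (f b)) s), cell (f b)), g (u b)).
have code_inj : {in B &, injective code'}.
  move=> b c bB cB [kb cb gb].
  have ib : index (principal (f b)) s = index (principal (f c)) s.
    by move: kb => /(congr1 val); rewrite /= !inordK // ltnS index_size.
  have pb : principal (f b) = principal (f c).
    have sb : principal (f b) \in s by apply: sP; move: bB; rewrite inE.
    have sc : principal (f c) \in s by apply: sP; move: cB; rewrite inE.
    by rewrite -(nth_index (principal 0) sb) -(nth_index (principal 0) sc) ib.
  apply: f_inj; rewrite (uP b bB) (uP c cB) (rep_eq b c bB cB) ?/key ?pb ?cb //.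
  by congr (_ * _); apply: g_inj => //; exact: hu.
have := leq_card_inj_in code_inj; rewrite !card_prod !card_ffun !card_ord => BS.
have s_gt0 : (0 < size s)%N.
  rewrite lt0n size_eq0; apply/eqP => s0.
  have /card_gt0P[b bB] : (0 < #|B|)%N by apply: leq_trans TB; rewrite expn_gt0 T_gt0.
  by have := sP b; rewrite s0 inE; move: bB; rewrite inE => -> /(_ isT).
apply: leq_trans TB (leq_trans BS _).
set L := trunc_log 2 T; set L1 := trunc_log 2 c1 in C7 *.
have L2 : (trunc_log 2 (c1 * T) <= L1 + L + 1)%N.
  rewrite -ltnS -(ltn_exp2l _ _ (isT : (1 < 2)%N)).
  apply: leq_ltn_trans (trunc_logP _ cT_gt0) _ => //.
  have -> : ((L1 + L + 1).+1 = L1.+1 + L.+1)%N by lia.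
  by rewrite expnD; apply: ltn_mul; exact: trunc_log_ltn.
have cells : ((m * (trunc_log 2 (c1 * T)).+1).+1 ^ m <= (m * (L1 + 2)).+1 ^ m * L.+1 ^ m)%N.
  rewrite -expnMn leq_exp2r //.
  apply: (@leq_trans (m * (L1 + L + 2)).+1); first by rewrite ltnS leq_mul2l; apply/orP; right; lia.
  nia.
apply: (@leq_trans ((size s * 2) * ((m * (L1 + 2)).+1 ^ m * L.+1 ^ m) * (c2 * 2).+1 ^ m)).
  rewrite leq_mul2r; apply/orP; right; apply: leq_mul => //.
  by rewrite muln2 -addnn -addn1 leq_add2l.
rewrite -mulnA -mulnA leq_mul2l; apply/orP; right.
apply: (@leq_trans (C7 * L.+1 ^ m)); last by rewrite leq_mul2r leq_addl orbT.
by rewrite /C7 -/L1; apply/eq_leq; ring.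
Qed.

End IdealLowerCount.

(** * Solutions of [v *m A(z) = 0] over a ring whose ideals form a chain *)

Lemma meval_linear (R : comNzRingType) (d : nat) (p : mpoly.mpoly d R) (w : 'I_d -> R) :
  (forall u, mpoly.mdeg u != 1%N -> mpoly.mcoeff u p = 0) ->
  mpoly.meval w p = \sum_j mpoly.mcoeff (mpoly.mnm1 j) p * w j.
Proof.
move=> p1; have -> : p = \sum_j mpoly.mcoeff (mpoly.mnm1 j) p *: mpoly.mpolyX R (mpoly.mnm1 j).
  apply/mpoly.mpolyP => u; rewrite raddf_sum /=.
  under eq_bigr => j _ do rewrite mpoly.mcoeffZ mpoly.mcoeffX.
  case: (boolP (mpoly.mdeg u == 1%N)) => [/mpoly.mdeg1P[i /eqP ->]|u1].
    rewrite (bigD1 i) //= eqxx mulr1 big1 ?addr0 // => j ji.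
    by rewrite mpoly.eq_mnm1 (negPf ji) mulr0.
  rewrite p1 // big1 // => j _; case: eqP => [ju|]; last by rewrite mulr0.
  by move: u1; rewrite -ju mpoly.mdeg1.
rewrite raddf_sum /=; apply: eq_bigr => j _.
rewrite mpoly.mevalZ mpoly.mevalXU raddf_sum /= (bigD1 j) //= mpoly.mcoeffZ mpoly.mcoeffX eqxx.
rewrite mulr1 big1 ?addr0 // => i ij.
by rewrite mpoly.mcoeffZ mpoly.mcoeffX mpoly.eq_mnm1 (negPf ij) mulr0.
Qed.

Section ArrangementForms.
Variables (K : fieldExtType rat) (d : nat) (A : central_arrangement K d).
Local Notation O := (ring_of_integers K).

Lemma form_coeff0 (H : hyps A) u : mpoly.mdeg u != 1%N -> mpoly.mcoeff u (Defs.form H) = 0.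
Proof.
move=> u1; apply/eqP; apply: contraNT u1; rewrite -mpoly.mcoeff_msupp => uH.
by apply/eqP; move/mpoly.dhomogP: (Defs.form_homog H); apply.
Qed.

Lemma form_at_basisE (H : hyps A) j : form_at_basis H j = mpoly.mcoeff (mpoly.mnm1 j) (Defs.form H).
Proof.
rewrite /form_at_basis (meval_linear _ (form_coeff0 H)) (bigD1 j) //= eqxx mulr1.
by rewrite big1 ?addr0 // => i /negPf ->; rewrite mulr0.
Qed.

Lemma mem_hyp (H : hyps A) (v : 'rV[K]_d) :
  (v \in val H) = (\sum_j \val (form_at_basis H j) * v 0 j == 0).
Proof.
rewrite formP meval_linear => [|u u1].
  by congr (_ == 0); apply: eq_bigr => j _; rewrite form_at_basisE mpoly.mcoeff_map_mpoly.
by rewrite mpoly.mcoeff_map_mpoly form_coeff0.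
Qed.

Section Specialise.
Variables (mu : flats A -> nat) (S : comPzRingType) (phi : {rmorphism O -> S}).

Definition lam (v : 'rV[S]_d) (H : hyps A) : S := \sum_j phi (form_at_basis H j) * v 0 j.

Lemma lamB v w H : lam (v - w) H = lam v H - lam w H.
Proof. by rewrite /lam -sumrB; apply: eq_bigr => j _; rewrite !mxE mulrBr. Qed.

Definition var_hyp (k : 'I_#|variable mu|) : hyps A := (val (enum_val k)).1.
Definition var_col (k : 'I_#|variable mu|) : 'I_#|column mu| := enum_rank (val (enum_val k)).2.

(** Every variable belongs to exactly one column, so the entries of v * A(z) depend on disjoint
    blocks of z and can be treated independently. *)
Lemma mul_specialiseE (v : 'rV[S]_d) (z : 'rV[S]_#|variable mu|) c :
  (v *m specialise phi (arr_matrix mu) z) 0 c =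
  \sum_(k | var_col k == c) lam v (var_hyp k) * z 0 k.
Proof.
rewrite mxE; under eq_bigr => j _ do rewrite mxE mulr_sumr.
rewrite exchange_big [RHS]big_mkcond /=; apply: eq_bigr => k _.
transitivity (\sum_j (if var_col k == c then phi (form_at_basis (var_hyp k) j) else 0) *
    v 0 j * z 0 k).
  apply: eq_bigr => j _; rewrite mulrA; congr (_ * _); rewrite mulrC; congr (_ * _).
  rewrite mxE raddf_sum /=.
  under eq_bigr => p _ do rewrite mpoly.mcoeffZ mpoly.mcoeffX mpoly.eq_mnm1.
  rewrite big_mkcond (bigD1 (enum_val k)) //= enum_valK eqxx mulr1 big1 ?addr0 => [|p pk].
    rewrite /var_col -(inj_eq enum_val_inj) enum_rankK /var_hyp.
    by case: ifP => // _; rewrite rmorph0.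
  case: ifP => // _; case: eqP => [rk|]; last by rewrite mulr0.
  by move: pk; rewrite -rk enum_rankK eqxx.
case: ifP => _; first by rewrite -mulr_suml.
by rewrite big1 // => j _; rewrite !mul0r.
Qed.

End Specialise.

End ArrangementForms.

(** Subtracting one chosen member of a fibre of f embeds the fibre in D. With [dif] a subtraction,
    this counts along an additive map with kernel inside D, while X may be any subset. *)
Lemma card_kernel_leq (T1 T2 T3 : finType) (X : {set T1}) (f : T1 -> T2) (E : {set T2})
    (dif : T1 -> T1 -> T3) (D : {set T3}) :
  (forall x, x \in X -> f x \in E) ->
  (forall x y, x \in X -> y \in X -> f x = f y -> dif x y \in D) ->
  (forall x x' y, dif x y = dif x' y -> x = x') ->
  (#|X| <= #|D| * #|E|)%N.
Proof.
move=> XE XD dif_inj.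
pose pre t := [pick x | (x \in X) && (f x == t)].
pose g x := (if pre (f x) is Some y then dif x y else dif x x, f x).
have preE x : x \in X -> exists y, [/\ pre (f x) = Some y, y \in X & f y = f x].
  move=> xX; rewrite /pre; case: pickP => [y /andP[yX /eqP fy]|nox]; first by exists y.
  by have := nox x; rewrite /= xX eqxx.
have g_inj : {in X &, injective g}.
  move=> x x' xX x'X; rewrite /g => -[+ fxx']; rewrite fxx'.
  by have [y [-> _ _]] := preE x' x'X; apply: dif_inj.
rewrite -cardsX -(card_in_imset g_inj); apply/subset_leq_card/fintype.subsetP => _ /imsetP[x xX ->].
rewrite inE /g /= XE // andbT.
by have [y [-> yX fy]] := preE x xX; apply: XD.
Qed.

Section ChainRing.
Variable S : finComPzRingType.

Definition annih (a : S) := [set u : S | a * u == 0].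
Definition mults (a : S) := [set u : S | [exists s, u == a * s]].
Definition msize (a : S) := #|mults a|.

Lemma multsP a u : reflect (exists s, u = a * s) (u \in mults a).
Proof. by rewrite inE; apply: (iffP existsP) => -[s /eqP]; exists s. Qed.

Lemma annihP a u : reflect (a * u = 0) (u \in annih a).
Proof. by rewrite inE; apply: eqP. Qed.

Lemma msize_gt0 a : (0 < msize a)%N.
Proof. by apply/card_gt0P; exists 0; apply/multsP; exists 0; rewrite mulr0. Qed.

Lemma msize_leq a : (msize a <= #|S|)%N.
Proof. exact: max_card. Qed.

Lemma msize0 : msize 0 = 1%N.
Proof.
rewrite /msize (_ : mults 0 = [set 0]) ?cards1 //; apply/setP => u.
rewrite [RHS]inE; apply/multsP/eqP => [[s ->]|->]; first by rewrite mul0r.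
by exists 0; rewrite mul0r.
Qed.

Lemma mem_mults a : a \in mults a.
Proof. by apply/multsP; exists 1; rewrite mulr1. Qed.

Lemma mults_sub a b : a \in mults b -> mults a \subset mults b.
Proof.
move=> /multsP[s ->]; apply/fintype.subsetP => _ /multsP[t ->]; apply/multsP.
by exists (s * t); rewrite mulrA.
Qed.

Lemma card_annih_rV n (a : S) : #|[set v : 'rV[S]_n | a *: v == 0]| = (#|annih a| ^ n)%N.
Proof.
rewrite -[n in RHS]card_ord -card_ffun_on.
pose f (v : 'rV[S]_n) := [ffun i => v 0 i].
have f_inj : injective f.
  by move=> v w /ffunP vw; apply/rowP => i; have := vw i; rewrite !ffunE.
rewrite -(card_imset _ f_inj); apply: eq_card => t; apply/imsetP/ffun_onP.
  move=> [v]; rewrite inE => /eqP av -> i; rewrite ffunE inE.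
  by move/rowP/(_ i): av; rewrite !mxE => /eqP.
move=> ta; exists (\row_i t i); last by apply/ffunP => i; rewrite ffunE mxE.
by rewrite inE; apply/eqP/rowP => i; rewrite !mxE; apply/eqP; have := ta i; rewrite inE.
Qed.

Lemma card_family_prod (I T : finType) (F : I -> {set T}) :
  #|[set t : {ffun I -> T} | [forall i, t i \in F i]]| = (\prod_i #|F i|)%N.
Proof.
transitivity #|family (fun i => mem (F i))|.
  by apply: eq_card => t; rewrite inE; apply/forallP/familyP.
by rewrite card_family foldrE big_map big_enum.
Qed.

Definition chain_ring := forall a b : S, a \in mults b \/ b \in mults a.

(** In a chain, principal ideals of equal size coincide; hence all these u lie in a single ideal
    with s elements. *)
Lemma chain_card_msize (s : nat) : chain_ring -> (#|[set u | msize u == s]| <= s)%N.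
Proof.
move=> chn; have [/eqP -> //|/finset.set0Pn[a]] := boolP ([set u | msize u == s] == finset.set0).
  by rewrite cards0.
rewrite inE => /eqP <-; apply/subset_leq_card/fintype.subsetP => u; rewrite inE => /eqP ua.
have [//|au] := chn u a.
have /eqP -> : mults a == mults u; last exact: mem_mults.
by rewrite finset.eqEcard mults_sub // -/(msize a) -/(msize u) ua leqnn.
Qed.

(* When all steps in the chain of principal ideals have index at least Q, their sizes are
   determined by their logarithms to base Q. *)
Lemma chain_trunc_log_inj (Q : nat) : chain_ring -> (1 < Q)%N ->
  (forall a b : S, b \in mults a -> a \notin mults b -> (Q * msize b <= msize a)%N) ->
  forall a b, trunc_log Q (msize a) = trunc_log Q (msize b) -> msize a = msize b.
Proof.
move=> chn Q1 hQ.
have mono a b : b \in mults a -> trunc_log Q (msize a) = trunc_log Q (msize b) -> msize a = msize b.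
  move=> ba; case: (boolP (a \in mults b)) => [ab _|ab].
    by apply/eqP; rewrite eqn_leq !subset_leq_card ?mults_sub.
  move=> lg; have := leq_trunc_log Q (hQ a b ba ab).
  by rewrite trunc_logMp ?msize_gt0 // lg ltnn.
move=> a b lg; have [ab|ba] := chn a b; last exact: mono.
by apply/esym/mono.
Qed.

End ChainRing.

Lemma leq_expn2r_weak (k a b : nat) : (a <= b)%N -> (a ^ k <= b ^ k)%N.
Proof. by case: k => // k ab; rewrite leq_exp2r. Qed.

Lemma dimv_rV (F : fieldType) (d : nat) : \dim (fullv : {vspace 'rV[F]_d}) = d.
Proof. by rewrite dimvf dim_matrix; exact: mul1n. Qed.

(** * Dimensions of intersections and integral coordinates from independent forms *)

Section ArrangementRank.
Variables (K : fieldExtType rat) (d : nat) (A : central_arrangement K d).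
Local Notation O := (ring_of_integers K).
Local Notation iota := (@ring_of_integers_val K).
Implicit Types (J : {set hyps A}) (H : hyps A).

Lemma intersectionU1 H J : intersection (H |: J) = (val H :&: intersection J)%VS.
Proof.
have [HJ|HJ] := boolP (H \in J); last by rewrite /intersection big_setU1.
rewrite (finset.setUidPr _) ?finset.sub1set //; apply/esym/capv_idPr.
by rewrite /intersection (bigD1 H) //= capvSl.
Qed.

Lemma mem_intersection J v : (v \in intersection J) = [forall H in J, v \in val H].
Proof.
apply/idP/forall_inP => [vJ H HJ|vJ].
  by apply: (subvP _ _ vJ); rewrite /intersection (bigD1 H) //= capvSl.
rewrite /intersection memvE; apply/subv_bigcapP => H HJ; rewrite -memvE; exact: vJ.
Qed.

Lemma dim_cap_hyp (U : {vspace 'rV[K]_d}) H : (\dim U <= (\dim (val H :&: U)).+1)%N.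
Proof.
pose f : 'Hom('rV[K]_d, 'rV[K]_1) :=
  linfun (mulmxr (\col_j \val (form_at_basis H j) : 'M[K]_(d, 1))).
have HE : val H = lker f.
  apply/vspaceP => v; rewrite mem_hyp memv_ker lfunE /=.
  have -> : \sum_j \val (form_at_basis H j) * v 0 j = (v *m \col_j \val (form_at_basis H j)) 0 0.
    by rewrite mxE; apply: eq_bigr => j _; rewrite mxE mulrC.
  apply/eqP/eqP => [v0|->]; last by rewrite mxE.
  by apply/rowP => i; rewrite ord1 v0 mxE.
rewrite -(limg_ker_dim f U) HE capvC -[X in (_ <= X)%N]addn1 leq_add2l.
by apply: leq_trans (dimvS (subvf _)) _; rewrite dimvf dim_matrix.
Qed.

Lemma dim_intersection_ge J : (d <= \dim (intersection J) + #|J|)%N.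
Proof.
elim: {J}#|J| {-2}J (erefl #|J|) => [J /eqP|k IH J Jk].
  rewrite cards_eq0 => /eqP ->; rewrite /intersection big_set0 cards0 addn0.
  by rewrite dimv_rV.
have /finset.set0Pn[H HJ] : J != finset.set0 by rewrite -cards_eq0 Jk.
move: Jk; rewrite (cardsD1 H J) HJ add1n => -[Jk].
apply: leq_trans (IH _ Jk) _; rewrite addnS -addSn leq_add2r.
by rewrite -{2}(finset.setD1K HJ) intersectionU1 dim_cap_hyp.
Qed.

Definition form_mx J : 'M[O]_(#|J|, d) := \matrix_(i, j) form_at_basis (enum_val i) j.

(** The equality case of [dim_intersection_ge]; it amounts to linear independence of the forms of
    J. *)
Definition independent J := (#|J| + \dim (intersection J) == d)%N.

(** In a linear relation, a hyperplane H with nonzero coefficient contains the intersection of the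
    others. Removing H would then keep the intersection and violate [dim_intersection_ge]. *)
Lemma independent_row_free J : independent J -> row_free (map_mx iota (form_mx J)).
Proof.
move=> indJ; rewrite -kermx_eq0; apply/eqP/row_matrixP => k; rewrite row0.
set u := row k _; have uB : u *m map_mx iota (form_mx J) = 0.
  by apply/eqP; rewrite -sub_kermx row_sub.
apply/eqP; apply: contraT => /rV0Pn[i0 ui0].
pose H := enum_val i0; have HJ : H \in J by apply: enum_valP.
suff sub : (intersection (J :\ H) <= val H)%VS.
  have := dim_intersection_ge (J :\ H); rewrite -(capv_idPr sub) -intersectionU1.
  rewrite finset.setD1K //; move: indJ; rewrite /independent (cardsD1 H J) HJ add1n addSn.
  by rewrite addnC => /eqP dE le_d; move: (leq_trans (eq_leq dE) le_d); rewrite ltnn.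
apply/subvP => v vJ; rewrite mem_hyp; apply/eqP/(mulfI ui0); rewrite mulr0.
have := congr1 (fun M : 'rV_d => (M *m v^T) 0 0) uB.
rewrite mul0mx [RHS]mxE -mulmxA mxE (bigD1 i0) //= big1 ?addr0 => [|i ii0].
  move=> uB0; apply: etrans uB0; congr (_ * _); rewrite [RHS]mxE.
  by apply: eq_bigr => j _; rewrite !mxE.
suff -> : (map_mx iota (form_mx J) *m v^T) i 0 = 0 by rewrite mulr0.
have : v \in val (enum_val i).
  move: vJ; rewrite mem_intersection => /forall_inP; apply.
  by rewrite !inE enum_valP andbT (inj_eq enum_val_inj).
rewrite mem_hyp => /eqP v0; apply: etrans v0; rewrite mxE.
by apply: eq_bigr => j _; rewrite !mxE.
Qed.

Lemma clear_denominators (m n : nat) (M : 'M[K]_(m, n)) :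
  exists2 del : O, del != 0 & exists M' : 'M[O]_(m, n), map_mx iota M' = iota del *: M.
Proof.
have denom (x : K) : exists2 a : O, a != 0 & exists b : O, iota b = iota a * x.
  have [a a0 ax] := integral_multiple x.
  exists a%:~R; last by exists (mk_algint ax); rewrite rmorph_int.
  apply: contraNneq a0 => /(congr1 iota); rewrite rmorph_int rmorph0 => /eqP.
  by rewrite intr_number_field_eq0.
have /choice[a aP] : forall p : 'I_m * 'I_n, exists a : O,
    a != 0 /\ exists b : O, iota b = iota a * M p.1 p.2.
  by move=> p; have [a a0 ab] := denom (M p.1 p.2); exists a.
have iota_neq0 x : x != 0 -> iota x != 0.
  by apply: contraNneq => x0; apply/eqP/val_inj.
exists (\prod_p a p).
  apply/eqP => /(congr1 iota); rewrite rmorph_prod rmorph0 => /eqP; apply/negP.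
  by apply/prodf_neq0 => p _; have [ap _] := aP p; exact: iota_neq0.
have /choice[b bP] : forall p : 'I_m * 'I_n, exists b : O, iota b = iota (a p) * M p.1 p.2.
  by move=> p; have [_] := aP p.
exists (\matrix_(i, j) ((\prod_(p | p != (i, j)) a p) * b (i, j))).
apply/matrixP => i j; rewrite mxE mxE [RHS]mxE [in RHS](bigD1 (i, j)) //=.
set q := \prod_(p | p != (i, j)) a p.
change (iota q * iota (b (i, j)) = iota (a (i, j)) * iota q * M i j).
by rewrite bP mulrA [X in X * _]mulrC.
Qed.

(* C completes the independent forms of J to a basis up to the denominator del, so that the
   forms of J become almost independent coordinates over every ring. *)
Lemma independent_complement J : independent J ->
  exists r (C : 'M[O]_(r, d)) (B1 : 'M[O]_(d, #|J|)) (B2 : 'M[O]_(d, r)) (del : O),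
  [/\ (r = d - #|J|)%N, del != 0 & del%:M = B1 *m form_mx J + B2 *m C].
Proof.
move=> indJ; pose B := map_mx iota (form_mx J).
have rf : row_free B by exact: independent_row_free.
have [e e0 [C DC]] := clear_denominators (row_base (B^C)%MS).
have e0' : iota e != 0 by apply: contraNneq e0 => e0; apply/eqP/val_inj.
have /sub_addsmxP[[u1 u2] /= u12] : (1%:M <= B + row_base (B^C)%MS)%MS.
  rewrite (adds_eqmx (eqmx_refl B) (eq_row_base _)) submx_full //; exact: addsmx_compl_full.
have [e' e'0 [M DM]] := clear_denominators (row_mx (iota e *: u1) u2).
exists (\rank (B^C)%MS), C, (lsubmx M), (rsubmx M), (e' * e); split.
- by rewrite mxrank_compl (eqP rf).
- by apply/eqP => /ring_of_integers_mulf_eq0[] /eqP; apply/negP.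
have map_iota_inj m1 m2 (X Y : 'M[O]_(m1, m2)) : map_mx iota X = map_mx iota Y -> X = Y.
  by move=> /matrixP XY; apply/matrixP => i j; apply: val_inj; have := XY i j; rewrite !mxE.
apply: map_iota_inj; rewrite map_mxD !map_mxM map_lsubmx map_rsubmx DM DC.
rewrite scale_row_mx row_mxKl row_mxKr map_scalar_mx /=.
rewrite -scalemx1 u12 scalerDr !scalerA -!scalemxAl; congr (_ + _).
by rewrite -scalemxAr scalerA.
Qed.

(** The forms of J together with their complement C map v to d coordinates, and [del] kills the
    kernel of this map. The constant must depend neither on J nor on S. *)
Lemma card_lam_independent : exists2 del : O, del != 0 &
  forall (S : finComPzRingType) (phi : {rmorphism O -> S}) (T : hyps A -> {set S}) J,
  independent J ->
  (#|[set v : 'rV[S]_d | [forall H in J, lam phi v H \in T H]]| <=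
     #|annih (phi del)| ^ d * ((\prod_(H in J) #|T H|) * #|S| ^ \dim (intersection J)))%N.
Proof.
have /choice[del delP] : forall J, exists del : O, del != 0 /\
  forall (S : finComPzRingType) (phi : {rmorphism O -> S}) (T : hyps A -> {set S}),
  independent J ->
  (#|[set v : 'rV[S]_d | [forall H in J, lam phi v H \in T H]]| <=
     #|annih (phi del)| ^ d * ((\prod_(H in J) #|T H|) * #|S| ^ \dim (intersection J)))%N.
  move=> J; have [indJ|nindJ] := boolP (independent J); last first.
    by exists 1; split; [exact: oner_neq0 | move=> S phi T].
  have [r [C [B1 [B2 [del [Dr del0 Ddel]]]]]] := independent_complement indJ.
  exists del; split => // S phi T _.
  have -> : \dim (intersection J) = r.
    by rewrite Dr -[X in (X - _)%N](eqP indJ) addKn.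
  pose f (v : 'rV[S]_d) := ([ffun i : 'I_#|J| => lam phi v (enum_val i)], v *m (map_mx phi C)^T).
  pose E1 := [set t : {ffun 'I_#|J| -> S} | [forall i, t i \in T (enum_val i)]].
  have cE1 : #|E1| = (\prod_(H in J) #|T H|)%N.
    by rewrite card_family_prod [RHS]big_enum_val.
  rewrite -cE1 -card_annih_rV -[(#|S| ^ r)%N]mul1n.
  have <- : #|[set: 'rV[S]_r]| = (1 * #|S| ^ r)%N by rewrite cardsT card_mx !mul1n.
  rewrite -cardsX; apply: (@card_kernel_leq _ _ _ _ f _ (fun v w => v - w)).
  - move=> v; rewrite inE => /forall_inP vT; rewrite !inE andbT.
    by apply/forallP => i; rewrite ffunE; apply: vT; apply: enum_valP.
  - move=> v w _ _ [/ffunP vw1 vw2]; rewrite inE; set x := v - w.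
    have x1 : map_mx phi (form_mx J) *m x^T = 0.
      apply/colP => i; have := vw1 i; rewrite !ffunE => /eqP; rewrite -subr_eq0 -lamB => /eqP.
      by rewrite /lam mxE => x0; rewrite [RHS]mxE -[RHS]x0; apply: eq_bigr => j _; rewrite !mxE.
    have x2 : map_mx phi C *m x^T = 0.
      by apply: trmx_inj; rewrite trmx_mul trmxK trmx0 mulmxBl vw2 subrr.
    apply/eqP/trmx_inj; rewrite linearZ /= trmx0 -mul_scalar_mx -map_scalar_mx Ddel.
    by rewrite map_mxD !map_mxM mulmxDl -!mulmxA x1 x2 !mulmx0 addr0.
  - by move=> v v' w /addIr.
(* Annihilators only grow when [del J] is replaced by a multiple, so the product serves all J at
   once. *)
exists (\prod_J del J).
  apply/eqP => /(congr1 iota); rewrite rmorph_prod rmorph0 => /eqP; apply/negP.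
  apply/prodf_neq0 => J _; have [dJ _] := delP J.
  by apply: contraNneq dJ => dJ; apply/eqP/val_inj.
move=> S phi T J indJ; have [_ /(_ S phi T indJ) le] := delP J.
apply: leq_trans le _; rewrite leq_mul2r; apply/orP; right.
have sub : (#|annih (phi (del J))| <= #|annih (phi (\prod_J del J)%R)|)%N.
  apply/subset_leq_card/fintype.subsetP => u; rewrite !inE => /eqP u0.
  by rewrite (bigD1 J) //= rmorphM mulrAC u0 mul0r.
exact: leq_expn2r_weak.
Qed.

End ArrangementRank.

Lemma card_classes_leq (T1 T2 : finType) (f : T1 -> T2) (X : {set T1}) (b : nat) :
  (forall t, (#|[set x in X | f x == t]| <= b)%N) -> (#|X| <= #|T2| * b)%N.
Proof.
move=> fb; rewrite -sum1_card (partition_big f xpredT) //= -sum_nat_const.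
apply: leq_sum => t _; rewrite sum1dep_card; exact: fb.
Qed.

Lemma card_pairs_leq (T1 T2 : finType) (P : {set T1}) (X : {set T1 * T2}) (c e : nat) :
  (forall x, x \in X -> x.1 \in P) ->
  (forall v, v \in P -> (#|[set z | (v, z) \in X]| * c <= e)%N) ->
  (#|X| * c <= #|P| * e)%N.
Proof.
move=> XP Pc; have -> : (#|X| = \sum_(v in P) #|[set z | (v, z) \in X]|)%N.
  rewrite -sum1_card (partition_big fst (mem P)) //=; apply: eq_bigr => v vP.
  rewrite -sum1_card (reindex_onto (fun z => (v, z)) snd) /=; last first.
    by move=> [v' z] /andP[_ /eqP /= ->].
  by apply: eq_bigl => z; rewrite !inE !eqxx !andbT.
rewrite big_distrl -sum_nat_const /=; exact: leq_sum.
Qed.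

Section SortedBasis.
Variables (K : fieldExtType rat) (d : nat) (A : central_arrangement K d) (mu : flats A -> nat).
Variable beta : nat.

Definition col_hyps (c : 'I_#|column mu|) : {set hyps A} :=
  [set var_hyp k | k in [pred k | var_col k == c]].

Hypothesis beta_bound : forall J : {set hyps A},
  (\dim (intersection J) <= beta + #|[set c | ~~ (col_hyps c \subset J)]|)%N.

(* B is the greedy basis for the list l sorted by the sizes s.  Every column c with
   col_hyps c inside J pays M c, which absorbs the jumps of the dimension beyond those that
   beta_bound allows (a discrete Abel summation). *)
Lemma sorted_basis (s : hyps A -> nat) (M : 'I_#|column mu| -> nat) (l : seq (hyps A)) :
  (forall H, 0 < s H)%N -> (forall c, 0 < M c)%N ->
  (forall c H, H \in col_hyps c -> (s H <= M c)%N) ->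
  pairwise (fun H H' => (s H <= s H')%N) l ->
  let J := [set H in l] in
  exists B : {set hyps A}, [/\ independent B, intersection B = intersection J &
    forall x, (0 < x)%N -> (forall H, H \in l -> (s H <= x)%N) ->
    (\prod_(H in B) s H <=
      x ^ (beta + #|[set c | ~~ (col_hyps c \subset J)]| - \dim (intersection J)) *
      \prod_(c | col_hyps c \subset J) M c)%N].
Proof.
move=> s0 M0 sM; elim/last_ind: l => [_|l H IH srt] J.
  have -> : J = finset.set0 by apply/finset.setP => H; rewrite !inE.
  exists finset.set0; split => // [|x x0 _].
    by rewrite /independent cards0 /intersection big_set0 dimv_rV.
  by rewrite big_set0 muln_gt0 expn_gt0 x0 /= prodn_gt0.
move: srt; rewrite pairwise_rcons => /andP[/allP lH srtl].
have [B [indB capB Bx]] := IH srtl; set J0 := [set H' in l] in capB Bx.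
have JE : J = H |: J0 by apply/finset.setP => H'; rewrite !inE mem_rcons inE.
have capJ : intersection J = (val H :&: intersection J0)%VS by rewrite JE intersectionU1.
pose new := [pred c | (col_hyps c \subset J) && ~~ (col_hyps c \subset J0)].
have J0J : J0 \subset J by rewrite JE finset.subsetUr.
have countE : #|[set c | ~~ (col_hyps c \subset J0)]| =
    (#|[set c | ~~ (col_hyps c \subset J)]| + #|new|)%N.
  rewrite addnC -(cardsID [set c | col_hyps c \subset J]); congr (_ + _)%N.
    by apply: eq_card => c; rewrite !inE andbC.
  apply: eq_card => c; rewrite !inE andb_idr //; apply: contra => cJ0.
  exact: fintype.subset_trans cJ0 J0J.
have prodE : (\prod_(c | col_hyps c \subset J0) M c * s H ^ #|new| <=
    \prod_(c | col_hyps c \subset J) M c)%N.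
  rewrite [X in (_ <= X)%N](bigID (fun c => col_hyps c \subset J0)) /=; apply: leq_mul.
    apply/eq_leq/eq_bigl => c; rewrite andb_idl // => cJ0.
    exact: fintype.subset_trans cJ0 J0J.
  rewrite -prod_nat_const; apply: leq_prod => c /andP[cJ ncJ0].
  have [H' H'c H'J0] := fintype.subsetPn ncJ0.
  have H'H : H' = H.
    move/fintype.subsetP: cJ => /(_ _ H'c).
    by rewrite JE !inE in H'J0 *; rewrite (negPf H'J0) orbF => /eqP.
  by apply: sM; rewrite -H'H.
set E' := #|[set c | ~~ (col_hyps c \subset J)]| in countE *.
have bJ : (\dim (intersection J) <= beta + E')%N by exact: beta_bound.
have bJ0 : (\dim (intersection J0) <= beta + (E' + #|new|))%N by rewrite -countE; exact: beta_bound.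
(* Since the list is sorted, [s H] bounds the earlier sizes and may be taken for x in the induction
   hypothesis. Each column that becomes contained in J pays one factor [s H]. *)
have BH := Bx (s H) (s0 H) lH; rewrite countE in BH.
have dle : (\dim (intersection J) <= \dim (intersection J0))%N by rewrite dimvS // capJ capvSr.
have dge := dim_cap_hyp (intersection J0) H; rewrite -capJ in dge.
have conclude (x g : nat) : (s H <= x)%N ->
    (g <= s H ^ (beta + (E' + #|new|) - \dim (intersection J)) *
      \prod_(c | col_hyps c \subset J0) M c)%N ->
    (g <= x ^ (beta + E' - \dim (intersection J)) * \prod_(c | col_hyps c \subset J) M c)%N.
  move=> sx g_le; apply: leq_trans g_le _.
  rewrite addnA -addnBAC // expnD -mulnA; apply: leq_mul; first exact: leq_expn2r_weak.
  by rewrite mulnC.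
have [eqd|ltd] : \dim (intersection J) = \dim (intersection J0) \/
    (\dim (intersection J0) = (\dim (intersection J)).+1)%N by lia.
  have capE : intersection J = intersection J0.
    by apply/eqP; rewrite eqEdim capJ capvSr -capJ eqd leqnn.
  exists B; split; rewrite ?capE // => x x0 hx.
  rewrite -{1}capE; apply: conclude; first by apply: hx; rewrite mem_rcons inE eqxx.
  by rewrite eqd.
have HB : H \notin B.
  apply/negP => HB; move: ltd; rewrite capJ -capB (capv_idPr _) ?capB; first by lia.
  by rewrite -capB /intersection (bigD1 H) //= capvSl.
exists (H |: B); split.
- by move: indB; rewrite /independent cardsU1 HB intersectionU1 capB -capJ ltd addnS add1n addSn.
- by rewrite intersectionU1 capB capJ.
move=> x x0 hx; apply: conclude; first by apply: hx; rewrite mem_rcons inE eqxx.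
rewrite big_setU1 //=; apply: leq_trans (leq_mul (leqnn (s H)) BH) _.
rewrite mulnA -expnS ltd -subSn; last by rewrite -ltd.
by rewrite subSS.
Qed.

End SortedBasis.

(** * The upper bound over a finite chain ring *)

Section ChainCount.
Variables (K : fieldExtType rat) (d : nat) (A : central_arrangement K d) (mu : flats A -> nat).
Local Notation O := (ring_of_integers K).
Variables (S : finComPzRingType) (phi : {rmorphism O -> S}).
Local Notation n := #|variable mu|.
Local Notation e := #|column mu|.
Local Notation N := #|S|.

(** Divided by |S|^n, the size of this set is the average kernel size. *)
Definition solutions : {set 'rV[S]_d * 'rV[S]_n} :=
  [set vz | vz.1 *m specialise phi (arr_matrix mu) vz.2 == 0].

Lemma solutionsP (v : 'rV[S]_d) (z : 'rV[S]_n) : reflect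
  (forall c : 'I_e, \sum_(k | var_col k == c) lam phi v (var_hyp k) * z 0 k = 0)
  ((v, z) \in solutions).
Proof.
rewrite inE /=; apply: (iffP eqP) => [vz0 c|vz0].
  by rewrite -mul_specialiseE vz0 mxE.
by apply/rowP => c; rewrite mul_specialiseE vz0 mxE.
Qed.

Lemma col_hypsP (c : 'I_e) H :
  reflect (exists2 k, var_col k = c & H = var_hyp k) (H \in col_hyps c).
Proof.
apply: (iffP imsetP) => [[k]|[k kc ->]]; first by rewrite inE => /eqP; exists k.
by exists k; rewrite ?inE ?kc.
Qed.

(* For fixed v the image of z |-> v * A(z) contains the product of the principal
   ideals generated by one chosen lam v (var_hyp k) in every column. *)
Lemma card_column_solutions (v : 'rV[S]_d) (M : 'I_e -> nat) :
  (forall c, M c = 1%N \/ exists2 k, var_col k = c & M c = msize (lam phi v (var_hyp k))) ->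
  (#|[set z | (v, z) \in solutions]| * \prod_c M c <= N ^ n)%N.
Proof.
move=> MP.
have /choice[kc kcP] : forall c, exists o : option 'I_n,
    if o is Some k then var_col k = c /\ M c = msize (lam phi v (var_hyp k)) else M c = 1%N.
  by move=> c; case: (MP c) => [M1|[k kc Mk]]; [exists None | exists (Some k)].
pose t c := if kc c is Some k then lam phi v (var_hyp k) else 0.
pose W := [set w : {ffun 'I_e -> S} | [forall c, w c \in mults (t c)]].
have cW : #|W| = (\prod_c M c)%N.
  rewrite card_family_prod; apply: eq_bigr => c _; rewrite -/(msize (t c)) /t.
  by have := kcP c; case: (kc c) => [k [_ ->]|->] //; rewrite msize0.
pose F (z : 'rV[S]_n) c := \sum_(k | var_col k == c) lam phi v (var_hyp k) * z 0 k.
have FB z z' c : F (z - z') c = F z c - F z' c.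
  by rewrite /F -sumrB; apply: eq_bigr => k _; rewrite !mxE mulrBr.
(* The preimage z is supported on the chosen variable of each column. *)
have FW w : w \in W -> exists z, forall c, F z c = w c.
  rewrite inE => /forallP wt.
  have /choice[s sP] : forall c, exists s, w c = t c * s.
    by move=> c; apply/multsP; apply: wt.
  exists (\row_k (if kc (var_col k) == Some k then s (var_col k) else 0)) => c.
  rewrite /F; have := kcP c; have := sP c; rewrite /t; case kcc : (kc c) => [k|] wc.
    move=> [kcol _]; rewrite (bigD1 k) /=; last by rewrite kcol.
    rewrite mxE kcol kcc eqxx big1 ?addr0 ?wc // => k' /andP[/eqP k'c k'k].
    rewrite mxE k'c kcc -if_neg (_ : Some k != Some k') ?mulr0 //.
    by apply: contraNneq k'k => -[->].
  move=> _; rewrite wc mul0r big1 // => k /eqP kcol.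
  by rewrite mxE kcol kcc mulr0.
have [pre preP] : exists pre, forall w, w \in W -> forall c, F (pre w) c = w c.
  have /choice[pre preP] : forall w, exists z, w \in W -> forall c, F z c = w c.
    by move=> w; case: (boolP (w \in W)) => [/FW[z]|_]; [exists z | exists 0].
  by exists pre.
rewrite -cW -cardsX -[X in (N ^ X)%N]mul1n -card_mx.
apply: (@leq_card_inj_in _ _ _ (fun zw => zw.1 + pre zw.2)) => -[z w] [z' w'].
rewrite !inE /= => /andP[zZ /forallP wW] /andP[zZ' /forallP wW'] zw.
have FZ y : y \in [set z | (v, z) \in solutions] -> forall c, F y c = 0.
  by rewrite inE => /solutionsP.
have Fz : forall c, F z c = 0 by apply: FZ; rewrite !inE.
have Fz' : forall c, F z' c = 0 by apply: FZ; rewrite !inE.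
have ww' : w = w'.
  apply/ffunP => c; rewrite -preP ?inE; last by apply/forallP.
  rewrite -[RHS]preP ?inE; last by apply/forallP.
  have -> : pre w = z' + pre w' - z by rewrite -zw addrC addKr.
  by rewrite FB Fz subr0 -[X in F (_ + X)]opprK FB Fz' sub0r -[- pre w']sub0r FB
    {1}/F big1 ?sub0r ?opprK // => k _; rewrite mxE mulr0.
by move: zw; rewrite ww' => /addIr ->.
Qed.

Variable beta : nat.
Hypothesis beta_bound : forall J : {set hyps A},
  (\dim (intersection J) <= beta + #|[set c : 'I_e | ~~ (col_hyps c \subset J)]|)%N.

Variable del : O.
Hypothesis delP : forall (T : hyps A -> {set S}) J, independent J ->
  (#|[set v : 'rV[S]_d | [forall H in J, lam phi v H \in T H]]| <=
     #|annih (phi del)| ^ d * ((\prod_(H in J) #|T H|) * #|S| ^ \dim (intersection J)))%N.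

Hypothesis chn : chain_ring S.

(** The product of the M c, by which the column conditions reduce the choices of z, cancels the
    excess in the count of v that [sorted_basis] allows. *)
Lemma chain_class_bound (s : hyps A -> nat) :
  (#|[set vz in solutions | [forall H, msize (lam phi vz.1 H) == s H]]| <=
    #|annih (phi del)| ^ d * N ^ (n + beta))%N.
Proof.
set X := [set vz in _ | _].
have [->|/finset.set0Pn[[v0 z0]]] := eqVneq X finset.set0; first by rewrite cards0.
rewrite inE => /andP[_ /forallP s0].
have s_gt0 H : (0 < s H)%N by rewrite -(eqP (s0 H)) msize_gt0.
have s_le H : (s H <= N)%N by rewrite -(eqP (s0 H)) msize_leq.
(* The 1 is for the columns of the ambient space, which contain no variable. *)
pose M (c : 'I_e) := maxn 1 (\max_(k | var_col k == c) s (var_hyp k))%N.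
have M_gt0 c : (0 < M c)%N by rewrite leq_maxl.
have sM (c : 'I_e) H : H \in col_hyps c -> (s H <= M c)%N.
  move=> /col_hypsP[k kc ->]; rewrite leq_max; apply/orP; right.
  by apply: (@bigop.leq_bigmax_cond _ _ (fun k => s (var_hyp k))); rewrite kc.
pose l := sort (fun H H' => (s H <= s H')%N) (enum {: hyps A}).
have srt : pairwise (fun H H' => (s H <= s H')%N) l.
  rewrite -sorted_pairwise; last by move=> ? ? ?; apply: leq_trans.
  by apply: sort_sorted => H H'; apply: leq_total.
have lT : [set H in l] = finset.setT.
  by apply/finset.setP => H; rewrite !inE mem_sort mem_enum.
have [B [indB capB]] := sorted_basis beta_bound s_gt0 M_gt0 sM srt.
have N_gt0 : (0 < N)%N by apply/card_gt0P; exists 0.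
(* Every size is at most N, and the set of all hyperplanes omits no column: what remains is N to the
   power beta minus the dimension of the common intersection. *)
move=> /(_ N N_gt0 (fun H _ => s_le H)); rewrite -capB lT.
have subT (c : 'I_e) : col_hyps c \subset (finset.setT : {set hyps A}).
  by apply/fintype.subsetP => H _; rewrite inE.
have noc : #|[set c : 'I_e | ~~ (col_hyps c \subset (finset.setT : {set hyps A}))]| = 0%N.
  by apply: eq_card0 => c; apply/negbTE; rewrite finset.in_set negbK; exact: subT.
rewrite noc addn0 [X in (_ <= _ * X)%N](eq_bigl xpredT); last by move=> c; exact: subT.
move=> prodB.
pose P := [set v : 'rV[S]_d | [forall H in B, lam phi v H \in [set u | msize u == s H]]].
have cP : (#|P| <= #|annih (phi del)| ^ d * (\prod_(H in B) s H * N ^ \dim (intersection B)))%N.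
  apply: leq_trans (delP (fun H => [set u | msize u == s H]) indB) _.
  rewrite leq_mul2l; apply/orP; right; rewrite leq_mul2r; apply/orP; right.
  by apply: leq_prod => H _; apply: chain_card_msize.
have XM : (#|X| * \prod_c M c <= #|P| * N ^ n)%N.
  apply: card_pairs_leq => [[v z]|v _].
    rewrite inE => /andP[_ /forallP sv]; rewrite inE; apply/forall_inP => H _.
    by rewrite inE; apply: sv.
  have [/existsP[z vzX]|/existsPn noz] := boolP [exists z, (v, z) \in X]; last first.
    rewrite (_ : [set z | (v, z) \in X] = finset.set0) ?cards0 //.
    by apply/finset.setP => z; rewrite inE (negPf (noz z)) inE.
  have sv H : msize (lam phi v H) = s H.
    by move: vzX; rewrite inE => /andP[_ /forallP /(_ H) /eqP].
  apply: leq_trans (card_column_solutions (v := v) (M := M) _).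
    rewrite leq_mul2r subset_leq_card ?orbT //; apply/fintype.subsetP => z'.
    by rewrite !inE => /andP[].
  move=> c; rewrite /M; have [M1|M1] := leqP (\max_(k | var_col k == c) s (var_hyp k))%N 1.
    by left.
  right; have [k kc Mk] : {k | k \in [pred k | var_col k == c] &
      (\max_(k in [pred k | var_col k == c]) s (var_hyp k))%N = s (var_hyp k)}.
    apply: bigop.eq_bigmax_cond; rewrite lt0n; apply: contraTneq M1 => /card0_eq k0.
    by rewrite big_pred0 // => k; have := k0 k; rewrite inE.
  exists k; first by move: kc; rewrite inE => /eqP.
  by rewrite sv -Mk.
have prodM_gt0 : (0 < \prod_c M c)%N by rewrite prodn_gt0.
rewrite -(leq_pmul2r prodM_gt0); apply: leq_trans XM _.
have bB : (\dim (intersection B) <= beta)%N.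
  by have := beta_bound finset.setT; rewrite capB lT noc addn0.
apply: leq_trans (leq_mul cP (leqnn _)) _.
rewrite -!mulnA leq_mul2l; apply/orP; right.
apply: leq_trans (leq_mul prodB (leqnn _)) _.
rewrite expnD; apply/eq_leq.
rewrite -[in RHS](subnK bB) expnD.
have comm (a b c e : nat) : (a * b * (c * e) = e * (a * c) * b)%N by ring.
exact: comm.
Qed.

(** Under the gap hypothesis a class is determined by logarithms to base Q, so a large Q makes the
    number of classes negligible against N. *)
Lemma chain_sol_bound (Q : nat) : (1 < Q)%N ->
  (forall a b : S, b \in mults a -> a \notin mults b -> (Q * msize b <= msize a)%N) ->
  (#|solutions| <= (trunc_log Q N).+1 ^ #|{: hyps A}| *
     (#|annih (phi del)| ^ d * N ^ (n + beta)))%N.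
Proof.
move=> Q1 hQ; rewrite -[X in (X ^ _)%N]card_ord -card_ffun.
pose lev (u : S) : 'I_(trunc_log Q N).+1 := inord (trunc_log Q (msize u)).
have levK u : lev u = trunc_log Q (msize u) :> nat.
  by rewrite /lev inordK // ltnS leq_trunc_log ?msize_leq.
apply: (@card_classes_leq _ _ (fun vz => [ffun H => lev (lam phi vz.1 H)])) => code.
set X := [set vz in _ | _].
have [->|/finset.set0Pn[[v0 z0]]] := eqVneq X finset.set0; first by rewrite cards0.
rewrite inE => /andP[_ /eqP code0].
apply: leq_trans (chain_class_bound (fun H => msize (lam phi v0 H))).
apply/subset_leq_card/fintype.subsetP => -[v z]; rewrite inE => /andP[vz /eqP codev].
rewrite inE vz /=; apply/forallP => H; apply/eqP.
apply: (chain_trunc_log_inj chn Q1 hQ); rewrite -!levK; congr (nat_of_ord _).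
by move: codev; rewrite -code0 => /ffunP/(_ H); rewrite !ffunE.
Qed.

End ChainCount.

Lemma bin_leq_exp2 (a b : nat) : ('C(a, b) <= 2 ^ a)%N.
Proof.
elim: a b => [|a IH] [|b]; rewrite ?bin0 ?expn_gt0 ?bin0n //.
by rewrite binS expnS mul2n -addnn leq_add.
Qed.

(** (L + 1)^k is at most a falling factorial, that is k! times a binomial coefficient of L + k,
    which is at most 2^(L + k). *)
Lemma poly_leq_exp2 (k : nat) :
  exists B : nat, (0 < B)%N /\ forall L : nat, (L.+1 ^ k <= B * 2 ^ L)%N.
Proof.
exists (k`! * 2 ^ k)%N; split; first by rewrite muln_gt0 fact_gt0 expn_gt0.
move=> L; have ff : (L.+1 ^ k <= (L + k) ^_ k)%N.
  elim: k => [|k IH]; first by rewrite expn0 ffactn0.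
  by rewrite addnS ffactSS expnS leq_mul // ltnS leq_addr.
apply: leq_trans ff _; rewrite -bin_ffact mulnC -mulnA leq_mul2l -expnD addnC.
by rewrite bin_leq_exp2 orbT.
Qed.

(** * Index estimates in finite quotients of rings of integers *)

Section QuotientRings.
Variable K : fieldExtType rat.
Local Notation O := (ring_of_integers K).
Implicit Types (I J : ideal O).

Definition fin_quot_map I (f : fin_quot I) : {rmorphism O -> fin_ring f} :=
  (quotient_map I : {rmorphism O -> quotient_ring I}).

Lemma fin_quot_mapP I (f : fin_quot I) x y :
  fin_quot_map f x = fin_quot_map f y <-> x - y \in ideal_pred I.
Proof. by split => [/quotient_mapP|xy] //; apply/quotient_mapP. Qed.

Lemma fin_quot_map0 I (f : fin_quot I) x : fin_quot_map f x = 0 <-> x \in ideal_pred I.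
Proof. by rewrite -[0](rmorph0 (fin_quot_map f)) fin_quot_mapP subr0. Qed.

Definition fin_quot_repr I (f : fin_quot I) (x : fin_ring f) : O := @quotient_repr _ I x.

Lemma fin_quot_reprK I (f : fin_quot I) : cancel (@fin_quot_repr I f) (fin_quot_map f).
Proof. by move=> x; apply: quotient_reprK. Qed.

Lemma proper_norm_ge2 I : fin_quot I -> 1 \notin ideal_pred I -> (1 < ideal_norm I)%N.
Proof.
move=> f I1; rewrite -[X in (X <= _)%N]card_bool.
apply: (@leq_ideal_norm _ I _ (fun b : bool => b%:R) f) => -[] [] //=; rewrite ?subr0 ?sub0r => xI.
  by rewrite xI in I1.
by move/idealN: xI; rewrite opprK => xI; rewrite xI in I1.
Qed.

(** The r with r * a in bS form a proper ideal J containing I, and O/J embeds in aS/bS through r |->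
    r * a. *)
Lemma msize_gap I (f : fin_quot I) (q : nat) :
  (forall J, {subset ideal_pred I <= ideal_pred J} -> 1 \notin ideal_pred J ->
    (q <= ideal_norm J)%N) ->
  forall a b : fin_ring f, b \in mults a -> a \notin mults b -> (q * msize b <= msize a)%N.
Proof.
move=> hq a b ba ab; set phi := fin_quot_map f.
pose P r := phi r * a \in mults b.
have P0 : P 0 by rewrite /P rmorph0 mul0r; apply/multsP; exists 0; rewrite mulr0.
have PB x y : P x -> P y -> P (x - y).
  rewrite /P => /multsP[s xs] /multsP[t yt]; apply/multsP; exists (s - t).
  by rewrite rmorphB mulrBl xs yt mulrBr.
have PM r x : P x -> P (r * x).
  rewrite /P => /multsP[s xs]; apply/multsP; exists (phi r * s).
  by rewrite rmorphM -mulrA xs mulrCA.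
pose J := mk_ideal P0 PB PM; have JP r : r \in ideal_pred J <-> P r by exact: mem_mk_ideal.
have IJ : {subset ideal_pred I <= ideal_pred J}.
  move=> x /(fin_quot_map0 f) x0; apply/JP; rewrite /P x0 mul0r.
  by apply/multsP; exists 0; rewrite mulr0.
have J1 : 1 \notin ideal_pred J by apply/negP => /JP; rewrite /P rmorph1 mul1r; apply/negP.
have [fJ _] := fin_quotS IJ f.
have [r [r_inj _]] := ideal_norm_reps fJ.
apply: leq_trans (leq_mul (hq J IJ J1) (leqnn _)) _.
rewrite /msize -[X in (X * _ <= _)%N]card_ord -cardsT -cardsX.
pose g (iu : 'I_(ideal_norm J) * fin_ring f) := phi (r iu.1) * a + iu.2.
have g_inj : {in finset.setX finset.setT (mults b) &, injective g}.
  move=> [i u] [j v]; rewrite !finset.in_setX !finset.in_setT /= => /multsP[s us] /multsP[t vt].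
  rewrite /g /= => ijuv.
  have ij : i = j.
    apply: r_inj; apply/JP; apply/multsP; exists (t - s).
    rewrite rmorphB mulrBl mulrBr -us -vt -[phi (r i) * a](addrK u) ijuv.
    by rewrite addrAC [_ + v]addrC addrK.
  by subst j; move/addrI: ijuv => ->.
rewrite -(card_in_imset g_inj); apply/subset_leq_card/fintype.subsetP => _ /imsetP[[i u] iuX ->].
move: iuX; rewrite finset.in_setX /= => /andP[_ /multsP[s ->]].
have /multsP[t ->] := ba; apply/multsP; exists (phi (r i) + t * s).
by rewrite /g /= mulrDr mulrA; congr (_ + _); exact: mulrC.
Qed.

(** With D the image of [del] in S = O/I, the annihilator is no larger than the index of DS in S,
    and S/DS is a quotient of O/(del). The bound is uniform in I. *)
Lemma card_annih_leq I (f : fin_quot I) (del : O) : fin_quot (principal del) ->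
  (#|annih (fin_quot_map f del)| <= ideal_norm (principal del))%N.
Proof.
move=> fd; set phi := fin_quot_map f; set D := phi del.
have AM : (#|annih D| * #|mults D| <= #|{: fin_ring f}|)%N.
  have /choice[pre preP] : forall t, exists s, t \in mults D -> t = D * s.
    by move=> t; case: (boolP (t \in mults D)) => [/multsP[s ts]|_]; [exists s | exists 0].
  rewrite -cardsX; apply: (@leq_card_inj_in _ _ _ (fun ut => ut.1 + pre ut.2)) => -[u t] [v w].
  rewrite !finset.in_setX /= => /andP[/annihP u0 tD] /andP[/annihP v0 wD] uvtw.
  have tw : t = w.
    by rewrite (preP t) // (preP w) // -[LHS]add0r -u0 -mulrDr uvtw mulrDr v0 add0r.
  by move: uvtw; rewrite tw => /addIr ->.
have NM : (#|{: fin_ring f}| <= #|mults D| * ideal_norm (principal del))%N.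
  have [r [r_inj r_surj]] := ideal_norm_reps fd.
  have /choice[c cP] : forall x : fin_ring f, exists i,
    fin_quot_repr x - r i \in ideal_pred (principal del).
    by move=> x; apply: r_surj.
  rewrite -[ideal_norm _]card_ord -[X in (_ <= _ * X)%N]cardsT -[X in (X <= _)%N]cardsT.
  apply: (@card_kernel_leq _ _ _ _ c _ (fun x y => x - y)) => [x _|x y _ _ cxy|x x' y /addIr //].
    exact: finset.in_setT.
  have : fin_quot_repr x - fin_quot_repr y \in ideal_pred (principal del).
    have -> : fin_quot_repr x - fin_quot_repr y =
      (fin_quot_repr x - r (c x)) - (fin_quot_repr y - r (c y)) by rewrite cxy; ring.
    exact: idealB.
  move=> /principalP[s Ds]; apply/multsP; exists (phi s).
  by rewrite -rmorphM mulrC -Ds rmorphB !fin_quot_reprK.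
rewrite -(leq_pmul2r (msize_gt0 D)); apply: leq_trans AM _.
by rewrite [X in (_ <= X)%N]mulnC.
Qed.

End QuotientRings.

Lemma fin_monoid_idempotent (S : finComPzRingType) (a : S) :
  exists n : nat, a ^+ n.+1 * a ^+ n.+1 = a ^+ n.+1.
Proof.
have /injectivePn[i [j ij aij]] : ~~ injectiveb (fun i : 'I_#|S|.+1 => a ^+ i).
  by apply/negP => /injectiveP/leq_card; rewrite card_ord ltnn.
wlog ltij : i j ij aij / (i < j)%N.
  move=> WL; have [lt_ij|le_ji] := ltnP i j; first exact: (WL i j).
  by apply: (WL j i) => //; rewrite ?ltn_neqAle ?le_ji ?andbT eq_sym.
pose p := (j - i)%N; have p0 : (0 < p)%N by rewrite subn_gt0.
have step k : (i <= k)%N -> a ^+ (k + p) = a ^+ k.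
  move=> ik; have -> : (k + p = (k - i) + j)%N by rewrite /p; lia.
  by rewrite exprD -aij -exprD subnK.
have steps t k : (i <= k)%N -> a ^+ (k + t * p) = a ^+ k.
  move=> ik; elim: t => [|t IH]; first by rewrite mul0n addn0.
  by rewrite mulSn [(p + _)%N]addnC addnA step ?IH // (leq_trans ik) ?leq_addr.
(* The exponent i.+1 * p is a positive multiple of the period that lies beyond the preperiod. *)
exists (i.+1 * p).-1; rewrite prednK ?muln_gt0 // -exprD steps //.
by rewrite mulSn (leq_trans (leq_pmulr i p0)) ?leq_addl.
Qed.

(** * Splitting along comaximal ideals *)

Section Splitting.
Variable K : fieldExtType rat.
Local Notation O := (ring_of_integers K).
Implicit Types (I J : ideal O).

Definition colon I (a : O) : ideal O.
Proof.
apply: (@mk_ideal O (fun x => a * x \in ideal_pred I)).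
- by rewrite mulr0 ideal_zero.
- by move=> x y ax ay; rewrite mulrBr idealB.
- by move=> b x ax; rewrite mulrCA idealM.
Defined.

Lemma colonP I a x : (x \in ideal_pred (colon I a)) <-> (a * x \in ideal_pred I).
Proof. exact: mem_mk_ideal. Qed.

Record comaximal_split I I1 I2 : Prop := ComaximalSplit {
  split_subl : {subset ideal_pred I <= ideal_pred I1};
  split_subr : {subset ideal_pred I <= ideal_pred I2};
  split_properl : 1 \notin ideal_pred I1;
  split_properr : 1 \notin ideal_pred I2;
  split_comax : exists e, e \in ideal_pred I1 /\ 1 - e \in ideal_pred I2;
  split_cap : forall x, x \in ideal_pred I1 -> x \in ideal_pred I2 -> x \in ideal_pred I
}.

(* If a and b are incomparable in the quotient, the element e of ring_of_integers_split is
   neither nilpotent nor a unit modulo I; a power of it is a nontrivial idempotent. *)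
Lemma chain_or_split I (f : fin_quot I) :
  chain_ring (fin_ring f) \/ exists I1 I2, comaximal_split I I1 I2.
Proof.
have [chn|nchn] := pselect (chain_ring (fin_ring f)); [by left | right].
have [a [b [nab nba]]] : exists a b : fin_ring f, a \notin mults b /\ b \notin mults a.
  apply: contrapT => nex; apply: nchn => a b.
  have [|nab] := boolP (a \in mults b); first by left.
  have [|nba] := boolP (b \in mults a); first by right.
  case: nex; exists a; exists b; split; [exact: nab | exact: nba].
pose phi := fin_quot_map f.
have [e [u [w [eb ea]]]] := ring_of_integers_split (fin_quot_repr a) (fin_quot_repr b).
have {}eb : phi e * b = phi u * a.
  by have := congr1 phi eb; rewrite !rmorphM !fin_quot_reprK.
have {}ea : (1 - phi e) * a = phi w * b.
  by have := congr1 phi ea; rewrite !rmorphM !fin_quot_reprK rmorphB rmorph1.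
have [k ek] := fin_monoid_idempotent (phi e).
pose g := e ^+ k.+1; have gg : (1 - g) * g \in ideal_pred I.
  by apply/(fin_quot_map0 f); rewrite mulrBl mul1r rmorphB rmorphM rmorphXn ek subrr.
exists (colon I (1 - g)), (colon I g); split.
- by move=> x xI; apply/colonP; exact: idealM.
- by move=> x xI; apply/colonP; exact: idealM.
- apply/negP => /colonP; rewrite mulr1 => /(fin_quot_map0 f).
  rewrite rmorphB rmorph1 rmorphXn => /eqP; rewrite subr_eq0 => /eqP e1.
  case/negP: nba; apply/multsP; exists (phi e ^+ k * phi u).
  by rewrite mulrC -mulrA -eb mulrA -exprSr -e1 mul1r.
- apply/negP => /colonP; rewrite mulr1 => /(fin_quot_map0 f); rewrite rmorphXn => e0.
  case/negP: nab; apply/multsP.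
  (* The geometric sum inverts 1 - e when e is nilpotent. *)
  exists (phi w * \sum_(i < k.+1) phi e ^+ i).
  rewrite mulrA [b * _]mulrC -ea mulrAC -[LHS]mul1r; congr (_ * _).
  by rewrite -opprB mulNr -subrX1 e0 sub0r opprK.
- exists g; split; first exact/colonP.
  by apply/colonP; rewrite mulrC.
- move=> x /colonP x1 /colonP x2.
  by rewrite -[x]mul1r -(subrK g 1) mulrDl idealD.
Qed.

(** Chinese remainders: (1 - e) * r i + e * s j is congruent to r i modulo I1 and to s j modulo
    I2. *)
Lemma split_norm I I1 I2 : comaximal_split I I1 I2 -> fin_quot I ->
  (ideal_norm I1 * ideal_norm I2 <= ideal_norm I)%N.
Proof.
move=> [s1 s2 _ _ [e [e1 e2]] cap] f.
have [f1 _] := fin_quotS s1 f; have [f2 _] := fin_quotS s2 f.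
have [r [r_inj _]] := ideal_norm_reps f1; have [s [s_inj _]] := ideal_norm_reps f2.
rewrite -[X in (X * _ <= _)%N]card_ord -[X in (_ * X <= _)%N]card_ord -card_prod.
apply: (@leq_ideal_norm _ I _ (fun ij => (1 - e) * r ij.1 + e * s ij.2) f).
move=> [i j] [i' j'] /= dI.
have -> : i = i'.
  apply: r_inj; have := s1 _ dI.
  have -> : r i - r i' = ((1 - e) * r i + e * s j - ((1 - e) * r i' + e * s j'))
     + (r i - r i' - (s j - s j')) * e by ring.
  by move=> h; apply: idealD => //; apply: idealM.
suff -> : j = j' by [].
apply: s_inj; have := s2 _ dI.
have -> : s j - s j' = ((1 - e) * r i + e * s j - ((1 - e) * r i' + e * s j'))
   + (s j - s j' - (r i - r i')) * (1 - e) by ring.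
by move=> h; apply: idealD => //; apply: idealM.
Qed.

Variables (d : nat) (A : central_arrangement K d) (mu : flats A -> nat).

Definition int_solution_entry (v : 'rV[O]_d) (z : 'rV[O]_#|variable mu|)
    (c : 'I_#|column mu|) : O :=
  \sum_(k | var_col k == c) (\sum_j form_at_basis (var_hyp k) j * v 0 j) * z 0 k.

(** Testing solutions on lifts to O allows comparing different quotients without maps between
    them. *)
Lemma solutions_lift I (f : fin_quot I) v z :
  (map_mx (fin_quot_map f) v, map_mx (fin_quot_map f) z) \in solutions mu (fin_quot_map f) <->
  forall c, int_solution_entry v z c \in ideal_pred I.
Proof.
have E c : \sum_(k | var_col k == c) lam (fin_quot_map f) (map_mx (fin_quot_map f) v) (var_hyp k) *
    map_mx (fin_quot_map f) z 0 k = fin_quot_map f (int_solution_entry v z c).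
  rewrite /int_solution_entry rmorph_sum; apply: eq_bigr => k _; rewrite rmorphM mxE.
  congr (_ * _); rewrite /lam rmorph_sum; apply: eq_bigr => j _.
  by rewrite mxE rmorphM.
split=> [/solutionsP vz c|vz]; first by apply/(fin_quot_map0 f); rewrite -E.
by apply/solutionsP => c; rewrite E; apply/fin_quot_map0.
Qed.

(** Reducing a lift modulo I1 and I2 sends solutions to pairs of solutions, injectively because I
    contains the intersection of I1 and I2. *)
Lemma split_solutions I I1 I2 (f : fin_quot I) (f1 : fin_quot I1) (f2 : fin_quot I2) :
  comaximal_split I I1 I2 ->
  (#|solutions mu (fin_quot_map f)| <=
    #|solutions mu (fin_quot_map f1)| * #|solutions mu (fin_quot_map f2)|)%N.
Proof.
move=> [s1 s2 _ _ _ cap].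
pose lift k (v : 'rV[fin_ring f]_k) : 'rV[O]_k := map_mx (@fin_quot_repr _ I f) v.
have liftK k (v : 'rV[fin_ring f]_k) : map_mx (fin_quot_map f) (lift k v) = v.
  by apply/rowP => i; rewrite !mxE fin_quot_reprK.
pose red J (g : fin_quot J) k (v : 'rV[fin_ring f]_k) := map_mx (fin_quot_map g) (lift k v).
pose F (vz : 'rV[fin_ring f]_d * 'rV[fin_ring f]_#|variable mu|) :=
  ((red _ f1 _ vz.1, red _ f1 _ vz.2), (red _ f2 _ vz.1, red _ f2 _ vz.2)).
have red_inj k (v w : 'rV[fin_ring f]_k) :
    red _ f1 _ v = red _ f1 _ w -> red _ f2 _ v = red _ f2 _ w -> v = w.
  move=> /rowP vw1 /rowP vw2; apply/rowP => i.
  have := vw1 i; have := vw2 i; rewrite !mxE => /fin_quot_mapP v2 /fin_quot_mapP v1.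
  by rewrite -[v 0 i]fin_quot_reprK -[w 0 i]fin_quot_reprK; apply/fin_quot_mapP/cap.
have F_inj : injective F.
  by move=> [v z] [v' z'] [v1 z1 v2 z2]; rewrite (red_inj _ _ _ v1 v2) (red_inj _ _ _ z1 z2).
rewrite -cardsX -(card_imset _ F_inj); apply/subset_leq_card/fintype.subsetP.
move=> _ /imsetP[[v z] vz ->].
rewrite finset.in_setX /F /=; apply/andP.
have {}vz : forall c, int_solution_entry (lift _ v) (lift _ z) c \in ideal_pred I.
  by apply/(solutions_lift f); rewrite !liftK.
by split; apply/solutions_lift => c; [apply: s1 | apply: s2].
Qed.

End Splitting.

Section NumberFieldIdeals.
Variable K : fieldExtType rat.
Local Notation O := (ring_of_integers K).
Implicit Types (I J : ideal O).

Lemma ring_of_integers_char0 (n : nat) : n.+1%:R != 0 :> O.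
Proof.
apply/eqP => /(congr1 (@ring_of_integers_val K)) /eqP; rewrite rmorph_nat rmorph0.
by rewrite -[_%:R]/(n.+1%:Z%:~R) intr_number_field_eq0.
Qed.

Lemma nonzero_fin_quot I : nonzero_ideal I -> fin_quot I.
Proof.
have [m [h H]] := ring_of_integers_heights K.
exact: (fin_quot_nonzero H (@ring_of_integers_mulf_eq0 K)).
Qed.

Lemma number_field_ideal_count_upper : exists C : nat, forall (X : nat) (s : seq (ideal O)),
  uniq s -> (forall I, I \in s -> nonzero_ideal I /\ (ideal_norm I <= X)%N) ->
  (size s <= C * X)%N.
Proof.
have [m [h H]] := ring_of_integers_heights K.
exact: (ideal_count_upper H (@ring_of_integers_mulf_eq0 K) ring_of_integers_char0).
Qed.

Lemma finite_ideals_leq (X : nat) :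
  finite_set [set I : ideal O | nonzero_ideal I /\ (ideal_norm I <= X)%N].
Proof.
have [C HC] := number_field_ideal_count_upper.
by apply: (@bounded_uniq_finite _ _ (C * X)) => s us sX; exact: HC.
Qed.

Definition ideals_leq X : {fset ideal O} :=
  fset_set [set I : ideal O | nonzero_ideal I /\ (ideal_norm I <= X)%N].

Lemma ideals_leqP X I : (I \in ideals_leq X) <-> (nonzero_ideal I /\ (ideal_norm I <= X)%N).
Proof.
rewrite /ideals_leq in_fset_set; last exact: finite_ideals_leq.
by rewrite inE; split => [/asboolP|IX] //; apply/asboolP.
Qed.

Lemma nonzero_idealS I J :
  {subset ideal_pred I <= ideal_pred J} -> nonzero_ideal I -> nonzero_ideal J.
Proof. by move=> IJ [x xI x0]; exists x => //; apply: IJ. Qed.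

(* Superadditive along comaximal splittings, hence an exponent that can pay for the constant
   lost on every chain factor above an ideal of small norm. *)
Definition small_over (Q : nat) I : nat :=
  count (fun J => `[< {subset ideal_pred I <= ideal_pred J} /\ 1 \notin ideal_pred J >])
    (ideals_leq Q).

(** No proper ideal contains both I1 and I2, as they are comaximal; so no ideal is counted twice. *)
Lemma small_over_split Q I I1 I2 : comaximal_split I I1 I2 ->
  (small_over Q I1 + small_over Q I2 <= small_over Q I)%N.
Proof.
move=> [s1 s2 _ _ [e [e1 e2]] _]; rewrite /small_over -count_predUI.
rewrite [X in (_ + X)%N](_ : _ = 0%N).
  rewrite addn0; apply: sub_count => J /= /orP[] /asboolP[sub J1]; apply/asboolP; split=> //.
    by move=> x /s1/sub.
  by move=> x /s2/sub.
apply/eqP; rewrite eqn0Ngt -has_count; apply/hasP => -[J _ /=].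
move=> /andP[/asboolP[sub1 J1] /asboolP[sub2 _]]; case/negP: J1.
by rewrite -[1](subrK e); apply: idealD; [exact: sub2 | exact: sub1].
Qed.

Lemma small_over_gt0 Q I J : nonzero_ideal I -> {subset ideal_pred I <= ideal_pred J} ->
  1 \notin ideal_pred J -> (ideal_norm J <= Q)%N -> (0 < small_over Q I)%N.
Proof.
move=> nI IJ J1 JQ; rewrite -has_count; apply/hasP; exists J; last exact/asboolP.
by apply/ideals_leqP; split => //; apply: nonzero_idealS nI.
Qed.

Lemma small_over_size Q I : (small_over Q I <= size (ideals_leq Q))%N.
Proof. exact: count_size. Qed.

End NumberFieldIdeals.

(** * The upper bound for arbitrary nonzero ideals *)

Section SolutionsUpper.
Variables (K : fieldExtType rat) (d : nat) (A : central_arrangement K d) (mu : flats A -> nat).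
Variable beta : nat.
Local Notation O := (ring_of_integers K).
Local Notation n := #|variable mu|.
Hypothesis beta_bound : forall J : {set hyps A},
  (\dim (intersection J) <= beta + #|[set c : 'I_#|column mu| | ~~ (col_hyps c \subset J)]|)%N.

Lemma annih_unit (I : ideal O) (f : fin_quot I) (del : O) (y : O) :
  1 - y * del \in ideal_pred I -> #|annih (fin_quot_map f del)| = 1%N.
Proof.
move=> /(fin_quot_map0 f); rewrite rmorphB rmorph1 rmorphM => /eqP.
rewrite subr_eq0 => /eqP yd; apply/eqP/cards1P; exists 0; apply/finset.setP => u.
rewrite [RHS]inE; apply/annihP/eqP => [u0|->]; last by rewrite mulr0.
by rewrite -[u]mul1r yd -mulrA u0 mulr0.
Qed.

(** The successor in the exponent is the spare factor N(I) that absorbs logarithms; after a p-th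
    root it costs only N(I)^(1/p). The induction on a bound for N(I) splits until the quotient is a
    chain ring. *)
Lemma solutions_upper (p : nat) : (0 < p)%N -> exists C : nat,
  forall (I : ideal O) (f : fin_quot I), nonzero_ideal I ->
  (#|solutions mu (fin_quot_map f)| ^ p <= C * ideal_norm I ^ (p * (n + beta)).+1)%N.
Proof.
move=> p0; have [del del0 delP] := card_lam_independent A.
have fdel : fin_quot (principal del) by apply/nonzero_fin_quot/nonzero_principal.
pose k := (#|{: hyps A}| * p)%N.
pose Delta := ideal_norm (principal del).
have Delta_gt0 : (0 < Delta)%N by apply: ideal_norm_gt0.
(* The summand 2^k yields (log_Q N + 1)^k <= (2^k)^(log_Q N) <= N; the summand Delta + 1 makes [del]
   invertible modulo I if all proper ideals above I have norm at least Q. *)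
pose Q := (2 ^ k + Delta + 1)%N.
have Q2 : (1 < Q)%N by rewrite /Q addn1 ltnS addn_gt0 expn_gt0.
have [B' [B'0 B'P]] := poly_leq_exp2 k.
(* B pays for the classes with logarithms to base 2 and for the annihilator of [del], in a chain
   quotient below an ideal of norm at most Q. *)
pose B := (B' * Delta ^ (d * p))%N.
have B_gt0 : (0 < B)%N by rewrite muln_gt0 B'0 expn_gt0 Delta_gt0.
suff main : forall (N : nat) (I : ideal O) (f : fin_quot I),
    (ideal_norm I <= N)%N -> nonzero_ideal I ->
    (#|solutions mu (fin_quot_map f)| ^ p <=
      B ^ small_over Q I * ideal_norm I ^ (p * (n + beta)).+1)%N.
  exists (B ^ size (ideals_leq K Q))%N => I f nI; apply: leq_trans (main _ I f (leqnn _) nI) _.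
  by rewrite leq_mul2r leq_pexp2l ?small_over_size ?orbT.
elim=> [I f|N IH I f IN nI].
  by rewrite leqn0 => /eqP I0; have := ideal_norm_gt0 f; rewrite I0.
have [chn|[I1 [I2 spl]]] := chain_or_split f; last first.
  have [s1 s2 p1 p2 _ _] := spl.
  have [f1 _] := fin_quotS s1 f; have [f2 _] := fin_quotS s2 f.
  have g1 := proper_norm_ge2 f1 p1; have g2 := proper_norm_ge2 f2 p2.
  have n12 := split_norm spl f.
  have l1 : (ideal_norm I1 <= N)%N.
    by rewrite -ltnS; apply: leq_trans IN; apply: leq_trans n12; rewrite ltn_Pmulr // ltnW.
  have l2 : (ideal_norm I2 <= N)%N.
    by rewrite -ltnS; apply: leq_trans IN; apply: leq_trans n12; rewrite ltn_Pmull // ltnW.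
  have b1 := IH I1 f1 l1 (nonzero_idealS s1 nI).
  have b2 := IH I2 f2 l2 (nonzero_idealS s2 nI).
  apply: leq_trans (leq_expn2r_weak p (split_solutions mu f f1 f2 spl)) _.
  rewrite expnMn; apply: leq_trans (leq_mul b1 b2) _.
  rewrite mulnACA -expnD -expnMn; apply: leq_mul; last exact: leq_expn2r_weak.
  by rewrite leq_pexp2l // small_over_split.
have NE : #|{: fin_ring f}| = ideal_norm I by rewrite -fin_quot_ncard.
have indI := fun T J => delP (fin_ring f : finComPzRingType) (fin_quot_map f) T J.
have N0 : (0 < ideal_norm I)%N by apply: ideal_norm_gt0.
have bound q : (1 < q)%N ->
    (forall J, {subset ideal_pred I <= ideal_pred J} -> 1 \notin ideal_pred J ->
    (q <= ideal_norm J)%N) ->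
    (#|solutions mu (fin_quot_map f)| ^ p <= (trunc_log q (ideal_norm I)).+1 ^ k *
       #|annih (fin_quot_map f del)| ^ (d * p) * ideal_norm I ^ (p * (n + beta)))%N.
  move=> q1 hq.
  have := chain_sol_bound beta_bound indI chn q1 (msize_gap hq); rewrite NE.
  move=> /(leq_expn2r_weak p) le; apply: leq_trans le _.
  by rewrite !expnMn -!expnM [((n + beta) * p)%N]mulnC mulnA.
case: (posnP (small_over Q I)) => [w0|w0].
  have hq J : {subset ideal_pred I <= ideal_pred J} -> 1 \notin ideal_pred J ->
      (Q <= ideal_norm J)%N.
    move=> IJ J1; apply: ltnW; rewrite ltnNge; apply/negP => JQ.
    by have := small_over_gt0 nI IJ J1 JQ; rewrite w0.
  (* Otherwise I + (del) is proper and contains I, while its norm is at most Delta < Q. *)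
  have ann1 : #|annih (fin_quot_map f del)| = 1%N.
    pose P x := exists y, x - y * del \in ideal_pred I.
    have P0 : P 0 by exists 0; rewrite mul0r subr0 ideal_zero.
    have PB x y : P x -> P y -> P (x - y).
      move=> [s xs] [t yt]; exists (s - t).
      have -> : x - y - (s - t) * del = (x - s * del) - (y - t * del) by ring.
      exact: idealB.
    have PM r x : P x -> P (r * x).
      by move=> [s xs]; exists (r * s); rewrite -mulrA -mulrBr idealM.
    pose J := mk_ideal P0 PB PM; have JP x : x \in ideal_pred J <-> P x by exact: mem_mk_ideal.
    have [/JP[y] |J1] := boolP (1 \in ideal_pred J); first exact: annih_unit.
    have IJ : {subset ideal_pred I <= ideal_pred J}.
      by move=> x xI; apply/JP; exists 0; rewrite mul0r subr0.
    have dJ : {subset ideal_pred (principal del) <= ideal_pred J}.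
      by apply: principal_sub; apply/JP; exists 1; rewrite mul1r subrr ideal_zero.
    have [_ JD] := fin_quotS dJ fdel.
    have := leq_trans (hq J IJ J1) JD; rewrite /Q -/Delta => QD.
    by move: QD; rewrite addn1 ltnNge leq_addl.
  apply: leq_trans (bound Q Q2 hq) _; rewrite w0 expn0 mul1n ann1 exp1n muln1 expnS.
  rewrite leq_mul2r; apply/orP; right.
  apply: (@leq_trans ((2 ^ k) ^ trunc_log Q (ideal_norm I))).
    rewrite -expnM mulnC expnM; apply: leq_expn2r_weak; exact: ltn_expl.
  apply: leq_trans (trunc_logP Q2 N0); apply: leq_expn2r_weak.
  by rewrite /Q -addnA leq_addr.
(* Gaps of index 2 always exist; the constant B is covered because [small_over Q I] is positive. *)
apply: leq_trans (bound 2%N isT _) _ => [J IJ J1|].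
  by apply: proper_norm_ge2 => //; exact: (fin_quotS IJ f).1.
rewrite expnS mulnA leq_mul2r; apply/orP; right.
apply: (@leq_trans (B * ideal_norm I)%N); last first.
  by rewrite leq_mul2r -{1}(expn1 B) leq_pexp2l ?orbT.
rewrite /B mulnAC; apply: leq_mul.
  apply: leq_trans (B'P _) _; rewrite leq_mul2l; apply/orP; right; exact: trunc_logP.
by apply: leq_expn2r_weak; exact: card_annih_leq.
Qed.

End SolutionsUpper.

(** * The lower bound *)

Section SolutionsLower.
Variables (K : fieldExtType rat) (d : nat) (A : central_arrangement K d) (mu : flats A -> nat).
Local Notation O := (ring_of_integers K).
Local Notation n := #|variable mu|.
Local Notation e := #|column mu|.
Local Notation iota := (@ring_of_integers_val K).

Definition unfit (U : {vspace 'rV[K]_d}) : {set 'I_e} :=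
  [set c | ~~ (col_hyps c \subset [set H | (U <= val H)%VS])].

(** D is a right inverse of C up to [del], so over any S the map u |-> u * C parametrises reductions
    of U with a kernel killed by [del]. *)
Lemma subspace_integral_basis (U : {vspace 'rV[K]_d}) :
  exists (C : 'M[O]_(\dim U, d)) (D : 'M[O]_(d, \dim U)) (del : O),
  [/\ del != 0, C *m D = del%:M & forall i, row i (map_mx iota C) \in U].
Proof.
pose B : 'M[K]_(\dim U, d) := \matrix_i (vbasis U)`_i.
have BU i : row i B \in U by rewrite rowK vbasis_mem // mem_nth // size_tuple.
have rfB : row_free B.
  rewrite -kermx_eq0; apply/eqP/row_matrixP => k; rewrite row0.
  set u := row k _; have uB : u *m B = 0 by apply/eqP; rewrite -sub_kermx row_sub.
  apply/rowP => i; rewrite [RHS]mxE.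
  have /freeP fr := basis_free (vbasisP U); apply: (fr (fun i => u 0 i)).
  rewrite -[RHS]uB mulmx_sum_row; apply: eq_bigr => j _; by rewrite rowK.
have [e1 e10 [C DC]] := clear_denominators B.
have [e2 e20 [D DD]] := clear_denominators (pinvmx B).
exists C, D, (e1 * e2); split.
- by apply/eqP => /ring_of_integers_mulf_eq0[] /eqP; apply/negP.
- have map_iota_inj m1 m2 (X Y : 'M[O]_(m1, m2)) : map_mx iota X = map_mx iota Y -> X = Y.
    by move=> /matrixP XY; apply/matrixP => i j; apply: val_inj; have := XY i j; rewrite !mxE.
  apply: map_iota_inj; rewrite map_mxM DC DD -scalemxAl -scalemxAr mulmxVp //.
  by rewrite map_scalar_mx /= scalerA scalemx1.
- by move=> i; rewrite DC linearZ /= memvZ // BU.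
Qed.

Section RingChange.
Variables (S : comPzRingType) (phi : {rmorphism O -> S}).

Lemma scale_kernel r k (C : 'M[O]_(r, k)) (D : 'M[O]_(k, r)) (del : O) (u w : 'rV[S]_r) :
  C *m D = del%:M -> u *m map_mx phi C = w *m map_mx phi C -> phi del *: (u - w) = 0.
Proof.
move=> CD uw; have {}uw : (u - w) *m map_mx phi C = 0 by rewrite mulmxBl uw subrr.
have : (u - w) *m map_mx phi C *m map_mx phi D = 0 by rewrite uw mul0mx.
by rewrite -mulmxA -map_mxM CD map_scalar_mx mul_mx_scalar.
Qed.

Lemma lam_subspace r (C : 'M[O]_(r, d)) (u : 'rV[S]_r) (H : hyps A) :
  (forall i, row i (map_mx iota C) \in val H) -> lam phi (u *m map_mx phi C) H = 0.
Proof.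
move=> CU; have CH : C *m (\col_j form_at_basis H j) = 0.
  apply/colP => i; rewrite mxE [RHS]mxE; apply: val_inj.
  have := CU i; rewrite mem_hyp => /eqP sum0.
  transitivity (\sum_j iota (C i j) * iota (form_at_basis H j)).
    by rewrite /= rmorph_sum /=; apply: eq_bigr => j _; rewrite mxE.
  apply: etrans sum0; apply: eq_bigr => j _; by rewrite !mxE mulrC.
have -> : lam phi (u *m map_mx phi C) H =
    (u *m map_mx phi C *m map_mx phi (\col_j form_at_basis H j)) 0 0.
  by rewrite [RHS]mxE; apply: eq_bigr => j _; rewrite mulrC; congr (_ * _); rewrite !mxE.
by rewrite -mulmxA -map_mxM CH map_mx0 mulmx0 mxE.
Qed.

End RingChange.

Lemma fin_solutions_lower (S : finComPzRingType) (phi : {rmorphism O -> S}) (U : {vspace 'rV[K]_d})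
    (C : 'M[O]_(\dim U, d)) (D : 'M[O]_(d, \dim U)) (del : O) :
  C *m D = del%:M -> (forall i, row i (map_mx iota C) \in U) ->
  (#|S| ^ (\dim U + n) <=
    #|annih (phi del)| ^ \dim U * (#|solutions mu phi| * #|S| ^ #|unfit U|))%N.
Proof.
move=> CD CU; set sol := solutions _ _.
pose im := [set u *m map_mx phi C | u : 'rV[S]_(\dim U)].
have imP : (#|S| ^ \dim U <= #|annih (phi del)| ^ \dim U * #|im|)%N.
  rewrite -card_annih_rV -[X in (_ ^ X)%N]mul1n -card_mx -cardsT.
  apply: (@card_kernel_leq _ _ _ _ (fun u => u *m map_mx phi C) _ (fun u w => u - w)).
  - by move=> u _; apply: imset_f.
  - move=> u w _ _ uw; rewrite finset.in_set; apply/eqP; exact: scale_kernel CD uw.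
  - by move=> u u' w /addIr.
have lam0 v (H : hyps A) : v \in im -> (U <= val H)%VS -> lam phi v H = 0.
  by move=> /imsetP[u _ ->] UH; apply: lam_subspace => i; apply: (subvP UH).
have kerP v : v \in im -> (#|S| ^ n <= #|[set z | (v, z) \in sol]| * #|S| ^ #|unfit U|)%N.
  move=> vim.
  pose F (z : 'rV[S]_n) : {ffun 'I_e -> S} :=
    [ffun c => \sum_(k | var_col k == c) lam phi v (var_hyp k) * z 0 k].
  pose E c : {set S} := if c \in unfit U then finset.setT else [set 0].
  have cE : #|[set t : {ffun 'I_e -> S} | [forall c, t c \in E c]]| = (#|S| ^ #|unfit U|)%N.
    rewrite card_family_prod (bigID (fun c => c \in unfit U)) /=.
    rewrite [X in (_ * X)%N]big1 => [|c /negPf cU]; last by rewrite /E cU cards1.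
    rewrite muln1 -prod_nat_const; apply: eq_bigr => c cU.
    by rewrite /E cU cardsT.
  have cn : (#|S| ^ n = #|[set: 'rV[S]_n]|)%N by rewrite cardsT card_mx mul1n.
  rewrite -cE [X in (X <= _)%N]cn.
  apply: (@card_kernel_leq _ _ _ _ F _ (fun z w => z - w)).
  - move=> z _; rewrite finset.in_set; apply/forallP => c; rewrite /E.
    case: ifPn => [_|]; first exact: finset.in_setT.
    rewrite finset.in_set negbK => /fintype.subsetP cU.
    rewrite finset.in_set1 ffunE big1 // => k /eqP kc; rewrite lam0 ?mul0r //.
    have : var_hyp k \in col_hyps c by apply/col_hypsP; exists k.
    by move/cU; rewrite finset.in_set.
  - move=> z w _ _ /ffunP zw; rewrite finset.in_set; apply/solutionsP => c.
    have := zw c; rewrite !ffunE => /eqP; rewrite -subr_eq0 -sumrB => /eqP zw0.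
    apply: etrans zw0; apply: eq_bigr => k _; by rewrite !mxE mulrBr.
  - by move=> u u' w /addIr.
rewrite expnD; apply: leq_trans (leq_mul imP (leqnn _)) _.
rewrite -mulnA leq_mul2l; apply/orP; right.
have sumP : (\sum_(v in im) #|[set z | (v, z) \in sol]| <= #|sol|)%N.
  rewrite -[X in (_ <= X)%N]sum1_card (partition_big fst xpredT) //=.
  rewrite [X in (_ <= X)%N](bigID (mem im)) /=; apply: leq_trans (leq_addr _ _).
  apply/eq_leq/eq_bigr => v vP; rewrite -sum1_card.
  rewrite (reindex_onto (fun z => (v, z)) snd) /=; last first.
    by move=> [v' z] /andP[_ /eqP /= ->].
  by apply: eq_bigl => z; rewrite finset.in_set !eqxx !andbT.
apply: (@leq_trans (\sum_(v in im) #|[set z | (v, z) \in sol]| * #|S| ^ #|unfit U|)%N).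
  by rewrite -sum_nat_const; apply: leq_sum => v; exact: kerP.
by rewrite -big_distrl /= leq_mul2r sumP orbT.
Qed.

Lemma solutions_lower (U : {vspace 'rV[K]_d}) : exists C : nat, (0 < C)%N /\
  forall (I : ideal O) (f : fin_quot I),
  (ideal_norm I ^ (\dim U + n) <=
    C * (#|solutions mu (fin_quot_map f)| * ideal_norm I ^ #|unfit U|))%N.
Proof.
have [C [D [del [del0 CD CU]]]] := subspace_integral_basis U.
have fdel : fin_quot (principal del) by apply/nonzero_fin_quot/nonzero_principal.
exists (ideal_norm (principal del) ^ \dim U)%N; split.
  by rewrite expn_gt0 ideal_norm_gt0.
move=> I f; rewrite (fin_quot_ncard f).
apply: leq_trans (fin_solutions_lower (fin_quot_map f) CD CU) _.
by rewrite leq_mul2r leq_expn2r_weak ?orbT //; exact: card_annih_leq.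
Qed.

End SolutionsLower.

(** * Values of flats and base change *)

Section FlatValues.
Variables (K : fieldExtType rat) (d : nat) (A : central_arrangement K d) (mu : flats A -> nat).

Lemma flatP (x : flats A) : exists J : {set hyps A}, val x = intersection J.
Proof. by case: x => x /= /imfsetP[J _ ->]; exists J. Qed.

Lemma flat_hyps (x : flats A) : val x = intersection [set H : hyps A | (val x <= val H)%VS].
Proof.
have [J xJ] := flatP x; apply/eqP; rewrite eqEsubv; apply/andP; split.
  by apply/subv_bigcapP => H; rewrite inE.
rewrite {2}xJ; apply/subv_bigcapP => H HJ; rewrite /intersection (bigD1 H) ?capvSl //.
by rewrite inE xJ /intersection (bigD1 H) //= capvSl.
Qed.

Lemma intersection_flat (J : {set hyps A}) : intersection J \in flats A.
Proof. by apply/imfsetP; exists J. Qed.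

Definition flat_of (J : {set hyps A}) : flats A := [` intersection_flat J]%fset.

Lemma col_hypsE (c : 'I_#|column mu|) :
  col_hyps c = [set H : hyps A | (val (tag (enum_val c)) <= val H)%VS].
Proof.
apply/finset.setP => H; rewrite [RHS]inE; apply/col_hypsP/idP => [[k <- ->]|cH].
  by rewrite /var_col enum_rankK /var_hyp; exact: (valP (enum_val k)).
pose p : variable mu := exist _ (H, enum_val c) cH.
exists (enum_rank p); first by rewrite /var_col enum_rankK /= enum_valK.
by rewrite /var_hyp enum_rankK.
Qed.

(** A flat is the intersection of the hyperplanes containing it, so containing every hyperplane
    condition of y amounts to lying inside y. *)
Lemma mem_unfit (x : flats A) c :
  (c \in unfit mu (val x)) = ~~ flat_le (tag (enum_val c)) x.
Proof.
rewrite inE; congr (~~ _); rewrite col_hypsE /flat_le; apply/fintype.subsetP/idP => [cx|xc H].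
  rewrite [X in (_ <= X)%VS]flat_hyps; apply/subv_bigcapP => H Hc.
  by have := cx H Hc; rewrite inE.
by rewrite !inE; apply: subv_trans.
Qed.

Lemma card_unfit (x : flats A) : #|unfit mu (val x)| = (\sum_(y : flats A | ~~ flat_le y x) mu y)%N.
Proof.
pose P := [pred p : column mu | ~~ flat_le (tag p) x].
have -> : #|unfit mu (val x)| = #|P|.
  rewrite -(fintype.card_image (@enum_val_inj (column mu) predT)).
  apply: eq_card => p; apply/fintype.imageP/idP => [[c]|px].
    by rewrite mem_unfit => cx ->.
  by exists (enum_rank p); rewrite ?mem_unfit enum_rankK.
rewrite -sum1_card (eq_bigl (fun p : column mu => ~~ flat_le (tag p) x && true)); last first.
  by move=> p; rewrite andbT.
rewrite -(sig_big_dep (fun y => ~~ flat_le y x) (fun y i => true) (fun _ _ => 1%N)) /=.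
by apply: eq_bigr => y _; rewrite sum1_card card_ord.
Qed.

Lemma flat_valueE (x : flats A) :
  flat_value mu x = (\dim (val x)).+1%:Z - #|unfit mu (val x)|%:Z.
Proof.
have dx : (\dim (val x) <= d)%N by rewrite -[X in (_ <= X)%N](dimv_rV K) dimvS ?subvf.
rewrite /flat_value card_unfit /flat_rk /codim -subzn //.
by set a := \dim _; set b := (\sum_(_ | _) _)%N; lia.
Qed.

Lemma max_flat_value_ge (x : flats A) : flat_value mu x <= max_flat_value mu.
Proof. by rewrite /max_flat_value; exact: le_bigmax. Qed.

Lemma max_flat_value_attained : exists x : flats A, max_flat_value mu = flat_value mu x.
Proof.
rewrite /max_flat_value; apply: (big_ind (fun v => exists x, v = flat_value mu x)).
- by exists (ambient A).
- by move=> v w [x ->] [y ->]; rewrite /Order.max; case: ifP => _; [exists y | exists x].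
- by move=> x _; exists x.
Qed.

(** The common intersection lies in every hyperplane and so annihilates all columns. This gives the
    lower end of the interval, and positivity. *)
Lemma top_flat_value : flat_value mu (flat_of finset.setT) =
  (\dim (intersection (finset.setT : {set hyps A}))).+1%:Z.
Proof.
rewrite flat_valueE /= (_ : #|unfit _ _| = 0%N) ?subr0 //.
apply: eq_card0 => c; rewrite inE; apply/negbTE; rewrite negbK.
apply/fintype.subsetP => H _; rewrite inE /intersection (bigD1 H) ?inE //=.
exact: capvSl.
Qed.

Lemma max_flat_value_bounds : d%:Z - (arr_rk A)%:Z + 1 <= max_flat_value mu <= d%:Z + 1.
Proof.
apply/andP; split.
  have := max_flat_value_ge (flat_of finset.setT); rewrite top_flat_value; apply: le_trans.
  have dx : (\dim (intersection (finset.setT : {set hyps A})) <= d)%N.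
    by rewrite -[X in (_ <= X)%N](dimv_rV K) dimvS ?subvf.
  by rewrite /arr_rk /codim -subzn //; move: (\dim _) dx => a _; lia.
have [x ->] := max_flat_value_attained; rewrite flat_valueE.
have dx : (\dim (val x) <= d)%N by rewrite -[X in (_ <= X)%N](dimv_rV K) dimvS ?subvf.
by lia.
Qed.

(** The inequality is needed for arbitrary J, since initial segments of a sorted list need not be
    closed: passing from J to all hyperplanes containing its intersection keeps the dimension and
    can only lower the number of columns left out. *)
Lemma max_flat_value_nat : exists beta : nat, [/\ max_flat_value mu = beta.+1%:Z,
  forall J : {set hyps A}, (\dim (intersection J) <= beta +
      #|[set c : 'I_#|column mu| | ~~ (col_hyps c \subset J)]|)%N &
  exists U : {vspace 'rV[K]_d}, \dim U = (beta + #|unfit mu U|)%N].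
Proof.
have := max_flat_value_ge (flat_of finset.setT); rewrite top_flat_value => top.
exists (`|max_flat_value mu|%N.-1); set beta := _.-1.
have betaE : max_flat_value mu = beta.+1%:Z.
  by rewrite /beta; move: top; case: (max_flat_value mu) => [[|b]|b] //=; lia.
clearbody beta; split => // [J|].
  have := max_flat_value_ge (flat_of J); rewrite betaE flat_valueE /= => vJ.
  have sub : (#|unfit mu (intersection J)| <=
      #|[set c : 'I_#|column mu| | ~~ (col_hyps c \subset J)]|)%N.
    apply/subset_leq_card/fintype.subsetP => c; rewrite !inE; apply: contra => cJ.
    apply/fintype.subsetP => H /(fintype.subsetP cJ) HJ; rewrite inE /intersection (bigD1 H) //=.
    exact: capvSl.
  have {}vJ : (\dim (intersection J)).+1%:Z - #|unfit mu (intersection J)|%:Z <= beta.+1%:Z := vJ.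
  move: vJ sub; move: (\dim _) #|unfit mu (intersection J)| => a b vJ.
  move: #|_| => c; clear -vJ; lia.
have [x xE] := max_flat_value_attained; exists (val x).
by move: xE; rewrite betaE flat_valueE; move: (\dim _) #|_| => a b; clear; lia.
Qed.

End FlatValues.

Lemma free_row_free (F : fieldType) (n d : nat) (X : n.-tuple 'rV[F]_d) :
  free X = row_free (\matrix_(i < n) X`_i).
Proof.
have sumE (k : 'I_n -> F) : \sum_i k i *: X`_i = (\row_i k i) *m \matrix_(i < n) X`_i.
  by rewrite mulmx_sum_row; apply: eq_bigr => i _; rewrite rowK mxE.
apply/idP/idP => [/freeP fr|rf].
  rewrite -kermx_eq0; apply/eqP/row_matrixP => k; rewrite row0.
  set u := row k _; have uB : u *m \matrix_(i < n) X`_i = 0.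
    by apply/eqP; rewrite -sub_kermx row_sub.
  apply/rowP => i; rewrite [RHS]mxE; apply: (fr (fun i => u 0 i)); rewrite sumE -[RHS]uB.
  by congr (_ *m _); apply/rowP => j; rewrite mxE.
apply/freeP => k; rewrite sumE => kX i.
have : \row_i k i = 0 by apply: (row_free_inj rf); rewrite kX mul0mx.
by move=> /rowP/(_ i); rewrite !mxE.
Qed.

Section ExtendScalars.
Variables (K K' : fieldExtType rat) (iota : {rmorphism K -> K'}) (d : nat).
Implicit Types U V : {vspace 'rV[K]_d}.
Local Notation ext := (@extend_scalars K K' iota d).

Lemma mem_extend U v : v \in U -> map_mx iota v \in ext U.
Proof.
move=> /coord_vbasis ->; rewrite raddf_sum /=; apply: memv_suml => i _.
rewrite map_mxZ memvZ // memv_span //; apply/mapP; exists (vbasis U)`_i => //.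
by rewrite mem_nth // size_tuple.
Qed.

Lemma extend_sub U V : (U <= V)%VS -> (ext U <= ext V)%VS.
Proof.
move=> UV; apply/span_subvP => _ /mapP[v vU ->]; apply: mem_extend.
by apply: (subvP UV); apply: vbasis_mem.
Qed.

Lemma dim_extend U : \dim (ext U) = \dim U.
Proof.
pose X := [tuple of [seq map_mx iota v | v <- vbasis U]].
have : free X.
  rewrite free_row_free.
  have -> : \matrix_(i < \dim U) X`_i = map_mx iota (\matrix_(i < \dim U) (vbasis U)`_i).
    apply/row_matrixP => i; rewrite rowK -map_row rowK (nth_map 0) //.
    by rewrite size_tuple.
  by rewrite row_free_map -free_row_free (basis_free (vbasisP U)).
by rewrite /free => /eqP; rewrite size_tuple.
Qed.

Lemma extend_add U V : ext (U + V) = (ext U + ext V)%VS.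
Proof.
apply/eqP; rewrite eqEsubv; apply/andP; split; last first.
  by rewrite subv_add !extend_sub ?addvSl ?addvSr.
rewrite {1}/extend_scalars; apply/span_subvP => _ /mapP[v vUV ->].
have /memv_addP[u uU [w wV ->]] := vbasis_mem vUV.
by rewrite map_mxD memv_add ?mem_extend.
Qed.

(** One inclusion is clear; the dimensions agree because extension preserves dimensions and sums. *)
Lemma extend_cap U V : ext (U :&: V) = (ext U :&: ext V)%VS.
Proof.
apply/eqP; rewrite eqEdim subv_cap !extend_sub ?capvSl ?capvSr //=.
have := dimv_sum_cap (ext U) (ext V); rewrite -extend_add !dim_extend -(dimv_sum_cap U V).
by move/addnI ->.
Qed.

Lemma extend_subE U V : (ext U <= ext V)%VS = (U <= V)%VS.
Proof.
apply/idP/idP => [UV|]; last exact: extend_sub.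
have UVE : (U :&: V)%VS = U.
  by apply/eqP; rewrite eqEdim capvSl -!dim_extend extend_cap (capv_idPl UV) leqnn.
by rewrite -UVE capvSr.
Qed.

Lemma extend_inj : injective ext.
Proof.
by move=> U V UV; apply/eqP; rewrite eqEsubv -!extend_subE UV subvv.
Qed.

Lemma extend_full : ext fullv = fullv.
Proof. by apply/eqP; rewrite eqEdim subvf dim_extend !dimv_rV leqnn. Qed.

Variables (A : central_arrangement K d) (A' : central_arrangement K' d).
Hypothesis base_change : is_base_change iota A A'.

Lemma base_change_hyp_subproof (H : hyps A) : ext (val H) \in hyps A'.
Proof. by rewrite base_change; apply/imfsetP; exists (val H) => //; apply: valP. Qed.

Definition base_change_hyp (H : hyps A) : hyps A' := [` base_change_hyp_subproof H]%fset.

Lemma base_change_hyp_surj (H' : hyps A') : exists H, H' = base_change_hyp H.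
Proof.
have : val H' \in [fset ext H | H in hyps A]%fset by rewrite -base_change; apply: valP.
move=> /imfsetP[U /= UA H'U].
by exists [` UA]%fset; apply: val_inj.
Qed.

Lemma intersection_extend (J : {set hyps A}) :
  ext (intersection J) = intersection (base_change_hyp @: J).
Proof.
elim: {J}#|J| {-2}J (erefl #|J|) => [J /eqP|k IH J Jk].
  by rewrite cards_eq0 => /eqP ->; rewrite imset0 /intersection !big_set0 extend_full.
have /finset.set0Pn[H HJ] : J != finset.set0 by rewrite -cards_eq0 Jk.
move: Jk; rewrite (cardsD1 H J) HJ add1n => -[Jk].
rewrite -(finset.setD1K HJ) intersectionU1 extend_cap IH // imsetU1 intersectionU1 //.
Qed.

Lemma base_change_flat_subproof (x : flats A) : ext (val x) \in flats A'.
Proof. by have [J ->] := flatP x; rewrite intersection_extend intersection_flat. Qed.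

Definition base_change_flat (x : flats A) : flats A' := [` base_change_flat_subproof x]%fset.

Lemma base_change_flat_inj : injective base_change_flat.
Proof. by move=> x y /(congr1 val) /= /extend_inj xy; apply: val_inj. Qed.

Lemma base_change_flat_surj (x' : flats A') : exists x, x' = base_change_flat x.
Proof.
have [J' xJ'] := flatP x'; pose J := base_change_hyp @^-1: J'.
have JJ' : J' = base_change_hyp @: J.
  apply/finset.setP => H'; apply/idP/imsetP => [H'J|[H HJ ->]]; last by rewrite inE in HJ.
  by have [H H'H] := base_change_hyp_surj H'; exists H; rewrite // inE -H'H.
by exists (flat_of J); apply: val_inj; rewrite /= xJ' JJ' intersection_extend.
Qed.

Variables (mu : flats A -> nat) (mu' : flats A' -> nat).
Hypothesis same_mu : same_multiplicities iota mu mu'.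

Lemma base_change_flat_value (x : flats A) :
  flat_value mu' (base_change_flat x) = flat_value mu x.
Proof.
rewrite /flat_value /flat_rk /codim /= dim_extend; congr (_ - Posz _).
have bij : bijective base_change_flat.
  apply: inj_card_bij; first exact: base_change_flat_inj.
  have /choice[g gK] := base_change_flat_surj.
  by apply: (leq_card g); apply: can_inj (_ : cancel g base_change_flat) => y; rewrite -gK.
rewrite (reindex base_change_flat) /=; last exact: onW_bij.
apply: eq_big => [y|y _]; first by rewrite /flat_le /= extend_subE.
exact: same_mu.
Qed.

Lemma base_change_max_flat_value : max_flat_value mu' = max_flat_value mu.
Proof.
apply/le_anti/andP; split.
  have [x' ->] := max_flat_value_attained mu'; have [x ->] := base_change_flat_surj x'.
  by rewrite base_change_flat_value max_flat_value_ge.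
have [x ->] := max_flat_value_attained mu.
by rewrite -base_change_flat_value max_flat_value_ge.
Qed.

End ExtendScalars.

(** * The abscissa of convergence *)

Section DirichletConvergence.
Variables (RR : realType) (a : nat -> RR).
Hypothesis a_ge0 : forall m, 0 <= a m.

Local Open Scope classical_set_scope.

Definition abs_term (sigma : RR) (m : nat) : RR := a m.+1 * m.+1%:R `^ (- sigma).

Lemma abs_term_ge0 sigma m : 0 <= abs_term sigma m.
Proof. by rewrite mulr_ge0 ?powR_ge0. Qed.

Lemma expR_ln_powR (m : nat) (sigma : RR) :
  expR (- (sigma * ln (m.+1%:R : RR))) = m.+1%:R `^ (- sigma).
Proof. by rewrite /powR pnatr_eq0 /= mulNr. Qed.

Lemma dirichlet_termE (s : RR[i]) m :
  (a m.+1)%:C%C * dirichlet_pow m.+1 s =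
  let t := complex.Im s * ln (m.+1%:R : RR) in
  (abs_term (complex.Re s) m * cos t +i* (- (abs_term (complex.Re s) m * sin t)))%C.
Proof.
rewrite /dirichlet_pow expR_ln_powR /abs_term /=.
by apply/eqP; rewrite eq_complex /= !mul0r !subr0 !addr0 !mulrN !mulrA !eqxx.
Qed.

Lemma bounded_abs_cvg (u : nat -> RR) (sigma B : RR) :
  (forall X, \sum_(0 <= m < X) abs_term sigma m <= B) ->
  (forall m, `|u m| <= abs_term sigma m) -> cvgn (series u).
Proof.
move=> bnd ub; apply: normed_cvg; apply: nondecreasing_is_cvgn.
  by move=> k l; apply: (nondecreasing_series (u_ := fun j => `|u j|)) => *; exact: normr_ge0.
exists B => _ [X _ <-]; apply: le_trans (bnd X).
by apply: ler_sum => m _; exact: ub.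
Qed.

Lemma complex_cvg (x y : nat -> RR) : cvgn x -> cvgn y ->
  cvgn (fun m => (x m +i* y m)%C : RR[i]^o).
Proof.
move=> /cvg_ex[l xl] /cvg_ex[k yk]; apply/cvg_ex; exists (l +i* k)%C.
apply/cvgrPdist_lt => -[e e']; rewrite ltcE /= => /andP[/eqP e'0 e0].
have e2 : 0 < e / 2 by rewrite divr_gt0.
move/cvgrPdist_lt: xl => /(_ _ e2) xl; move/cvgrPdist_lt: yk => /(_ _ e2) yk.
near=> m; have xm : `|l - x m| < e / 2 by near: m.
have ym : `|k - y m| < e / 2 by near: m.
rewrite normc_def ltcE /= e'0 eqxx /=.
rewrite -[X in _ < X](gtr0_norm e0) -sqrtr_sqr ltr_sqrt ?exprn_gt0 //.
rewrite -(real_normK (num_real (l - x m))) -(real_normK (num_real (k - y m))).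
have := normr_ge0 (l - x m); have := normr_ge0 (k - y m); nra.
Unshelve. all: by end_near.
Qed.

(** Real and imaginary parts of the terms are dominated by [abs_term], which depends on the real
    part of s only. *)
Lemma bounded_dirichlet_converges (s : RR[i]) (B : RR) :
  (forall X, \sum_(0 <= m < X) abs_term (complex.Re s) m <= B) -> dirichlet_converges a s.
Proof.
move=> bnd; rewrite /dirichlet_converges.
pose t m := complex.Im s * ln (m.+1%:R : RR).
pose u m := abs_term (complex.Re s) m * cos (t m).
pose v m := - (abs_term (complex.Re s) m * sin (t m)).
have cu : cvgn (series u).
  apply: bounded_abs_cvg bnd _ => m; rewrite normrM (ger0_norm (abs_term_ge0 _ _)).
  by rewrite ler_piMr ?abs_term_ge0 // ler_norml cos_geN1 cos_le1.
have cv : cvgn (series v).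
  apply: bounded_abs_cvg bnd _ => m; rewrite normrN normrM (ger0_norm (abs_term_ge0 _ _)).
  by rewrite ler_piMr ?abs_term_ge0 // ler_norml sin_geN1 sin_le1.
suff -> : series (fun m => (a m.+1)%:C%C * dirichlet_pow m.+1 s : RR[i]^o) =
    (fun m => (series u m +i* series v m)%C) by exact: complex_cvg.
apply/funext => X; rewrite /series /=; elim: X => [|X IH]; first by rewrite !big_geq.
by rewrite !big_nat_recr //= IH dirichlet_termE; apply/eqP; rewrite eq_complex /= !eqxx.
Qed.

Lemma dirichlet_converges_bounded (sigma : RR) : dirichlet_converges a (sigma%:C)%C ->
  exists B, forall X, \sum_(0 <= m < X) abs_term sigma m <= B.
Proof.
move=> cv; have [M [_ /(_ (M + 1))]] := cvg_seq_bounded cv.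
rewrite ltrDl ltr01 => /(_ isT) bnd; exists (complex.Re (M + 1)) => X.
have := bnd X I; rewrite /=.
have -> : series (fun m => (a m.+1)%:C%C * dirichlet_pow m.+1 sigma%:C%C : RR[i]^o) X =
    (\sum_(0 <= m < X) abs_term sigma m)%:C%C.
  rewrite /series /=; elim: X => [|X IH]; first by rewrite !big_geq.
  rewrite !big_nat_recr //= IH dirichlet_termE /=; apply/eqP.
  by rewrite eq_complex /= !mul0r cos0 sin0 mulr1 mulr0 oppr0 addr0 !eqxx.
rewrite normc_def lecE /= => /andP[_]; rewrite expr0n /= addr0 sqrtr_sqr ger0_norm //.
by apply: sumr_ge0 => m _; exact: abs_term_ge0.
Qed.

End DirichletConvergence.

(** * Sums of powers of norms from counting estimates *)

Section NormSums.
Variables (RR : realType) (T : choiceType) (P : set T) (N : T -> nat).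
Hypothesis N_gt0 : forall I, P I -> (0 < N I)%N.
Hypothesis finP : forall X, finite_set [set I | P I /\ (N I <= X)%N].

Local Open Scope classical_set_scope.

Definition norm_leq (X : nat) : {fset T} := fset_set [set I | P I /\ (N I <= X)%N].

Lemma norm_leqP X I : reflect (P I /\ (N I <= X)%N) (I \in norm_leq X).
Proof. by rewrite /norm_leq in_fset_set //; apply: (iffP idP); rewrite in_setE. Qed.

(** [ask_zeta_coef] unfolds to this sum, with T the type of ideals. *)
Definition norm_sum (F : T -> RR) (m : nat) : RR := \sum_(I \in [set I | P I /\ N I = m]) F I.

Lemma finite_norm_eq m : finite_set [set I | P I /\ N I = m].
Proof. by apply: sub_finite_set (finP m) => I [PI NI]; split; rewrite ?NI. Qed.

Lemma norm_leq_sumE (F : T -> RR) X :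
  \sum_(0 <= m < X) norm_sum F m.+1 = \sum_(I <- norm_leq X) F I.
Proof.
elim: X => [|X IH].
  rewrite big_geq // big_seq big1 // => I /norm_leqP[/N_gt0]; lia.
rewrite big_nat_recr //= IH /norm_sum fsbig_finite; last exact: finite_norm_eq.
rewrite -big_cat; apply/perm_big/uniq_perm; rewrite ?fset_uniq //.
  rewrite cat_uniq !fset_uniq andbT /=; apply/hasPn => I.
  rewrite in_fset_set ?in_setE => [[PI NI]|]; last exact: finite_norm_eq.
  by apply/negP => /norm_leqP[_]; lia.
move=> I; rewrite mem_cat; apply/orP/norm_leqP => [[/norm_leqP[PI NI]|]|[PI NI]].
- by split=> //; lia.
- by rewrite in_fset_set ?in_setE => [[PI NI]|]; [split=> //; lia | exact: finite_norm_eq].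
have [NX|NX] := leqP (N I) X; [left; exact/norm_leqP | right].
rewrite in_fset_set ?in_setE; last exact: finite_norm_eq.
by split=> //; lia.
Qed.

Lemma powR2_gt0 (t : RR) : 0 < 2 `^ t. Proof. by rewrite powR_gt0. Qed.

Lemma powR_expn (k : nat) (t : RR) : (2 ^ k)%:R `^ t = (2 `^ t) ^+ k.
Proof. by rewrite natrX -powR_mulrn // -powRrM mulrC powRrM powR_mulrn ?powR_ge0. Qed.

Lemma powR_le_neg (x y t : RR) : 0 < x -> x <= y -> 0 <= t -> y `^ (- t) <= x `^ (- t).
Proof.
move=> x0 xy t0; have y0 := lt_le_trans x0 xy.
by rewrite !powRN lef_pV2 ?posrE ?powR_gt0 // ge0_ler_powR ?nnegrE // ltW.
Qed.

Lemma sum_seq_const (s : seq T) (c : RR) : \sum_(I <- s) c = (size s)%:R * c.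
Proof. by rewrite big_const_seq count_predT iter_addr_0 mulr_natl. Qed.

Section Upper.
Variable C : nat.
Hypothesis C_count : forall (X : nat) (s : seq T), uniq s ->
  (forall I, I \in s -> P I /\ (N I <= X)%N) -> (size s <= C * X)%N.

(** The dyadic block of norms near 2^j has at most C * 2^(j+1) members, each contributing at most
    2^(-jt), which gives a geometric series of ratio 2^(1-t). *)
Lemma norm_sum_bounded (t : RR) : 1 < t ->
  exists B, forall X, \sum_(I <- norm_leq X) (N I)%:R `^ (- t) <= B.
Proof.
move=> t1; pose r : RR := 2 `^ (1 - t).
have r1 : r < 1 by rewrite /r /powR pnatr_eq0 /= expR_lt1 pmulr_llt0 ?ln_gt0 ?ltr1n // subr_lt0.
have r0 : 0 < r by exact: powR2_gt0.
exists ((2 * C)%:R / (1 - r)) => X.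
rewrite big_seq (partition_big (fun I => inord (trunc_log 2 (N I)) : 'I_X.+1) xpredT) //=.
apply: le_trans (geometric_le_lim X.+1 (ler0n _ _) r0 _); last by rewrite gtr0_norm.
rewrite /series /= big_mkord; apply: ler_sum => j _.
set s := [seq I <- norm_leq X | trunc_log 2 (N I) == j].
have sP I : I \in s -> [/\ P I, (2 ^ j <= N I)%N & (N I <= 2 ^ j.+1)%N].
  rewrite mem_filter => /andP[/eqP <- /norm_leqP[PI NX]].
  by have /andP[n1 n2] := trunc_log_bounds (isT : (1 < 2)%N) (N_gt0 PI); split=> //; exact: ltnW.
have -> : \sum_(I <- norm_leq X | (I \in norm_leq X) && (inord (trunc_log 2 (N I)) == j))
    (N I)%:R `^ (- t) = \sum_(I <- s) (N I)%:R `^ (- t) :> RR.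
  rewrite /s big_filter big_seq_cond [RHS]big_seq_cond; apply: eq_bigl => I.
  case: (boolP (I \in norm_leq X)) => //= /norm_leqP[PI NX].
  rewrite -val_eqE /= inordK // ltnS; apply: leq_trans NX; apply: ltnW.
  by apply: leq_trans (ltn_expl _ (isT : (1 < 2)%N)) (trunc_logP _ (N_gt0 PI)).
apply: (@le_trans _ _ (\sum_(I <- s) (2 ^ j)%:R `^ (- t))).
  rewrite big_seq [X in _ <= X]big_seq; apply: ler_sum => I /sP[_ n1 _].
  by apply: powR_le_neg; rewrite ?ltr0n ?expn_gt0 ?ler_nat //; lra.
have size_s : (size s <= C * 2 ^ j.+1)%N.
  by apply: C_count; [exact/filter_uniq/fset_uniq | move=> I /sP[]].
rewrite sum_seq_const.
apply: (@le_trans _ _ ((C * 2 ^ j.+1)%:R * (2 ^ j)%:R `^ (- t))).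
  by rewrite ler_wpM2r ?powR_ge0 // ler_nat.
rewrite /r powRD; last by rewrite pnatr_eq0 implybT.
rewrite powRr1 // exprMn powR_expn !natrM natrX exprS le_eqVlt.
by apply/orP; left; apply/eqP; ring.
Qed.

End Upper.

Section Lower.
Variables m C : nat.
Hypothesis m_gt0 : (0 < m)%N.
Hypothesis C_gt0 : (0 < C)%N.
Hypothesis C_count : forall x, (0 < x)%N -> exists s : seq T, [/\ uniq s,
  forall I, I \in s -> P I /\ (N I <= C * x ^ m)%N &
  (x ^ m <= size s * (C * (trunc_log 2 x).+1 ^ m))%N].

(** The count at x = 2^j would bound 2^(uj), with u = m * (1 - t) > 0, by a constant times (j + 1)^m
    for all j. *)
Lemma norm_sum_unbounded (t M : RR) : 0 <= t -> t < 1 ->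
  exists X, M < \sum_(I <- norm_leq X) (N I)%:R `^ (- t).
Proof.
move=> t0 t1; apply: contrapT => nex.
have {nex} bnd X : \sum_(I <- norm_leq X) (N I)%:R `^ (- t) <= M.
  by rewrite leNgt; apply/negP => MX; apply: nex; exists X.
have M0 : 0 <= M by apply: le_trans (bnd 0%N); apply: sumr_ge0 => *; exact: powR_ge0.
pose u : RR := m%:R * (1 - t); have u0 : 0 < u by rewrite mulr_gt0 ?ltr0n //; lra.
have step j : (2 `^ u) ^+ j <= M * C%:R `^ t * (C * j.+1 ^ m)%:R.
  have [s [us sP sz]] := C_count (expn_gt0 2 j); rewrite trunc_expnK // in sz.
  have sX : {subset s <= norm_leq (C * (2 ^ j) ^ m)} by move=> I /sP ?; exact/norm_leqP.
  have sM : (size s)%:R * (C * (2 ^ j) ^ m)%:R `^ (- t) <= M.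
    apply: le_trans (bnd (C * (2 ^ j) ^ m)%N).
    rewrite (bigID (mem s)) /= -[X in X <= _]addr0; apply: lerD; last first.
      by apply: sumr_ge0 => *; exact: powR_ge0.
    rewrite -big_filter (perm_big s); last first.
      apply: uniq_perm; rewrite ?filter_uniq ?fset_uniq // => I; rewrite mem_filter.
      by apply/andb_idr; exact: sX.
    rewrite -sum_seq_const big_seq [X in X <= _]big_seq; apply: ler_sum => I /sP[PI NI].
    by apply: powR_le_neg; rewrite ?ltr0n ?N_gt0 ?ler_nat.
  have CE : (C * (2 ^ j) ^ m)%:R `^ t = C%:R `^ t * ((2 `^ t) ^+ (j * m)) :> RR.
    by rewrite natrM powRM // -expnM powR_expn.
  have C0 : 0 < C%:R `^ t :> RR by apply: powR_gt0; rewrite ltr0n.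
  have D0 : 0 < (2 `^ t : RR) ^+ (j * m) by rewrite exprn_gt0 ?powR2_gt0.
  rewrite powRN CE ler_pdivrMr ?mulr_gt0 // in sM.
  have uE : (2 `^ u) ^+ j * (2 `^ t) ^+ (j * m) = ((2 ^ j) ^ m)%:R :> RR.
    rewrite -expnM natrX -!powR_mulrn ?powR_ge0 // -!powRrM -powRD; last first.
      by rewrite pnatr_eq0 implybT.
    by congr (_ `^ _); rewrite /u natrM; ring.
  rewrite -(ler_pM2r D0) uE.
  apply: (@le_trans _ _ ((size s * (C * j.+1 ^ m))%:R)); first by rewrite ler_nat.
  rewrite natrM; apply: le_trans (ler_wpM2r _ sM) _ => //.
  by rewrite le_eqVlt; apply/orP; left; apply/eqP; ring.
(* As u * K >= 2, at j = K * i the left side is at least 4^i, while the polynomial is O(2^i); so 2^i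
   would be bounded. *)
pose K := (Num.Def.archi_bound (2 / u)).
have K2 : 2 <= u * K%:R.
  have := archi_boundP (_ : 0 <= 2 / u); rewrite -/K => /(_ (divr_ge0 _ (ltW u0))).
  by rewrite ltr_pdivrMr // [K%:R * u]mulrC => h; exact/ltW/h.
have [B [B0 BP]] := poly_leq_exp2 m.
pose M' := M * C%:R `^ t * (C * (K.+1 ^ m * B))%:R.
have big i : (2 ^ i)%:R <= M'.
  have i2 : 0 < 2 ^+ i :> RR by rewrite exprn_gt0.
  rewrite natrX -(ler_pM2r i2).
  apply: (@le_trans _ _ ((2 `^ u) ^+ (K * i))).
    rewrite -exprMn [X in _ <= X]exprM lerXn2r ?nnegrE ?exprn_ge0 ?powR_ge0 //.
    rewrite -[X in _ <= X]powR_mulrn ?powR_ge0 // -powRrM.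
    rewrite -[X in X <= _](powR_mulrn 2 (_ : 0 <= 2)) //.
    by rewrite ler_powR // ler1n.
  apply: le_trans (step _) _; rewrite /M' -[X in _ <= X]mulrA ler_wpM2l ?mulr_ge0 ?powR_ge0 //.
  rewrite -natrX -natrM ler_nat -!mulnA leq_mul2l; apply/orP; right.
  apply: (@leq_trans (K.+1 ^ m * i.+1 ^ m)%N); first by rewrite -expnMn leq_exp2r //; nia.
  by rewrite leq_mul2l BP orbT.
have M'0 : 0 <= M' by apply: le_trans (big 0%N).
have := archi_boundP M'0; rewrite ltNge => /negP; apply.
by apply: le_trans (big (Num.Def.archi_bound M')); rewrite ler_nat ltnW // ltn_expl.
Qed.

End Lower.

End NormSums.

Section NormAbscissa.
Variables (RR : realType) (T : choiceType) (P : set T) (N : T -> nat) (F : T -> RR) (b : nat).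
Hypothesis N_gt0 : forall I, P I -> (0 < N I)%N.
Hypothesis count_upper : exists C : nat, forall (X : nat) (s : seq T), uniq s ->
  (forall I, I \in s -> P I /\ (N I <= X)%N) -> (size s <= C * X)%N.
Hypothesis count_lower : exists m C : nat, [/\ (0 < m)%N, (0 < C)%N &
  forall x, (0 < x)%N -> exists s : seq T, [/\ uniq s,
  forall I, I \in s -> P I /\ (N I <= C * x ^ m)%N &
  (x ^ m <= size s * (C * (trunc_log 2 x).+1 ^ m))%N]].
Hypothesis F_ge0 : forall I, 0 <= F I.
Hypothesis F_upper : forall p, (0 < p)%N -> exists C : nat, forall I, P I ->
  F I ^+ p <= (C * N I ^ (p * b).+1)%:R.
Hypothesis F_lower : exists2 C : nat, (0 < C)%N & forall I, P I -> (N I ^ b)%:R <= C%:R * F I.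

Local Open Scope classical_set_scope.

Let finP X : finite_set [set I | P I /\ (N I <= X)%N].
Proof.
have [C HC] := count_upper.
by apply: (@bounded_uniq_finite _ _ (C * X)) => s us sX; exact: HC.
Qed.

Let a := norm_sum P N F.

Let a_ge0 m : 0 <= a m.
Proof. by rewrite /a /norm_sum fsumr_ge0. Qed.

Let abs_sumE sigma X : \sum_(0 <= m < X) abs_term a sigma m =
  \sum_(I <- norm_leq P N X) F I * (N I)%:R `^ (- sigma).
Proof.
rewrite -norm_leq_sumE //; apply: eq_bigr => m _.
rewrite /abs_term /a /norm_sum !fsbig_finite; try exact: finite_norm_eq.
rewrite mulr_suml big_seq [RHS]big_seq; apply: eq_bigr => I.
by rewrite in_fset_set ?in_setE => [[_ ->]|]; last exact: finite_norm_eq.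
Qed.

Lemma dirichlet_converges_above (s : RR[i]) : b.+1%:R < complex.Re s -> dirichlet_converges a s.
Proof.
set sigma := complex.Re s => bs.
(* p is large enough that 1/p < sigma - (b + 1), so the exponent t below still exceeds 1. *)
pose p := (Num.Def.archi_bound (2 / (sigma - b.+1%:R))).+1.
have pE : p%:R^-1 < sigma - b.+1%:R.
  have e0 : 0 < sigma - b.+1%:R by rewrite subr_gt0.
  have := archi_boundP (divr_ge0 (ler0n _ 2) (ltW e0)); rewrite ltr_pdivrMr // => h.
  rewrite invf_plt ?posrE // -[X in X < _]mul1r ltr_pdivrMr //.
  apply: lt_trans (_ : 1 < 2) _; first by rewrite ltr1n.
  by apply: lt_trans h _; rewrite ltr_pM2r // ltr_nat.
have [C HC] := F_upper (ltn0Sn _ : (0 < p)%N); have [D HD] := count_upper.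
pose t := sigma - b%:R - p%:R^-1.
have t1 : 1 < t by rewrite /t; move: pE; rewrite -addn1 natrD; lra.
have [B HB] := norm_sum_bounded N_gt0 finP HD t1.
apply: (@bounded_dirichlet_converges _ _ a_ge0 _ (C.+1%:R * B)) => X.
rewrite abs_sumE; apply: le_trans (ler_wpM2l (ler0n _ _) (HB X)).
rewrite mulr_sumr big_seq [X in _ <= X]big_seq; apply: ler_sum => I /norm_leqP-/(_ finP)[PI _].
have N0 : 0 < (N I)%:R :> RR by rewrite ltr0n N_gt0.
have N00 : ((N I)%:R != 0 :> RR) by rewrite gt_eqF.
have -> : - t = (b%:R + p%:R^-1) + - sigma by rewrite /t; ring.
rewrite powRD ?N00 ?implybT // mulrA ler_wpM2r ?powR_ge0 //.
rewrite -(@ler_pXn2r _ p) ?nnegrE ?mulr_ge0 ?powR_ge0 //.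
apply: le_trans (HC I PI) _; rewrite exprMn -[X in _ <= _ * X]powR_mulrn ?powR_ge0 //.
rewrite -powRrM (_ : (b%:R + p%:R^-1) * p%:R = (p * b).+1%:R); last first.
  by rewrite mulrDl mulVf ?pnatr_eq0 // -addn1 natrD natrM mulrC.
rewrite powR_mulrn // natrM natrX ler_wpM2r ?exprn_ge0 //.
(* C <= (C + 1)^p, so C + 1 replaces a p-th root of C. *)
rewrite -natrX ler_nat; apply: leq_trans (leqnSn C) _; rewrite -{1}(expn1 C.+1) leq_pexp2l //.
Qed.

Lemma dirichlet_diverges_below (sigma : RR) : b%:R <= sigma -> sigma < b.+1%:R ->
  ~ dirichlet_converges a (sigma%:C)%C.
Proof.
move=> bs sb /(dirichlet_converges_bounded a_ge0)[B HB].
have [m [C [m0 C0 HC]]] := count_lower; have [D D0 HD] := F_lower.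
have t0 : 0 <= sigma - b%:R by rewrite subr_ge0.
have t1 : sigma - b%:R < 1 by move: sb; rewrite -addn1 natrD; lra.
have [X] := norm_sum_unbounded N_gt0 finP m0 C0 HC (D%:R * B) t0 t1.
rewrite ltNge => /negP; apply; apply: le_trans (ler_wpM2l (ler0n _ D) (HB X)).
rewrite abs_sumE mulr_sumr big_seq [X in _ <= X]big_seq; apply: ler_sum => I.
move=> /norm_leqP-/(_ finP)[PI _].
have N0 : 0 < (N I)%:R :> RR by rewrite ltr0n N_gt0.
have N00 : ((N I)%:R != 0 :> RR) by rewrite gt_eqF.
rewrite opprB powRD ?N00 ?implybT // powR_mulrn // mulrA ler_wpM2r ?powR_ge0 //.
by rewrite -natrX HD.
Qed.

Lemma norm_abscissa : abscissa_of_convergence a = (b.+1%:R)%:E.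
Proof.
apply/eqP; rewrite eq_le; apply/andP; split.
  by apply: ereal_inf_lbound; exists b.+1%:R => // s; exact: dirichlet_converges_above.
apply: le_ereal_inf_tmp => _ [c cP <-]; rewrite lee_fin leNgt; apply/negP => cb.
(* A point right of c, at least b and below b + 1, where convergence is assumed and divergence is
   known. *)
pose sigma : RR := (Num.max c b%:R + b.+1%:R) / 2.
have b1 : b.+1%:R = b%:R + 1 :> RR by rewrite -addn1 natrD.
have cm : c <= Num.max c b%:R by rewrite le_max lexx.
have bm : b%:R <= Num.max c b%:R by rewrite le_max lexx orbT.
have mb : Num.max c b%:R < b.+1%:R by rewrite gt_max cb b1 ltrDl ltr01.
apply: (@dirichlet_diverges_below sigma); rewrite ?/sigma; try lra.
by apply: cP => /=; rewrite /sigma; lra.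
Qed.

End NormAbscissa.

Lemma ask_finite (RR : realType) (R : comNzRingType) (S : finComPzRingType)
    (phi : {rmorphism R -> S}) (n d e : nat) (M : 'M[mpoly.mpoly n R]_(d, e)) :
  ask RR phi M = (#|S|%:R ^+ n)^-1 *
    #|[set vz : 'rV[S]_d * 'rV[S]_n | vz.1 *m specialise phi M vz.2 == 0]|%:R.
Proof.
rewrite /ask ncard_finType; congr ((_%:R ^+ n)^-1 * _).
  by apply: eq_card => x; rewrite !inE in_setT.
rewrite fsbig_finite; last exact: finite_finset.
rewrite (perm_big (enum 'rV[S]_n)) /=; last first.
  apply: uniq_perm; rewrite ?fset_uniq ?enum_uniq // => z.
  by rewrite in_fset_set ?in_setT ?mem_enum //; exact: finite_finset.
rewrite big_enum /= -sum1_card (partition_big snd xpredT) //= natr_sum.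
apply: eq_bigr => z _; congr (_%:R); rewrite ncard_finType.
rewrite -sum1_card (reindex_onto (fun v => (v, z)) fst) /=; last first.
  by move=> [v z'] /andP[_ /eqP /= ->].
apply: eq_bigl => v; rewrite !inE /= !eqxx !andbT.
by apply/idP/idP => [|/eqP vz]; rewrite in_setE /=; first by move=> ->; rewrite eqxx.
Qed.

Section ArrangementAbscissa.
Variables (RR : realType) (K : fieldExtType rat) (d : nat).
Variables (A : central_arrangement K d) (mu : flats A -> nat).
Local Notation O := (ring_of_integers K).
Local Notation n := #|variable mu|.

Lemma ask_solutions (I : ideal O) (f : fin_quot I) :
  ask RR (quotient_map I) (arr_matrix mu) =
  ((ideal_norm I)%:R ^+ n)^-1 * #|solutions mu (fin_quot_map f)|%:R.
Proof. rewrite (fin_quot_ncard f); exact: (ask_finite RR (fin_quot_map f)). Qed.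

Lemma ask_ge0 (I : ideal O) : 0 <= ask RR (quotient_map I) (arr_matrix mu).
Proof. by rewrite mulr_ge0 ?invr_ge0 ?exprn_ge0 // fsumr_ge0. Qed.

Lemma arr_abscissaE : arr_abscissa mu RR = (max_flat_value mu)%:~R%:E.
Proof.
have [b [-> b_bound [U UE]]] := max_flat_value_nat mu.
apply: norm_abscissa => //.
- by move=> I /nonzero_fin_quot/ideal_norm_gt0.
- exact: number_field_ideal_count_upper.
- have [m [h H]] := ring_of_integers_heights K.
  have [C [C0 HC]] := ideal_count_lower H (@ring_of_integers_mulf_eq0 K).
  by exists m, C; split=> //; exact: height_dim_gt0 H.
- exact: ask_ge0.
(* Dividing by the p-th power of N^n lowers the exponent p * (n + b) + 1 to p * b + 1. *)
- move=> p p0; have [C HC] := solutions_upper b_bound p0; exists C => I nI.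
  have f := nonzero_fin_quot nI; have N0 : 0 < (ideal_norm I)%:R :> RR.
    by rewrite ltr0n ideal_norm_gt0.
  rewrite (ask_solutions f) exprMn exprVn mulrC ler_pdivrMr ?exprn_gt0 //.
  rewrite -exprM -!natrX -natrM ler_nat; apply: leq_trans (HC I f nI) _.
  by rewrite -mulnA -expnD mulnDr [(n * p)%N]mulnC addnC addSn.
have [C [C0 HC]] := solutions_lower mu U; exists C => // I nI.
have f := nonzero_fin_quot nI; have N0 : (0 < ideal_norm I)%N by exact: ideal_norm_gt0.
rewrite (ask_solutions f) mulrA mulrAC ler_pdivlMr ?exprn_gt0 ?ltr0n //.
rewrite -natrX -!natrM ler_nat -expnD.
have u0 : (0 < ideal_norm I ^ #|unfit mu U|)%N by rewrite expn_gt0 N0.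
rewrite -(leq_pmul2r u0) -expnD -mulnA.
by apply: leq_trans (HC I f); rewrite UE addnAC.
Qed.

End ArrangementAbscissa.

Theorem theorem1p7 (RR : realType) (K : fieldExtType rat) (d : nat)
    (A : central_arrangement K d) (mu : flats A -> nat) :
  [/\ exists2 n : nat, (0 < n)%N & arr_abscissa mu RR = n%:R%:E,
      arr_abscissa mu RR = (max_flat_value mu)%:~R%:E,
      d%:Z - (arr_rk A)%:Z + 1 <= max_flat_value mu <= d%:Z + 1 &
      forall (K' : fieldExtType rat) (iota : {rmorphism K -> K'})
             (A' : central_arrangement K' d) (mu' : flats A' -> nat),
        is_base_change iota A A' -> same_multiplicities iota mu mu' ->
        arr_abscissa mu' RR = arr_abscissa mu RR].
Proof.
split.
- have [b [bE _ _]] := max_flat_value_nat mu.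
  by exists b.+1; rewrite // arr_abscissaE bE.
- exact: arr_abscissaE.
- exact: max_flat_value_bounds.
move=> K' iota A' mu' base_change same_mu.
by rewrite !arr_abscissaE (base_change_max_flat_value base_change same_mu).
Qed.
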